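(* Let $\{G^{(n)}\}_{n\ge 1}$ be a fixed sequence of undirected signed graphs, $G^{(n)}=(V,E,W)$ having $n$ edges. Assume: (A1) there is $L_-<\infty$ such that every negative edge of every $G^{(n)}$ has embeddedness at most $L_-$; (A2) $\sup_{i\in E}\varepsilon_i^2=o(n)$; (A3) for all $l_1,\dots,l_5\in\{0,\dots,L_-\}$ the quantities $$\frac1n\sum_{(i,j,k)\in E_{l_1}\times E_{l_2}\times E_{l_3}}\triangle_{ijk},\qquad \frac1n\sum_{i\in E_{l_1}}\Big(\sum_{(j,k)\in E_{l_2}\times E_{l_3}}\triangle_{ijk}\Big)\Big(\sum_{(j',k')\in E_{l_4}\times E_{l_5}}\triangle_{ij'k'}\Big)$$ converge to a limit as $n\to\infty$, and $p_l=m_l/n_l$ converges to a limit as $n\to\infty$. Let $U^{(n)}_\pi$ be the number of unbalanced triangles under the stratified permutation model $G^{(n)}_\pi$, and $V^{(n)}_p$ the number of unbalanced triangles under the independent-sign model $G_p^{(n)}$. Then, as $n\to\infty$, $$n^{-1/2}\big(U^{(n)}_\pi-\mathbb E(V^{(n)}_p)\big)\xrightarrow{\mathcal D}\mathcal N(0,\sigma_u^2),$$ where $\sigma_u^2=\Sigma^s_{1,1}+\Sigma^s_{3,3}+2\Sigma^s_{1,3}$ and $$\Sigma^s=\Sigma_{\widetilde T,\widetilde T}-\Sigma_{\widetilde T,\widetilde M}\Sigma_{\widetilde M,\widetilde M}^{-1}\Sigma_{\widetilde T,\widetilde M}^{\top}.$$ Here $\Sigma_{\widetilde T,\widetilde T},\Sigma_{\widetilde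 T,\widetilde M},\Sigma_{\widetilde M,\widetilde M}$ are the blocks (indexed by $T$- and $M$-coordinates) of $\Sigma=\lim_{n\to\infty}\Sigma^{(n)}$, where $\Sigma^{(n)}$ is the covariance matrix of $(\widetilde T^{(n)},\widetilde M^{(n)})$.
   Context: A signed graph is $G=(V,E,W)$ with $(V,E)$ a finite undirected simple graph, $|E|=n$, and $W\in\{-1,+1\}^E$ the edge signs; an edge $i$ is negative if $W_i=-1$. $\triangle\subset E^3$ is the set of ordered triples of edges forming a triangle, $\triangle_{ijk}=1$ if $(i,j,k)\in\triangle$ and $0$ otherwise, and $\triangle'$ is the set of triples in $\triangle$ with $i<j<k$ (for a fixed order on $E$), so each triangle is counted once. A triangle is unbalanced if the product of its three edge signs is $-1$. The embeddedness of an edge $i$ is $\varepsilon_i=\frac12\sum_{(j,k)\in E^2}\triangle_{ijk}$, the number of triangles containing $i$. $E_l$ is the set of edges of embeddedness $l$, $n_l=|E_l|$, $m_l=|\{i\in E_l: W_i=-1\}|$, $p_l=m_l/n_l$. All of these depend on $n$ for a sequence $G^{(n)}$. Stratified permutation model: let $L$ be the maximal embeddedness in $G$; $\pi=\tau_L\circ\dots\circ\tau_1$, where $\tau_l$ are independent, $\tau_l$ being a uniformly random permutation of $E_l$ fixing all other edges. $G_\pi=(V,E,(W_{\pi(i)})_{i\in E})$ and $U_\pi=\sum_{(i,j,k)\in\triangle'}\mathbf 1\{W_{\pi(i)}W_{\pi(j)}W_{\pi(k)}=-1\}$. Independent-sign model: $G_p=(V,E,X)$ with $X_i$, $i\in E$,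 independent, $\mathbb P(X_i=-1)=p_{\varepsilon_i}$, $\mathbb P(X_i=1)=1-p_{\varepsilon_i}$. $V_p=\sum_{(i,j,k)\in\triangle'}\mathbf 1\{X_iX_jX_k=-1\}$. In $G_p^{(n)}$: $T^{(n)}_\alpha$ is the number of triangles with exactly $\alpha$ negative edges ($\alpha=1,2,3$), $T^{(n)}=(T_1^{(n)},T_2^{(n)},T_3^{(n)})$; $M_l^{(n)}$ is the number of negative edges of embeddedness $l$, $M^{(n)}=(M_0^{(n)},\dots,M_{L_-}^{(n)})$; $\widetilde T^{(n)}=n^{-1/2}(T^{(n)}-\mathbb E T^{(n)})$, $\widetilde M^{(n)}=n^{-1/2}(M^{(n)}-\mathbb E M^{(n)})$. Convention: coordinates $\widetilde M_l^{(n)}$ that are degenerate in the limit ($m_l/n\to0$, or more generally zero limiting variance) are removed from $\widetilde M^{(n)}$ before forming $\Sigma_{\widetilde M,\widetilde M}^{-1}$ and $\Sigma_{\widetilde T,\widetilde M}$. $\mathcal N(0,0)$ is the point mass at $0$.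
   Formalization: The existence of the limit Σ of the covariance matrices Σ^(n) is assumed as a hypothesis, because (A1)–(A3), with embeddedness indices only up to L_-, do not imply it; (A2) and (A3) are then not needed. *)

(* Defs.v *)
From HB Require Import structures.
From mathcomp Require Import all_boot all_order all_algebra all_fingroup.
From mathcomp Require Import all_classical all_reals all_analysis.
Set Implicit Arguments.
Unset Strict Implicit.
Unset Printing Implicit Defensive.
Import Order.TTheory GRing.Theory Num.Theory.
Import numFieldNormedType.Exports.

Local Open Scope classical_set_scope.
Local Open Scope ring_scope.

(* A finite simple graph is a set of two-element subsets of a finite vertex
   set; signs are encoded by booleans, [true] standing for -1. *)
Record signed_graph := SignedGraph {
  vertex : finType;
  edges : {set {set vertex}};
  edges_card2 : forall e, e \in edges -> #|e| = 2%N;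
  neg : {ffun {e : {set vertex} | e \in edges} -> bool}
}.

Definition edge (G : signed_graph) : finType :=
  {e : {set vertex G} | e \in edges G}.

Definition sgn (b : bool) : int := (-1) ^+ b.

Section Graph.
Variable G : signed_graph.
Implicit Types i j k : edge G.

Definition signing := {ffun edge G -> bool}.

Definition triangle i j k : bool :=
  [exists x : vertex G, exists y : vertex G, exists z : vertex G,
     [&& uniq [:: x; y; z], val i == [set x; y]%SET,
         val j == [set y; z]%SET & val k == [set x; z]%SET]].

(* The fixed order on edges is the order of their enumeration. *)
Definition triangles : {set edge G * edge G * edge G} :=
  [set t : edge G * edge G * edge G |
     [&& triangle t.1.1 t.1.2 t.2,
         (enum_rank t.1.1 < enum_rank t.1.2)%N &
         (enum_rank t.1.2 < enum_rank t.2)%N]]%SET.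

(* The halved sum is even: [triangle i j k = triangle i k j], and
   [triangle i j j] never holds. *)
Definition embeddedness i : nat :=
  (\sum_(p : edge G * edge G) triangle i p.1 p.2)%N./2.

Definition Eset (l : nat) : {set edge G} :=
  [set i : edge G | embeddedness i == l]%SET.

Definition max_embeddedness : nat := (\max_(i : edge G) embeddedness i)%N.

Definition nb_neg (l : nat) (s : signing) : nat :=
  #|[set i in Eset l | s i]%SET|.

Definition nb_unbalanced (s : signing) : nat :=
  #|[set t in triangles |
      sgn (s t.1.1) * sgn (s t.1.2) * sgn (s t.2) == -1]%SET|.

Definition nb_triangles_neg (a : nat) (s : signing) : nat :=
  #|[set t in triangles | (s t.1.1 + s t.1.2 + s t.2)%N == a]%SET|.

Variable R : realType.

Definition neg_frac (l : nat) : R := (nb_neg l (neg G))%:R / #|Eset l|%:R.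

Definition tri_density (l1 l2 l3 : nat) : R :=
  #|edge G|%:R^-1 *
  \sum_(i in Eset l1) \sum_(j in Eset l2) \sum_(k in Eset l3)
     (triangle i j k)%:R.

Definition tri_pair_density (l1 l2 l3 l4 l5 : nat) : R :=
  #|edge G|%:R^-1 *
  \sum_(i in Eset l1)
     (\sum_(j in Eset l2) \sum_(k in Eset l3) (triangle i j k)%:R) *
     (\sum_(j in Eset l4) \sum_(k in Eset l5) (triangle i j k)%:R).

End Graph.

Section FiniteProbability.
Variables (R : realType) (T : finType) (w : T -> R).

Definition fexp (X : T -> R) : R := \sum_t w t * X t.

Definition fcov (X Y : T -> R) : R :=
  fexp (fun t => (X t - fexp X) * (Y t - fexp Y)).

Definition fcdf (X : T -> R) (x : R) : R := \sum_(t | X t <= x) w t.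

End FiniteProbability.

Section Models.
Variables (R : realType) (G : signed_graph).

(* Index [l : 'I_L] carries the permutation tau_(l+1) of E_(l+1). *)
Definition strat_sample : finType :=
  {ffun 'I_(max_embeddedness G) -> {perm edge G}}.

Definition strat_pmf (tau : strat_sample) : R :=
  \prod_l (if tau l \in Sym (Eset G l.+1)
           then #|Sym (Eset G l.+1)|%:R^-1 else 0).

(* Since [(s * t)%g x = t (s x)], this product is tau_L o ... o tau_1. *)
Definition strat_perm (tau : strat_sample) : {perm edge G} :=
  (\prod_(l < max_embeddedness G) tau l)%g.

Definition U_strat (tau : strat_sample) : R :=
  (nb_unbalanced [ffun i => neg G (strat_perm tau i)])%:R.

Definition indep_pmf (x : signing G) : R :=
  \prod_i (if x i then neg_frac G R (embeddedness i)
           else 1 - neg_frac G R (embeddedness i)).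

Definition V_indep (x : signing G) : R := (nb_unbalanced x)%:R.

Definition T_vec (x : signing G) : 'rV[R]_3 :=
  \row_(a < 3) (nb_triangles_neg a.+1 x)%:R.

Definition M_vec (Lm : nat) (x : signing G) : 'rV[R]_(Lm.+1) :=
  \row_(l < Lm.+1) (nb_neg l x)%:R.

Definition rescale (m : nat) (Z : signing G -> 'rV[R]_m) (x : signing G) :
    'rV[R]_m :=
  \row_a ((Num.sqrt #|edge G|%:R)^-1 *
          (Z x ord0 a - fexp indep_pmf (fun y => Z y ord0 a))).

Definition TM_vec (Lm : nat) (x : signing G) : 'rV[R]_(3 + Lm.+1) :=
  row_mx (rescale T_vec x) (rescale (@M_vec Lm) x).

Definition cov_mx (Lm : nat) : 'M[R]_(3 + Lm.+1) :=
  \matrix_(a, b) fcov indep_pmf (fun x => TM_vec Lm x ord0 a)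
                                (fun x => TM_vec Lm x ord0 b).

End Models.

Section Limit.
Variables (R : realType) (Lm : nat) (Sigma : 'M[R]_(3 + Lm.+1)).

(* The M-coordinates with nonzero limiting variance. *)
Definition kept : {set 'I_Lm.+1} :=
  [set l : 'I_Lm.+1 | drsubmx Sigma l l != 0]%SET.

Definition Sigma_TM : 'M[R]_(3, #|kept|) :=
  colsub (fun l : 'I_#|kept| => enum_val l) (ursubmx Sigma).

Definition Sigma_MM : 'M[R]_#|kept| :=
  mxsub (fun l : 'I_#|kept| => enum_val l)
        (fun l : 'I_#|kept| => enum_val l) (drsubmx Sigma).

Definition Sigma_s : 'M[R]_3 :=
  ulsubmx Sigma - Sigma_TM *m invmx Sigma_MM *m Sigma_TM^T.

(* The indices [ord0] and [ord_max] stand for alpha = 1 and alpha = 3. *)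
Definition sigma_u2 : R :=
  Sigma_s ord0 ord0 + Sigma_s ord_max ord_max + 2 * Sigma_s ord0 ord_max.

End Limit.

(* N(0, v).  The second argument of [normal_prob] is the standard deviation,
   and [normal_prob 0 0] is not a point mass. *)
Definition gaussian (R : realType) (v : R) : set R -> \bar R :=
  if v == 0 then \d_(0 : R) else normal_prob 0 (Num.sqrt v).

(* Convergence of the distribution functions [F n] at every continuity point
   of the limiting distribution function. *)
Definition cvg_in_law (R : realType) (F : nat -> R -> R)
    (mu : set R -> \bar R) : Prop :=
  let cdf_mu := fun x : R => fine (mu [set` `]-oo, x]]) in
  forall x : R, {for x, continuous cdf_mu} ->
    (fun n => F n x) @ \oo --> cdf_mu x.

(* Main.v *)
(** Let [M_l] be the number of negative edges of embeddedness [l], and [m_l] its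
    value in the given graph, which is also its mean in the independent-sign model.
    The permutation model is the independent-sign model conditioned on [M = m].
    Since negative edges have embeddedness at most [Lm], the number [V] of
    unbalanced triangles is a sum of terms with bounded degree of dependence.

    Let [W] be [V - EV] minus its linear regression on [M]; then [W] is
    uncorrelated with every [M_l], and the limit of [Var W / n] is the Schur
    complement [sigma_u2]. Stein's method for local dependence gives
    [E[(h (W / sqrt n) - c) g]] -> 0, where [c] is the Gaussian mean of [h] and
    [g] is a smooth bump, supported in [delta]-balls, of [(M - m) / sqrt n]: the
    terms containing derivatives of [g] vanish because [Cov (W, M_l) = 0].
    The mean of [g] is bounded below since the law of [M] decreases in each
    coordinate away from [m]. On the support of [g], turning [M] into [m] by
    flipping one edge at a time changes [V] by [O(delta sqrt n)], so that the
    conditional mean given [M = m] is within [O(delta)] of [c]. *)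

Require Import Defs.
From HB Require Import structures.
From mathcomp Require Import all_boot all_order all_algebra all_fingroup.
From mathcomp Require Import all_classical all_reals all_analysis.
From mathcomp Require Import measurable_realfun.
From mathcomp Require Import zify ring lra.
Import Order.TTheory GRing.Theory Num.Theory.
Import numFieldNormedType.Exports.
Set Implicit Arguments.
Unset Strict Implicit.
Unset Printing Implicit Defensive.

Local Open Scope classical_set_scope.
Local Open Scope ring_scope.

(** * Expectations under finite product measures *)

(** The event [M = m] may have probability tending to 0, so convergence in law of the pair [(W, M)]
    says nothing by itself about [W] given [M = m]. The bump replaces this event by a window of
    width [delta * sqrt n] around [m], whose mass stays bounded below as [n] grows. Hence the order
    of limits: [n] to infinity at fixed [delta], then [delta] to 0.

    The lower bound on that mass is uniform in the variances of the counts. Chebyshev's inequality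
    puts half of the mass in a box of side of order [sqrt n]; contracting this box toward [m] by a
    fixed factor merges boundedly many points and can only increase their probabilities.

    Some [M_l] may have vanishing limiting variance. Flipping one edge of low embeddedness changes
    [V] by at most a constant [d], which gives [|Cov (V, M_l)| <= d * Var M_l]. This keeps the
    regression coefficients bounded, and it makes the degenerate levels drop out of the limiting
    variance. *)

Section Expectation.
Variables (R : realType) (T : finType) (w : T -> R).
Hypotheses (w0 : forall t, 0 <= w t) (w1 : \sum_t w t = 1).
Implicit Types X Y : T -> R.
Local Notation E := (fexp w).

Lemma eq_fexp X Y : X =1 Y -> E X = E Y.
Proof. by move=> XY; apply: eq_bigr => t _; rewrite XY. Qed.

Lemma fexpD X Y : E (fun t => X t + Y t) = E X + E Y.
Proof. by rewrite -big_split; apply: eq_bigr => t _; rewrite mulrDr. Qed.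

Lemma fexpZ c X : E (fun t => c * X t) = c * E X.
Proof. by rewrite big_distrr; apply: eq_bigr => t _; rewrite /= mulrCA. Qed.

Lemma fexpN X : E (fun t => - X t) = - E X.
Proof. by rewrite -sumrN; apply: eq_bigr => t _; rewrite mulrN. Qed.

Lemma fexpB X Y : E (fun t => X t - Y t) = E X - E Y.
Proof. by rewrite fexpD fexpN. Qed.

Lemma fexp_sum (A : Type) (r : seq A) (P : pred A) (F : A -> T -> R) :
  E (fun t => \sum_(a <- r | P a) F a t) = \sum_(a <- r | P a) E (F a).
Proof.
by rewrite exchange_big; apply: eq_bigr => t _; rewrite /= big_distrr.
Qed.

Lemma fexp_cst c : E (fun=> c) = c.
Proof. by rewrite /fexp -big_distrl /= w1 mul1r. Qed.

Lemma le_fexp X Y : (forall t, X t <= Y t) -> E X <= E Y.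
Proof. by move=> XY; apply: ler_sum => t _; rewrite ler_wpM2l. Qed.

Lemma fexp_ge0 X : (forall t, 0 <= X t) -> 0 <= E X.
Proof. by move=> X0; apply: sumr_ge0 => t _; rewrite mulr_ge0. Qed.

Lemma ler_norm_fexp X : `|E X| <= E (fun t => `|X t|).
Proof.
apply: (le_trans (ler_norm_sum _ _ _)); apply: ler_sum => t _.
by rewrite normrM ger0_norm.
Qed.

Lemma fexp_le_bound X c : (forall t, `|X t| <= c) -> `|E X| <= c.
Proof.
move=> Xc; apply: (le_trans (ler_norm_fexp X)).
by rewrite -[leRHS]fexp_cst; apply: le_fexp.
Qed.

Lemma eq_fexp_supp X Y : (forall t, w t != 0 -> X t = Y t) -> E X = E Y.
Proof.
move=> XY; apply: eq_bigr => t _.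
by have [->|/XY->//] := eqVneq (w t) 0; rewrite !mul0r.
Qed.

Lemma fcov_ge0 X : 0 <= fcov w X X.
Proof. by apply: fexp_ge0 => t; rewrite -expr2 sqr_ge0. Qed.

Lemma fcovE X Y : fcov w X Y = E (fun t => X t * Y t) - E X * E Y.
Proof.
rewrite /fcov (eq_fexp (Y := fun t => X t * Y t - E Y * X t - E X * Y t
  + E X * E Y)); last by move=> t; ring.
by rewrite fexpD !fexpB !fexpZ fexp_cst; ring.
Qed.

Lemma sqr_fexp_le X : E X ^+ 2 <= E (fun t => X t ^+ 2).
Proof.
have := fcov_ge0 X; rewrite fcovE -expr2 subr_ge0 => /le_trans; apply.
by rewrite (eq_fexp (Y := fun t => X t ^+ 2)) // => t; rewrite expr2.
Qed.

Lemma fexp_norm_le_sqrt X : E (fun t => `|X t|) <= Num.sqrt (E (fun t => X t ^+ 2)).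
Proof.
rewrite -[leLHS]ger0_norm ?fexp_ge0 // -sqrtr_sqr; apply: ler_wsqrtr.
apply: (le_trans (sqr_fexp_le _)); apply: le_fexp => t.
by rewrite real_normK ?num_real.
Qed.

Lemma fcovC X Y : fcov w X Y = fcov w Y X.
Proof. by apply: eq_fexp => t; rewrite mulrC. Qed.

Lemma eq_fcov X X' Y Y' : X =1 X' -> Y =1 Y' -> fcov w X Y = fcov w X' Y'.
Proof.
move=> XX' YY'; rewrite /fcov (eq_fexp XX') (eq_fexp YY').
by apply: eq_fexp => t; rewrite XX' YY'.
Qed.

Lemma fcovDl X Y Z : fcov w (fun t => X t + Y t) Z = fcov w X Z + fcov w Y Z.
Proof. by rewrite /fcov -fexpD fexpD; apply: eq_fexp => t; ring. Qed.

Lemma fcovZl c X Z : fcov w (fun t => c * X t) Z = c * fcov w X Z.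
Proof. by rewrite /fcov -fexpZ fexpZ; apply: eq_fexp => t; ring. Qed.

Lemma fcov_suml (A : Type) (r : seq A) (P : pred A) (F : A -> T -> R) Z :
  fcov w (fun t => \sum_(a <- r | P a) F a t) Z
  = \sum_(a <- r | P a) fcov w (F a) Z.
Proof.
rewrite /fcov -fexp_sum fexp_sum; apply: eq_fexp => t.
by rewrite -sumrB big_distrl.
Qed.

Lemma fcov_cstl c Z : fcov w (fun=> c) Z = 0.
Proof.
rewrite /fcov fexp_cst (eq_fexp (Y := fun=> 0)) ?fexp_cst // => t.
by rewrite subrr mul0r.
Qed.

Lemma fcov_sumr (A : Type) (r : seq A) (P : pred A) (F : A -> T -> R) Z :
  fcov w Z (fun t => \sum_(a <- r | P a) F a t)
  = \sum_(a <- r | P a) fcov w Z (F a).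
Proof. by rewrite fcovC fcov_suml; apply: eq_bigr => a _; rewrite fcovC. Qed.

Lemma fcov_bound X Y b c : (forall t, `|X t| <= b) -> (forall t, `|Y t| <= c) ->
  `|fcov w X Y| <= 4 * (b * c).
Proof.
move=> Xb Yc; apply: fexp_le_bound => t; rewrite normrM.
have -> : 4 * (b * c) = (b + b) * (c + c) by ring.
apply: ler_pM => //; apply: (le_trans (ler_normB _ _)); apply: lerD => //;
  exact: fexp_le_bound.
Qed.

Lemma markov_sqr X c : 0 < c ->
  c ^+ 2 * \sum_(t | c < `|X t|) w t <= E (fun t => X t ^+ 2).
Proof.
move=> c0; rewrite big_distrr /= big_mkcond /=; apply: ler_sum => t _.
case: ifP => [cX|_]; last by rewrite mulr_ge0 ?sqr_ge0.
rewrite mulrC ler_wpM2l // -[leRHS]real_normK ?num_real //.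
by rewrite lerXn2r ?nnegrE // ltW.
Qed.

End Expectation.

(** * Product Bernoulli measures and independence of functions of disjoint coordinates *)

Section ProductMeasure.
Variables (R : realType) (I : finType) (p : I -> R).
Hypothesis p01 : forall i, 0 <= p i <= 1.
Implicit Types (S : {set I}) (x y : {ffun I -> bool}).

Definition bernoulli_prod x : R := \prod_i (if x i then p i else 1 - p i).

Local Notation E := (fexp bernoulli_prod).

Lemma bernoulli_prod_ge0 x : 0 <= bernoulli_prod x.
Proof.
by apply: prodr_ge0 => i _; have /andP[? ?] := p01 i; case: ifP; rewrite ?subr_ge0.
Qed.

Lemma bernoulli_prod_sum : \sum_x bernoulli_prod x = 1.
Proof.
rewrite -(bigA_distr_bigA (fun i (b : bool) => if b then p i else 1 - p i)) /=.
by apply: big1 => i _; rewrite big_bool /= addrC subrK.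
Qed.

Definition depends_on S (T : Type) (F : {ffun I -> bool} -> T) :=
  forall x y, {in S, x =1 y} -> F x = F y.

Definition splice S x y : {ffun I -> bool} := [ffun i => if i \in S then x i else y i].

(* Splicing two independent copies of [x] along [S] preserves their joint law. *)
Lemma fexp_indep S (F H : {ffun I -> bool} -> R) :
  depends_on S F -> depends_on (~: S) H -> E (fun x => F x * H x) = E F * E H.
Proof.
move=> dF dH; rewrite {2 3}/fexp big_distrlr /= pair_big /=.
pose g (z : {ffun I -> bool} * {ffun I -> bool}) := (splice S z.1 z.2, splice S z.2
    z.1).
have gK : involutive g.
  move=> [x y]; rewrite /g /=; apply/eqP; rewrite xpair_eqE.
  by apply/andP; split; apply/eqP/ffunP => i; rewrite !ffunE; case: (i \in S).
rewrite (reindex_inj (inv_inj gK)) /=.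
under eq_bigr => z _.
  have -> : F (splice S z.1 z.2) = F z.1.
    by apply: dF => i iS; rewrite ffunE iS.
  have -> : H (splice S z.2 z.1) = H z.1.
    by apply: dH => i; rewrite inE ffunE => /negbTE->.
  rewrite mulrACA.
  have -> : bernoulli_prod (splice S z.1 z.2) * bernoulli_prod (splice S z.2 z.1)
     = bernoulli_prod z.1 * bernoulli_prod z.2.
    rewrite -!big_split; apply: eq_bigr => i _ /=; rewrite !ffunE.
    by case: (i \in S) => //; rewrite mulrC.
  over.
rewrite -(pair_big xpredT xpredT (fun x y =>
  bernoulli_prod x * bernoulli_prod y * (F x * H x))) /=.
apply: eq_bigr => x _.
under eq_bigr => y _ do rewrite mulrAC.
by rewrite -big_distrr /= bernoulli_prod_sum mulr1.
Qed.

Lemma depends_onS S1 S2 (T : Type) (F : {ffun I -> bool} -> T) : S1 \subset S2 ->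
  depends_on S1 F -> depends_on S2 F.
Proof. by move=> /fintype.subsetP sS dF x y xy; apply: dF => i /sS/xy. Qed.

Lemma fcov_indep S1 S2 (F H : {ffun I -> bool} -> R) : S2 \subset ~: S1 ->
  depends_on S1 F -> depends_on S2 H -> fcov bernoulli_prod F H = 0.
Proof.
move=> dS dF dH.
rewrite fcovE ?bernoulli_prod_sum // (fexp_indep dF) ?subrr //.
exact: depends_onS dH.
Qed.

End ProductMeasure.

(** * Variance of a sum of locally dependent terms *)

Section Incidence.
Variables (I A : finType) (S : A -> {set I}) (d k : nat).
Hypotheses (Hd : forall i, (\sum_a (i \in S a) <= d)%N)
           (Hk : forall a, (#|S a| <= k)%N).

Definition adj a b := [exists i, (i \in S a) && (i \in S b)].

Lemma adjC a b : adj a b = adj b a.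
Proof. by apply: eq_existsb => i; rewrite andbC. Qed.

Lemma adjN_sub a b : ~~ adj a b -> S b \subset ~: S a.
Proof.
move=> /existsPn nab; apply/fintype.subsetP => i ib; rewrite inE.
by apply/negP => ia; have := nab i; rewrite ia ib.
Qed.

Lemma sum_adj a : (\sum_b adj a b <= k * d)%N.
Proof.
apply: (@leq_trans (\sum_(i in S a) d)); last by rewrite sum_nat_const leq_mul2r Hk
    orbT.
apply: (@leq_trans (\sum_(i in S a) \sum_b (i \in S b)));
  last by apply: leq_sum.
rewrite exchange_big; apply: leq_sum => b _ /=.
case: (boolP (adj a b)) => // /existsP[i /andP[ia ib]].
by rewrite (bigD1 i) //= ib.
Qed.

(** Many indices may have empty support, as do the triples that are not triangles in the
    application; bounds must therefore grow with [#|I|] and not with [#|A|]. *)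
Lemma sum_nonempty : (\sum_a [exists i, i \in S a] <= #|I| * d)%N.
Proof.
apply: (@leq_trans (\sum_(i : I) d)); last by rewrite sum_nat_const.
apply: (@leq_trans (\sum_i \sum_b (i \in S b))%N); last by apply: leq_sum.
rewrite exchange_big; apply: leq_sum => b _ /=.
case: (boolP [exists i, i \in S b]) => // /existsP[i ib].
by rewrite (bigD1 i) //= ib.
Qed.

Lemma sum_adj_all : (\sum_a \sum_b adj a b <= #|I| * d * (k * d))%N.
Proof.
apply: (@leq_trans (\sum_a [exists i, i \in S a] * (k * d))%N); last first.
  by rewrite -big_distrl leq_mul2r sum_nonempty orbT.
apply: leq_sum => a _; case: (boolP [exists i, i \in S a]) => ne.
  by rewrite mul1n sum_adj.
rewrite mul0n leqn0 big1 // => b _; apply/eqP; rewrite eqb0.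
by apply: contra ne => /existsP[i /andP[ia _]]; apply/existsP; exists i.
Qed.

(** Products of two adjacent terms are again locally dependent, with these supports. This lets the
    variance bound be applied a second time, to the quadratic sums of Stein's method. *)
Definition adj_pair_support (c : A * A) : {set I} :=
  if adj c.1 c.2 then S c.1 :|: S c.2 else finset.set0.

Lemma adj_pair_incidence i : (\sum_c (i \in adj_pair_support c) <= 2 * (d * (k * d)))%N.
Proof.
(* Counts the ordered adjacent pairs whose first support contains [i]; by symmetry of [adj] the
   second supports contribute as much, whence the factor 2. *)
have half : (\sum_a \sum_b (i \in S a) * adj a b <= d * (k * d))%N.
  apply: (@leq_trans (\sum_a (i \in S a) * (k * d))%N).
    by apply: leq_sum => a _; rewrite -big_distrr leq_mul2l sum_adj orbT.
  by rewrite -big_distrl leq_mul2r Hd orbT.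
rewrite mul2n -addnn; apply: leq_trans (leq_add half half).
rewrite [X in (_ <= _ + X)%N]exchange_big -big_split /=.
rewrite -(pair_big xpredT xpredT
  (fun a b => (i \in adj_pair_support (a, b)) : nat)) /=.
apply: leq_sum => a _; rewrite -big_split /=; apply: leq_sum => b _.
rewrite /adj_pair_support /= [adj b a]adjC; case: (adj a b); rewrite !inE //.
by case: (i \in S a); case: (i \in S b).
Qed.

Lemma card_adj_pair c : (#|adj_pair_support c| <= 2 * k)%N.
Proof.
rewrite /adj_pair_support; case: ifP => _; last by rewrite cards0.
apply: (leq_trans (leq_card_setU _ _)).
by rewrite mul2n -addnn leq_add.
Qed.

End Incidence.

Section LocalVariance.
Variables (R : realType) (I A : finType) (p : I -> R).
Hypothesis p01 : forall i, 0 <= p i <= 1.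
Variables (S : A -> {set I}) (d k : nat) (B : R).
Hypotheses (Hd : forall i, (\sum_a (i \in S a) <= d)%N)
           (Hk : forall a, (#|S a| <= k)%N).
Local Notation P := (bernoulli_prod p).

(** Covariances of nonadjacent terms vanish by independence; each of the at most
    [#|I| * d * (k * d)] adjacent pairs contributes at most [4 * B ^+ 2], a centred term being
    bounded by [2 * B]. *)
Lemma local_variance (U : A -> {ffun I -> bool} -> R) :
  (forall a, depends_on (S a) (U a)) -> (forall a x, `|U a x| <= B) ->
  fcov P (fun x => \sum_a U a x) (fun x => \sum_a U a x)
  <= (#|I| * d * (k * d))%N%:R * (4 * B ^+ 2).
Proof.
move=> dU UB; have P0 := bernoulli_prod_ge0 p01; have P1 := bernoulli_prod_sum p.
rewrite fcov_suml //.
apply: (@le_trans _ _ (\sum_a \sum_b (adj S a b)%:R * (4 * B ^+ 2))); last first.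
  rewrite (eq_bigr (fun a => (\sum_b adj S a b)%N%:R * (4 * B ^+ 2))); last first.
    by move=> a _; rewrite -big_distrl natr_sum.
  rewrite -big_distrl /=; apply: ler_wpM2r; first by rewrite mulr_ge0 ?sqr_ge0.
  by rewrite -natr_sum ler_nat (sum_adj_all Hd Hk).
apply: ler_sum => a _; rewrite fcov_sumr //; apply: ler_sum => b _.
case: (boolP (adj S a b)) => ab.
  rewrite mul1r (le_trans (ler_norm _)) // expr2.
  by apply: fcov_bound.
rewrite mul0r le_eqVlt; apply/orP; left; apply/eqP.
exact: (fcov_indep p (adjN_sub ab)).
Qed.

End LocalVariance.

(** * Stein's method with a weight *)

Section WeightedStein.
Variables (R : realType) (I A : finType) (p : I -> R).
Hypothesis p01 : forall i, 0 <= p i <= 1.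
Variables (S : A -> {set I}) (d k m : nat) (B : R).
Hypotheses (Hd : forall i, (\sum_a (i \in S a) <= d)%N)
           (Hk : forall a, (#|S a| <= k)%N) (B0 : 0 <= B).
Local Notation P := (bernoulli_prod p).
Local Notation E := (fexp P).
Variables (Y : A -> {ffun I -> bool} -> R) (Z : 'I_m -> A -> {ffun I -> bool} -> R).
Hypotheses (dY : forall a, depends_on (S a) (Y a))
  (dZ : forall l a, depends_on (S a) (Z l a))
  (YB : forall a x, `|Y a x| <= B) (ZB : forall l a x, `|Z l a x| <= B)
  (EY : forall a, E (Y a) = 0).

Let P0 := bernoulli_prod_ge0 p01.
Let P1 := bernoulli_prod_sum p.

(** A term with empty support is constant, hence equal to its mean 0. Only the indices counted by
    [sum_nonempty] enter the error. *)
Lemma centered_supp_eq0 a x : ~~ [exists i, i \in S a] -> Y a x = 0.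
Proof.
move=> /existsPn Sa; rewrite -(EY a) -(fexp_cst P1 (Y a x)); apply: eq_fexp => y.
by apply: dY => i; rewrite (negbTE (Sa i)).
Qed.

Variable s : R.
Hypotheses (s0 : 0 <= s) (sI : s ^+ 2 * #|I|%:R <= 1).

Let W x := \sum_a Y a x.
Let M l x := \sum_a Z l a x.

Definition pair_product (T : A -> {ffun I -> bool} -> R) (c : A * A) x :=
  (adj S c.1 c.2)%:R * (Y c.1 x * T c.2 x).

Lemma pair_product_depends T (dT : forall a, depends_on (S a) (T a)) c :
  depends_on (adj_pair_support S c) (pair_product T c).
Proof.
rewrite /adj_pair_support /pair_product; case: ifP => _; last first.
  by move=> x y _; rewrite !mul0r.
move=> x y xy; congr (_ * (_ * _)).
  by apply: dY => i ic; apply: xy; rewrite inE ic.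
by apply: dT => i ic; apply: xy; rewrite inE ic orbT.
Qed.

(** The bound of [local_variance] per element of [I], for the family of adjacent products: degree
    [2 * (d * (k * d))], supports of size [2 * k], terms bounded by [B ^+ 2]. *)
Definition var_const : R :=
  (2 * (d * (k * d)) * (2 * k * (2 * (d * (k * d)))))%N%:R * (4 * (B ^+ 2) ^+ 2).

(** The quadratic sum has variance at most [#|I| * var_const]. One factor [s ^+ 2] compensates
    [#|I|], and the other leaves a standard deviation of order [s]. *)
Lemma pair_product_concentration T (dT : forall a, depends_on (S a) (T a))
    (TB : forall a x, `|T a x| <= B) (C := fun x => s ^+ 2 * \sum_c pair_product T c
        x) :
  E (fun x => `|C x - E C|) <= s * Num.sqrt var_const.
Proof.
apply: (le_trans (fexp_norm_le_sqrt P0 P1 _)).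
have -> : s * Num.sqrt var_const = Num.sqrt (s ^+ 2 * var_const).
  by rewrite (sqrtrM _ (sqr_ge0 s)) sqrtr_sqr ger0_norm.
apply: ler_wsqrtr.
have -> : E (fun x => (C x - E C) ^+ 2) = fcov P C C by apply: eq_fexp => x; rewrite
    expr2.
rewrite fcovZl // fcovC fcovZl //.
have key : fcov P (fun x => \sum_c pair_product T c x) (fun x => \sum_c pair_product
    T c x)
   <= #|I|%:R * var_const.
  have := local_variance p01 (adj_pair_incidence Hd Hk) (card_adj_pair Hk)
    (pair_product_depends dT) (B := B ^+ 2).
  have -> : #|I|%:R * var_const = (#|I| * (2 * (d * (k * d))) *
      (2 * k * (2 * (d * (k * d)))))%N%:R * (4 * (B ^+ 2) ^+ 2).
    by rewrite /var_const !natrM; ring.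
  apply=> c x.
  rewrite /pair_product normrM normrM expr2.
  case: (adj _ _ _); last by rewrite normr0 mul0r mulr_ge0.
  by rewrite normr1 mul1r ler_pM.
rewrite -subr_ge0; have : 0 <= s ^+ 2 * (s ^+ 2 * (#|I|%:R * var_const
  - fcov P (fun x => \sum_c pair_product T c x) (fun x => \sum_c pair_product T c x))).
  by rewrite !mulr_ge0 ?sqr_ge0 ?subr_ge0.
move=> /le_trans; apply; rewrite -subr_ge0.
have -> : s ^+ 2 * var_const - s ^+ 2 *
   (s ^+ 2 * fcov P (fun x => \sum_c pair_product T c x) (fun x => \sum_c
       pair_product T c x)) -
  s ^+ 2 * (s ^+ 2 * (#|I|%:R * var_const -
  fcov P (fun x => \sum_c pair_product T c x) (fun x => \sum_c pair_product T c x))) =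
  s ^+ 2 * (var_const * (1 - s ^+ 2 * #|I|%:R)) by ring.
by rewrite !mulr_ge0 ?sqr_ge0 ?subr_ge0 ?ler0n.
Qed.

(** For nonadjacent indices the two factors are independent and the first is centred, so restricting
    to adjacent pairs does not change the mean. *)
Lemma pair_product_mean T (dT : forall a, depends_on (S a) (T a)) :
  E (fun x => \sum_c pair_product T c x) = E (fun x => (\sum_a Y a x) * \sum_a T a x).
Proof.
rewrite [RHS](eq_fexp _ (Y := fun x => \sum_c Y c.1 x * T c.2 x)); last first.
  by move=> x; rewrite /= big_distrlr /= pair_big.
rewrite !fexp_sum; apply: eq_bigr => -[a b] _; rewrite /pair_product /= fexpZ.
case: (boolP (adj S a b)) => ab; first by rewrite mul1r.
rewrite mul0r (fexp_indep p (@dY a) (depends_onS (adjN_sub ab) (dT b))).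
by rewrite EY mul0r.
Qed.

Variables (psi psi1 : R -> R) (G : ('I_m -> R) -> R) (G1 : 'I_m -> ('I_m -> R) -> R).
Variables (Cpsi CG eta : R).
Let D : R := (k * d)%N%:R.
Let kappa : R := s * (B * D).
Hypotheses (psiC : forall w, `|psi w| <= Cpsi) (psi1C : forall w, `|psi1 w| <= Cpsi)
  (eta0 : 0 <= eta)
  (psi_lip : forall w u, `|u| <= kappa -> `|psi w - psi (w - u)| <= Cpsi * kappa)
  (psi_diff : forall w u, `|u| <= kappa ->
     `|psi w - psi (w - u) - psi1 w * u| <= eta * kappa)
  (GC : forall z, `|G z| <= 1) (G1C : forall l z, `|G1 l z| <= CG)
  (G_lip : forall z h, (forall l, `|h l| <= kappa) ->
     `|G z - G (fun l => z l - h l)| <= CG * kappa)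
  (G_diff : forall z h, (forall l, `|h l| <= kappa) ->
     `|G z - G (fun l => z l - h l) - \sum_l G1 l z * h l| <= CG * kappa ^+ 2).

Let kappa0 : 0 <= kappa. Proof. by rewrite !mulr_ge0 ?ler0n. Qed.
Let Cpsi0 : 0 <= Cpsi. Proof. exact: le_trans (normr_ge0 _) (psiC 0). Qed.

(* [kappa] bounds the change of a rescaled sum when the terms adjacent to a given one
   are removed. *)
Lemma product_expansion w u z h : `|u| <= kappa -> (forall l, `|h l| <= kappa) ->
  `|psi w * G z - psi (w - u) * G (fun l => z l - h l)
    - (psi1 w * G z * u + \sum_l psi w * G1 l z * h l)|
  <= kappa * (eta + kappa * (2 * Cpsi * CG)).
Proof.
move=> uk hk; set G' := G (fun l => z l - h l).
have -> : \sum_l psi w * G1 l z * h l = psi w * \sum_l G1 l z * h l.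
  by rewrite big_distrr; apply: eq_bigr => l _; rewrite -mulrA.
(* Discrete product rule; the last product of two increments is of second order in [kappa]. *)
have -> : psi w * G z - psi (w - u) * G'
    - (psi1 w * G z * u + psi w * \sum_l G1 l z * h l)
  = (psi w - psi (w - u) - psi1 w * u) * G z
    + psi w * (G z - G' - \sum_l G1 l z * h l)
    - (psi w - psi (w - u)) * (G z - G') by ring.
have -> : kappa * (eta + kappa * (2 * Cpsi * CG)) = eta * kappa * 1
   + Cpsi * (CG * kappa ^+ 2) + (Cpsi * kappa) * (CG * kappa) by ring.
apply: (le_trans (ler_normB _ _)); apply: lerD; last first.
  by rewrite normrM; apply: ler_pM => //; [apply: psi_lip|apply: G_lip].
apply: (le_trans (ler_normD _ _)); apply: lerD; rewrite normrM; apply: ler_pM => //.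
  exact: psi_diff.
exact: G_diff.
Qed.

Lemma sum_adj_bound (T : A -> {ffun I -> bool} -> R) a x : (forall a x, `|T a x| <=
    B) ->
  `|s * \sum_(b | adj S a b) T b x| <= kappa.
Proof.
move=> TB; rewrite normrM ger0_norm // /kappa ler_wpM2l //.
apply: (le_trans (ler_norm_sum _ _ _)).
apply: (@le_trans _ _ (\sum_(b | adj S a b) B)); first by apply: ler_sum.
rewrite sumr_const -mulr_natr ler_wpM2l // ler_nat -sum1_card big_mkcond.
apply: leq_trans (sum_adj Hd Hk a); apply: leq_sum => b _.
by rewrite -[b \in _]/(adj S a b); case: (adj S a b).
Qed.

(** The first summand collects the Taylor remainders, the second the fluctuations of the quadratic
    sums around their means. *)
Definition stein_error : R :=
  d%:R * B * (B * D) * (eta + kappa * (2 * Cpsi * CG))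
  + (Cpsi + m%:R * (Cpsi * CG)) * (s * Num.sqrt var_const).

(** Each [Y a] is centred and independent of what remains of [F] once all terms adjacent to [a] are
    removed; expanding [F] around that remainder to first order yields [psi1] with the variance of
    [W], and derivatives of [G] with the covariances of [W] and [M l]. The latter vanish by
    hypothesis. *)
Lemma weighted_stein : (forall l, E (fun x => W x * M l x) = 0) ->
  `|E (fun x => (s ^+ 2 * E (fun y => W y ^+ 2) * psi1 (s * W x)
                 - s * W x * psi (s * W x)) * G (fun l => s * M l x))| <= stein_error.
Proof.
move=> WM0.
pose F x := psi (s * W x) * G (fun l => s * M l x).
pose u a x := s * \sum_(b | adj S a b) Y b x.
pose h a x l := s * \sum_(b | adj S a b) Z l b x.
(* [Fa a] is [F] without the terms adjacent to [a]; [L a] is the linear part of [F - Fa a]. *)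
pose Fa a x := psi (s * W x - u a x) * G (fun l => s * M l x - h a x l).
pose L a x := psi1 (s * W x) * G (fun l => s * M l x) * u a x
  + \sum_l psi (s * W x) * G1 l (fun l => s * M l x) * h a x l.
pose C T x := s ^+ 2 * \sum_c pair_product T c x.
have EFa a : E (fun x => Y a x * Fa a x) = 0.
  rewrite (fexp_indep p (@dY a)) ?EY ?mul0r //.
  have tl T x : s * (\sum_b T b x) - s * (\sum_(b | adj S a b) T b x)
      = s * \sum_(b | ~~ adj S a b) T b x :> R.
    by rewrite (bigID (adj S a)) /=; ring.
  have dN (T : A -> {ffun I -> bool} -> R) : (forall a, depends_on (S a) (T a)) ->
      depends_on (~: S a) (fun x => s * \sum_(b | ~~ adj S a b) T b x).
    move=> dT x y xy; congr (_ * _); apply: eq_bigr => b ab.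
    exact: (depends_onS (adjN_sub ab) (dT b)).
  move=> x y xy; rewrite /Fa /u /h; congr (psi _ * G _).
    by rewrite !tl; apply: dN xy.
  by apply/funext => l; rewrite !tl; apply: dN xy.
(* The summed linear parts involve only quadratic sums: [C Y] estimates the variance of [s * W], and
   [C (Z l)] its covariance with [s * M l]. *)
have LC x : \sum_a s * (Y a x * L a x) = psi1 (s * W x) * G (fun l => s * M l x) * C Y x
   + \sum_l psi (s * W x) * G1 l (fun l => s * M l x) * C (Z l) x.
  have CE T : C T x = \sum_a s * (Y a x * (s * \sum_(b | adj S a b) T b x)).
    rewrite /C -(pair_big xpredT xpredT (fun a b => pair_product T (a, b) x)) /=.
    rewrite big_distrr; apply: eq_bigr => a _ /=.
    rewrite [in RHS]big_mkcond /= !big_distrr /=; apply: eq_bigr => b _.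
    by rewrite /pair_product /=; case: (adj S a b) => /=; ring.
  rewrite CE; under [X in _ = _ + X]eq_bigr => l _ do rewrite CE big_distrr /=.
  rewrite exchange_big big_distrr -big_split; apply: eq_bigr => a _ /=.
  rewrite /L /u mulrDr mulrDr; congr (_ + _); first by ring.
  by rewrite !big_distrr; apply: eq_bigr => l _ /=; rewrite /h; ring.
have EC T : (forall a, depends_on (S a) (T a)) ->
    E (C T) = s ^+ 2 * E (fun x => W x * \sum_a T a x).
  by move=> dT; rewrite /C fexpZ pair_product_mean.
have step1 : E (fun x => s * W x * F x) =
   E (fun x => \sum_a s * (Y a x * (F x - Fa a x))).
  transitivity (E (fun x => s * W x * F x - \sum_a s * (Y a x * Fa a x))).
    rewrite fexpB fexp_sum [X in _ = _ - X]big1 ?subr0 // => a _.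
    by rewrite fexpZ EFa mulr0.
  apply: eq_fexp => x; rewrite /W big_distrr big_distrl -sumrB.
  by apply: eq_bigr => a _ /=; ring.
(* At most [#|I| * d] terms are nonzero. Each carries one factor [s] and another inside [kappa], and
   [s ^+ 2 * #|I|%:R <= 1]. *)
have rem x : `|\sum_a s * (Y a x * (F x - Fa a x - L a x))|
   <= d%:R * B * (B * D) * (eta + kappa * (2 * Cpsi * CG)).
  set rho := eta + _.
  have rho0 : 0 <= rho.
    have CG0 : 0 <= Cpsi * CG * kappa.
      by rewrite -mulrA mulr_ge0 // (le_trans (normr_ge0 _) (@G_lip (fun=> 0)
        (fun=> 0) _)) // => l; rewrite normr0.
    have -> : rho = eta + 2 * (Cpsi * CG * kappa) by rewrite /rho; ring.
    by rewrite addr_ge0 // mulr_ge0.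
  apply: (le_trans (ler_norm_sum _ _ _)).
  apply: (@le_trans _ _ (\sum_a [exists i, i \in S a]%:R * (s * (B * (kappa * rho))))).
    apply: ler_sum => a _; case: (boolP [exists i, i \in S a]) => Sa; last first.
      by rewrite (centered_supp_eq0 _ Sa) mul0r mulr0 normr0 mul0r.
    rewrite mul1r !normrM ger0_norm // ler_wpM2l // ler_pM //.
    by apply: product_expansion => [|l]; exact: sum_adj_bound.
  rewrite -big_distrl -natr_sum /=.
  apply: (@le_trans _ _ ((#|I| * d)%N%:R * (s * (B * (kappa * rho))))).
    by rewrite ler_wpM2r ?mulr_ge0 // ler_nat (sum_nonempty Hd).
  rewrite (_ : _ * _ = (s ^+ 2 * #|I|%:R) * (d%:R * B * (B * D) * rho)).
    by rewrite ler_piMl // !mulr_ge0 ?ler0n.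
  by rewrite natrM /kappa; ring.
(* The first bracket has mean 0 by [step1] and the second is bounded by [rem]. The third contains
   only deviations of [C Y] and [C (Z l)] from their means, since [C (Z l)] has mean 0 by [WM0]. *)
have split x : (s ^+ 2 * E (fun y => W y ^+ 2) * psi1 (s * W x)
       - s * W x * psi (s * W x)) * G (fun l => s * M l x) =
   (\sum_a s * (Y a x * (F x - Fa a x)) - s * W x * F x)
   - \sum_a s * (Y a x * (F x - Fa a x - L a x))
   - (psi1 (s * W x) * G (fun l => s * M l x) * (C Y x - E (C Y))
     + \sum_l psi (s * W x) * G1 l (fun l => s * M l x) * (C (Z l) x - E (C (Z l)))).
  have -> : \sum_a s * (Y a x * (F x - Fa a x - L a x)) =
     \sum_a s * (Y a x * (F x - Fa a x)) - \sum_a s * (Y a x * L a x).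
    by rewrite -sumrB; apply: eq_bigr => a _; ring.
  have -> : E (C Y) = s ^+ 2 * E (fun y => W y ^+ 2).
    by rewrite EC //; congr (_ * _); apply: eq_fexp => y; rewrite expr2.
  rewrite LC /F.
  under [X in _ - (_ + X)]eq_bigr => l _.
    have -> : E (C (Z l)) = 0 by rewrite EC //; have := WM0 l; rewrite /M => ->;
        rewrite mulr0.
    rewrite subr0; over.
  by ring.
rewrite (eq_fexp _ split) fexpB fexpB fexpB -step1 subrr sub0r -opprD normrN.
apply: (le_trans (ler_normD _ _)); apply: lerD; first exact: fexp_le_bound.
apply: (le_trans (ler_norm_fexp P0 _)).
apply: (@le_trans _ _ (E (fun x => Cpsi * `|C Y x - E (C Y)|
   + \sum_l (Cpsi * CG) * `|C (Z l) x - E (C (Z l))|))).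
  apply: le_fexp => // x; apply: (le_trans (ler_normD _ _)); apply: lerD.
    rewrite normrM ler_wpM2r // normrM -[leRHS]mulr1; exact: ler_pM.
  apply: (le_trans (ler_norm_sum _ _ _)); apply: ler_sum => l _.
  by rewrite normrM ler_wpM2r // normrM; exact: ler_pM.
rewrite fexpD fexpZ fexp_sum mulrDl; apply: lerD.
  by rewrite ler_wpM2l // pair_product_concentration.
rewrite -mulrA mulr_natl -[m in X in _ <= X]card_ord -sumr_const.
apply: ler_sum => l _; rewrite fexpZ.
have CG0 : 0 <= CG by exact: le_trans (normr_ge0 _) (G1C l (fun=> 0)).
by rewrite ler_wpM2l ?mulr_ge0 // pair_product_concentration.
Qed.

End WeightedStein.

(** * Configurations with prescribed level counts *)

Section Slices.
Variables (R : realType) (I : finType) (e : I -> nat) (Lm : nat).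
Local Notation X := {ffun I -> bool}.
Local Notation K := 'I_Lm.+1.
Implicit Types (x y : X) (k : {ffun K -> nat}) (l : K).

Definition count_true (l : nat) x : nat := \sum_(i | e i == l) x i.
Definition level_size (l : nat) : nat := \sum_(i | e i == l) 1.
Definition low_support x := [forall i, x i ==> (e i <= Lm)%N].
Definition slice k : {set X} :=
  [set x | low_support x && [forall l : K, count_true l x == k l]].
Definition add_true (i : I) x : X := [ffun j => (j == i) || x j].
Definition del_true (i : I) x : X := [ffun j => (j != i) && x j].
Definition incr l k : {ffun K -> nat} := [ffun l' => (k l' + (l' == l))%N].

Lemma count_true_add i x l : ~~ x i ->
  count_true l (add_true i x) = (count_true l x + (e i == l))%N.
Proof.
move=> xi; rewrite /count_true big_mkcond [in RHS]big_mkcond /=.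
rewrite (bigD1 i) //= [in RHS](bigD1 i) //= !ffunE eqxx /= (negbTE xi).
rewrite (eq_bigr (fun j => if e j == l then x j : nat else 0%N)).
  by case: (e i == l); rewrite /= ?add0n ?addn0 // addnC.
by move=> j /negbTE ji; rewrite ffunE ji.
Qed.

Lemma low_support_add i x : (e i <= Lm)%N -> low_support (add_true i x) = low_support x.
Proof.
move=> ei; apply: eq_forallb => j; rewrite ffunE.
by case: eqP => [->|//]; rewrite ei !implybT.
Qed.

Lemma del_add i x : (del_true i (add_true i x) == x) = ~~ x i.
Proof.
apply/eqP/idP => [<-|xi]; first by rewrite !ffunE eqxx.
by apply/ffunP => j; rewrite !ffunE; case: eqP => // ->; rewrite (negbTE xi).
Qed.

Lemma add_del i x : x i -> add_true i (del_true i x) = x.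
Proof. by move=> xi; apply/ffunP => j; rewrite !ffunE; case: eqP => // ->. Qed.

(* Counts the pairs ([x], [add_true i x]) from either end. *)
Lemma slice_double_count k l (H : X -> I -> R) :
  \sum_(x in slice k) \sum_(i | (e i == l) && ~~ x i) H (add_true i x) i
  = \sum_(y in slice (incr l k)) \sum_(i | (e i == l) && y i) H y i.
Proof.
rewrite !pair_big_dep /=.
rewrite [RHS](reindex_onto (fun z => (add_true z.2 z.1, z.2))
  (fun z => (del_true z.2 z.1, z.2))) /=; last first.
  by case=> y i /= /and3P[_ _ yi]; rewrite add_del.
apply: eq_bigl => -[x i] /=; rewrite xpair_eqE eqxx andbT del_add ffunE eqxx /= andbT.
case: eqP => [ei|]; rewrite ?andbF //= andbC.
have eL : (e i <= Lm)%N by rewrite ei -ltnS.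
case: (boolP (x i)) => xi; rewrite ?andbF //= andbT !inE low_support_add //.
rewrite andbT; congr (_ && _); apply: eq_forallb => l'.
by rewrite count_true_add // ffunE ei [l' == l]eq_sym eqn_add2r.
Qed.

Lemma sum_true x l : \sum_(i | (e i == l) && x i) 1 = (count_true l x)%:R :> R.
Proof.
rewrite /count_true natr_sum big_mkcondr /=.
by apply: eq_bigr => i _; case: (x i).
Qed.

Lemma sum_false x l : \sum_(i | (e i == l) && ~~ x i) 1
  = (level_size l)%:R - (count_true l x)%:R :> R.
Proof.
rewrite -sum_true /level_size natr_sum [in RHS](bigID (fun i => x i)) /=.
by rewrite addrAC subrr add0r.
Qed.

(** The two coefficients are the numbers of false sites of level [l] in a point of the lower slice
    and of true ones in a point of the upper slice, so both sums become sums over the pairs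
    [(x, add_true i x)]. *)
Lemma slice_step k l (F : X -> R) :
  ((level_size l)%:R - (k l)%:R) * (\sum_(x in slice k) F x)
  - (k l).+1%:R * (\sum_(y in slice (incr l k)) F y)
  = \sum_(x in slice k) \sum_(i | (e i == l) && ~~ x i) (F x - F (add_true i x)).
Proof.
under [RHS]eq_bigr => x _ do rewrite sumrB.
rewrite sumrB (slice_double_count k l (fun y _ => F y)) !big_distrr /=.
congr (_ - _); apply: eq_bigr => x; rewrite inE => /andP[_ /forallP/(_ l)/eqP xk].
  by rewrite -xk -sum_false mulr_suml; apply: eq_bigr => i _; rewrite mul1r.
have <- : count_true l x = (k l).+1 by rewrite xk ffunE eqxx addn1.
by rewrite -sum_true mulr_suml; apply: eq_bigr => i _; rewrite mul1r.
Qed.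

Lemma slice_card_step k l : ((level_size l)%:R - (k l)%:R) * #|slice k|%:R
  = (k l).+1%:R * #|slice (incr l k)|%:R :> R.
Proof.
have := slice_step k l (fun=> 1); rewrite !sumr_const [RHS]big1 => [/eqP|x _].
  by rewrite subr_eq0 => /eqP.
by rewrite big1 // => i _; rewrite subrr.
Qed.

Definition slice_avg k (F : X -> R) : R := (\sum_(x in slice k) F x) / #|slice k|%:R.

Lemma count_true_le (l : nat) x : (count_true l x <= level_size l)%N.
Proof. by apply: leq_sum => i _; case: (x i). Qed.

Lemma slice_le k l : (0 < #|slice k|)%N -> (k l <= level_size l)%N.
Proof.
case/card_gt0P => x; rewrite inE => /andP[_ /forallP/(_ l)/eqP <-].
exact: count_true_le.
Qed.

Lemma slice_incr_gt0 k l : (0 < #|slice k|)%N -> (k l < level_size l)%N ->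
  (0 < #|slice (incr l k)|)%N.
Proof.
move=> Sk kl; have := slice_card_step k l; rewrite lt0n.
case: (#|slice (incr l k)|) => // /eqP; rewrite mulr0 mulf_eq0 subr_eq0 eqr_nat.
by rewrite pnatr_eq0 gtn_eqF //= gtn_eqF.
Qed.

(** Coupling: for [x] uniform in the slice of [k] and [i] uniform among its false sites of level
    [l], [add_true i x] is uniform in the slice of [incr l k]. *)
Lemma slice_avg_step c (F : X -> R) : (forall x i, `|F x - F (add_true i x)| <= c) ->
  forall k l, (0 < #|slice k|)%N -> (k l < level_size l)%N ->
  `|slice_avg k F - slice_avg (incr l k) F| <= c.
Proof.
move=> Fc k l Sk kl; have Sk' := slice_incr_gt0 Sk kl.
set n := (level_size l)%:R - (k l)%:R : R.
have n0 : 0 < n by rewrite subr_gt0 ltr_nat.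
have N0 : 0 < #|slice k|%:R :> R by rewrite ltr0n.
have N0' : 0 < #|slice (incr l k)|%:R :> R by rewrite ltr0n.
have k0 : 0 < (k l).+1%:R :> R by rewrite ltr0n.
have eN : n * #|slice k|%:R = (k l).+1%:R * #|slice (incr l k)|%:R :> R.
  exact: slice_card_step.
have nN : 0 < n * #|slice k|%:R by rewrite mulr_gt0.
rewrite -(ler_pM2l nN) -[X in X * `|_|]ger0_norm ?(ltW nN) // -normrM mulrBr.
rewrite {2}eN /slice_avg.
have -> : n * #|slice k|%:R * ((\sum_(x in slice k) F x) / #|slice k|%:R)
   = n * \sum_(x in slice k) F x by field; rewrite gt_eqF.
have -> : (k l).+1%:R * #|slice (incr l k)|%:R
    * ((\sum_(x in slice (incr l k)) F x) / #|slice (incr l k)|%:R)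
   = (k l).+1%:R * \sum_(x in slice (incr l k)) F x by field; rewrite gt_eqF.
rewrite slice_step; apply: (le_trans (ler_norm_sum _ _ _)).
have -> : n * #|slice k|%:R * c = \sum_(x in slice k) n * c.
  by rewrite sumr_const -[RHS]mulr_natr; ring.
apply: ler_sum => x; rewrite inE => /andP[_ /forallP/(_ l)/eqP xk].
rewrite /n -xk -sum_false mulr_suml; apply: (le_trans (ler_norm_sum _ _ _)).
by apply: ler_sum => i _; rewrite mul1r.
Qed.

Definition absdiff (a b : nat) : nat := ((a - b) + (b - a))%N.
Lemma absdiffE a c : (absdiff a c)%:R = `|a%:R - c%:R| :> R.
Proof.
rewrite /absdiff; have [ac|/ltnW ca] := leqP a c.
  rewrite (_ : (a - c)%N = 0%N) ?add0n; last by lia.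
  by rewrite natrB // ler0_norm ?opprB // subr_le0 ler_nat.
rewrite (_ : (c - a)%N = 0%N) ?addn0; last by lia.
by rewrite natrB // ger0_norm // subr_ge0 ler_nat.
Qed.

Definition lattice_dist k k' : nat := \sum_l absdiff (k l) (k' l).

Lemma lattice_distC k k' : lattice_dist k k' = lattice_dist k' k.
Proof. by apply: eq_bigr => l _; rewrite /absdiff addnC. Qed.

Lemma lattice_dist_incr k k' l : (k l < k' l)%N ->
  lattice_dist k k' = (lattice_dist (incr l k) k').+1.
Proof.
move=> kl; rewrite /lattice_dist (bigD1 l) //= [in RHS](bigD1 l) //= ffunE eqxx.
rewrite (eq_bigr (fun l' => absdiff (incr l k l') (k' l'))); last first.
  by move=> l' /negbTE ll'; rewrite ffunE ll' addn0.
by rewrite -addSn; congr (_ + _)%N; rewrite /absdiff; lia.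
Qed.

Lemma lattice_dist0 k k' : lattice_dist k k' = 0%N -> k = k'.
Proof.
move/eqP; rewrite sum_nat_eq0 => /forallP d0; apply/ffunP => l.
by have := d0 l; rewrite /absdiff /=; lia.
Qed.

Lemma lattice_dist_gt0 k k' : (0 < lattice_dist k k')%N -> exists l, k l != k' l.
Proof.
move=> d0; case: (pickP (fun l => k l != k' l)) => [l|kk]; first by exists l.
move: d0; rewrite /lattice_dist big1 // => l _.
by move/negbFE/eqP : (kk l) => ->; rewrite /absdiff subnn.
Qed.

(** Joins [k] to [k'] by unit steps. Raising the smaller of two differing coordinates keeps it at
    most the other one, so every slice on the way is nonempty. *)
Lemma slice_avg_lip c (F : X -> R) : (forall x i, `|F x - F (add_true i x)| <= c) ->
  forall k k', (0 < #|slice k|)%N -> (0 < #|slice k'|)%N ->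
  `|slice_avg k F - slice_avg k' F| <= (lattice_dist k k')%:R * c.
Proof.
move=> Fc k k'; move: {2}(lattice_dist k k') (erefl (lattice_dist k k')) => N.
elim: N k k' => [|N IH] k k' dN Sk Sk'.
  by rewrite dN (lattice_dist0 dN) subrr normr0 mul0r.
have [l kl] : exists l, k l != k' l by apply: lattice_dist_gt0; rewrite dN.
wlog ltk : k k' dN Sk Sk' kl / (k l < k' l)%N.
  move=> wl; have [kk|kk] := ltnP (k l) (k' l); first exact: wl.
  rewrite distrC lattice_distC; apply: wl => //; rewrite 1?lattice_distC 1?eq_sym //.
  by rewrite ltn_neqAle eq_sym kl.
have kn : (k l < level_size l)%N := leq_trans ltk (slice_le l Sk').
have dN' : lattice_dist (incr l k) k' = N.
  by apply/eqP; rewrite -eqSS -lattice_dist_incr // dN.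
rewrite dN -[N.+1]add1n natrD mulrDl mul1r -dN'.
apply: (le_trans (ler_distD (slice_avg (incr l k) F) _ _)); apply: lerD.
  exact: slice_avg_step.
by apply: IH => //; exact: slice_incr_gt0.
Qed.

Variables (p : I -> R) (m : K -> nat).
Hypotheses (p01 : forall i, 0 <= p i <= 1)
  (phigh : forall i, (Lm < e i)%N -> p i = 0)
  (plow : forall l i, e i = l -> p i = (m l)%:R / (level_size l)%:R)
  (mn : forall l, (m l <= level_size l)%N).
Local Notation P := (bernoulli_prod p).

Lemma bernoulli_prod_add i x : ~~ x i -> P (add_true i x) * (1 - p i) = P x * p i.
Proof.
move=> xi; rewrite /bernoulli_prod (bigD1 i) //= [in RHS](bigD1 i) //=.
rewrite ffunE eqxx /= (negbTE xi) (eq_bigr (fun j => if x j then p j else 1 - p j)).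
  by ring.
by move=> j /negbTE ji; rewrite ffunE ji.
Qed.

Lemma bernoulli_prod_high x : ~~ low_support x -> P x = 0.
Proof.
move=> /forallPn[i]; rewrite negb_imply -ltnNge => /andP[xi /phigh pi0].
by rewrite /bernoulli_prod (bigD1 i) //= xi pi0 mul0r.
Qed.

Definition slice_prob k : R := \sum_(x in slice k) P x.

Lemma slice_prob_ge0 k : 0 <= slice_prob k.
Proof. by apply: sumr_ge0 => x _; exact: bernoulli_prod_ge0. Qed.

(* Ratio of consecutive binomial probabilities with success probability
   [m l / level_size l]; it crosses 1 at [k l = m l]. *)
Lemma slice_prob_step k l : (k l < level_size l)%N ->
  ((level_size l)%:R - (m l)%:R) * (k l).+1%:R * slice_prob (incr l k)
  = (m l)%:R * ((level_size l)%:R - (k l)%:R) * slice_prob k.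
Proof.
move=> kl; set n : R := (level_size l)%:R.
have n0 : 0 < n by rewrite ltr0n (leq_ltn_trans _ kl).
pose q : R := (m l)%:R / n.
have mE : (m l)%:R = q * n by rewrite /q divfK // gt_eqF.
have key : (1 - q) * ((k l).+1%:R * slice_prob (incr l k)) = q * ((n - (k l)%:R) *
    slice_prob k).
  have -> : (k l).+1%:R * slice_prob (incr l k) =
      \sum_(x in slice k) \sum_(i | (e i == l) && ~~ x i) P (add_true i x).
    rewrite (slice_double_count _ _ (fun y i => P y)) mulr_sumr.
    apply: eq_bigr => y; rewrite inE => /andP[_ /forallP/(_ l)/eqP yk].
    have <- : count_true l y = (k l).+1 by rewrite yk ffunE eqxx addn1.
    by rewrite -sum_true mulr_suml; apply: eq_bigr => i _; rewrite mul1r.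
  rewrite !mulr_sumr; apply: eq_bigr => x.
  rewrite inE => /andP[_ /forallP/(_ l)/eqP xk].
  rewrite /n -xk -sum_false mulr_suml !mulr_sumr; apply: eq_bigr => i /andP[/eqP ei xi].
  by rewrite mulrC -[q](plow ei) bernoulli_prod_add // mul1r mulrC.
rewrite mE; have -> : n - q * n = (1 - q) * n by ring.
have -> : (1 - q) * n * (k l).+1%:R * slice_prob (incr l k) =
  n * ((1 - q) * ((k l).+1%:R * slice_prob (incr l k))) by ring.
by rewrite key; ring.
Qed.

(** At [m l <= k l] the ratio given by [slice_prob_step] is at most 1; when level [l] is already
    full, the raised slice is empty. *)
Lemma slice_prob_incr_le k l : (m l <= k l)%N -> slice_prob (incr l k) <= slice_prob k.
Proof.
move=> mk; have [kl|lk] := ltnP (k l) (level_size l); last first.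
  rewrite {1}/slice_prob big1 ?slice_prob_ge0 // => x.
  rewrite inE => /andP[_ /forallP/(_ l)/eqP]; rewrite ffunE eqxx addn1 => xk.
  by have := count_true_le l x; rewrite xk ltnNge lk.
have ml : (m l < level_size l)%N := leq_ltn_trans mk kl.
set a : R := ((level_size l)%:R - (m l)%:R) * (k l).+1%:R.
have a0 : 0 < a by rewrite mulr_gt0 ?subr_gt0 ?ltr_nat ?ltr0n.
rewrite -(ler_pM2l a0) slice_prob_step // ler_wpM2r ?slice_prob_ge0 //.
rewrite /a -!natrB ?(ltnW ml) ?(ltnW kl) // -!natrM ler_nat; nia.
Qed.

Lemma slice_prob_incr_ge k l : (k l < m l)%N -> slice_prob k <= slice_prob (incr l k).
Proof.
move=> km; have kl : (k l < level_size l)%N := leq_trans km (mn l).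
set a : R := (m l)%:R * ((level_size l)%:R - (k l)%:R).
have a0 : 0 < a by rewrite mulr_gt0 ?subr_gt0 ?ltr_nat ?ltr0n // (leq_ltn_trans _ km).
rewrite -(ler_pM2l a0) -slice_prob_step // ler_wpM2r ?slice_prob_ge0 //.
rewrite /a -!natrB ?mn ?(ltnW kl) // -!natrM ler_nat; have := mn l; nia.
Qed.

(** Unimodality in each coordinate: the probability grows when every coordinate moves toward [m]
    without crossing it. *)
Lemma slice_prob_toward k k' :
  (forall l, ((m l <= k' l) && (k' l <= k l)) || ((k l <= k' l) && (k' l <= m l)))%N ->
  slice_prob k <= slice_prob k'.
Proof.
move: {2}(lattice_dist k k') (erefl (lattice_dist k k')) => N.
elim: N k k' => [|N IH] k k' dN kk'; first by rewrite (lattice_dist0 dN).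
have [l kl] : exists l, k l != k' l by apply: lattice_dist_gt0; rewrite dN.
have [ltk|gtk] := ltnP (k l) (k' l).
  have dN' : lattice_dist (incr l k) k' = N.
    by apply/eqP; rewrite -eqSS -lattice_dist_incr // dN.
  apply: (@le_trans _ _ (slice_prob (incr l k))).
    by apply: slice_prob_incr_ge; have := kk' l; lia.
  apply: IH => // l'; rewrite ffunE; have := kk' l'.
  by case: eqP => [->|_] /=; lia.
(* Instead of lowering [k], the target [k'] is raised, so that [incr] is the only move. *)
have ltk : (k' l < k l)%N by rewrite ltn_neqAle eq_sym kl.
have dN' : lattice_dist k (incr l k') = N.
  by rewrite lattice_distC; apply/eqP; rewrite -eqSS -lattice_dist_incr //
      lattice_distC dN.
apply: (@le_trans _ _ (slice_prob (incr l k'))); last first.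
  by apply: slice_prob_incr_le; have := kk' l; lia.
apply: IH => // l'; rewrite ffunE; have := kk' l'.
by case: eqP => [->|_] /=; lia.
Qed.

End Slices.

(** * Lower bound for the probability of a small box *)

Section Coordinates.
Variables (R : realType) (I : finType) (p : I -> R).
Hypothesis p01 : forall i, 0 <= p i <= 1.
Local Notation P := (bernoulli_prod p).

Lemma fexp_coord i : fexp P (fun x => (x i)%:R) = p i.
Proof.
pose F j (b : bool) : R := (if b then p j else 1 - p j) * (if j == i then b%:R else 1).
transitivity (\sum_(x : {ffun I -> bool}) \prod_j F j (x j)).
  apply: eq_bigr => x _; rewrite big_split /=; congr (_ * _).
  by rewrite -big_mkcond big_pred1_eq.
rewrite -(bigA_distr_bigA F) (bigD1 i) //= [X in _ * X]big1 => [|j ji].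
  by rewrite big_bool /F eqxx /=; ring.
by rewrite big_bool /F (negbTE ji) /=; ring.
Qed.

Lemma depends_on_coord i : depends_on [set i]%SET (fun x : {ffun I -> bool} => (x
    i)%:R : R).
Proof. by move=> x y xy; rewrite xy // inE. Qed.

End Coordinates.

Section Box.
Variables (R : realType) (I : finType) (e : I -> nat) (Lm : nat).
Local Notation X := {ffun I -> bool}.
Local Notation K := 'I_Lm.+1.
Local Notation N := #|I|.
Local Notation count_true := (count_true e).
Local Notation level_size := (level_size e).
Variables (p : I -> R) (m : K -> nat).
Hypotheses (p01 : forall i, 0 <= p i <= 1)
  (phigh : forall i, (Lm < e i)%N -> p i = 0)
  (plow : forall (l : K) i, e i = l -> p i = (m l)%:R / (level_size l)%:R)
  (mn : forall l : K, (m l <= level_size l)%N).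
Local Notation P := (bernoulli_prod p).

Definition counts (x : X) : {ffun K -> nat} := [ffun l : K => count_true l x].
(** Counts are at most [N]; vectors over ['I_N.+1] form a finite type that can index sums over
    slices. *)
Definition vals (c : {ffun K -> 'I_N.+1}) : {ffun K -> nat} := [ffun l => c l : nat].

Lemma level_size_le l : (level_size l <= N)%N.
Proof. by rewrite /level_size sum1_card max_card. Qed.

Lemma in_slice k x : (x \in slice e k) = low_support e Lm x && (counts x == k).
Proof.
rewrite inE; congr (_ && _); apply/forallP/eqP => [xk|<- l].
  by apply/ffunP => l; rewrite ffunE; apply/eqP.
by rewrite ffunE.
Qed.

Lemma sum_by_slices (Q : {ffun K -> nat} -> bool) :
  \sum_(x | Q (counts x)) P x = \sum_(c | Q (vals c)) slice_prob e p (vals c).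
Proof.
rewrite (bigID (low_support e Lm)) /= [X in _ + X]big1 ?addr0; last first.
  by move=> x /andP[_]; apply: bernoulli_prod_high.
pose h x : {ffun K -> 'I_N.+1} := [ffun l => inord (counts x l)].
have hE x : vals (h x) = counts x.
  apply/ffunP => l; rewrite !ffunE inordK // ltnS (leq_trans (count_true_le _ _ _)) //.
  exact: level_size_le.
have hv c x : vals c = counts x -> h x = c.
  by move=> cx; apply/ffunP => l; rewrite ffunE -cx ffunE inord_val.
rewrite (partition_big h (fun c => Q (vals c))) /= => [|x /andP[Qx _]]; last by
    rewrite hE.
apply: eq_bigr => c Qc; apply: eq_bigl => x; rewrite in_slice.
case: (low_support e Lm x); rewrite ?andbF ?andbT //=.
apply/andP/eqP => [[_ /eqP <-]|xc]; first by rewrite hE.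
by rewrite xc Qc (hv c) ?xc.
Qed.

Definition near_center b (k : {ffun K -> nat}) := [forall l, absdiff (k l) (m l) <=
    b]%N.

(** Divides the distance from [a] to the centre [c] by [r.+1], rounding toward [c] on either
    side. *)
Definition contract (r a c : nat) : nat :=
  if (c <= a)%N then (c + (a - c) %/ r.+1)%N else (c - (c - a) %/ r.+1)%N.

Lemma contract_between r a c :
  ((c <= contract r a c <= a) || (a <= contract r a c <= c))%N.
Proof.
rewrite /contract; case: (leqP c a) => ca; apply/orP; [left|right].
  by have := leq_div (a - c) r.+1; move: (_ %/ _)%N => q; lia.
by have := leq_div (c - a) r.+1; move: (_ %/ _)%N => q; lia.
Qed.

Lemma contract_dist r a c b : (absdiff a c <= b)%N -> (absdiff (contract r a c) c <=
    b %/ r.+1)%N.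
Proof.
move=> ab; apply: leq_trans (leq_div2r r.+1 ab).
rewrite /contract /absdiff; case: (leqP c a) => ca.
  rewrite (_ : (c - a)%N = 0%N) ?addn0; last by lia.
  by move: (_ %/ _)%N => q; lia.
rewrite (_ : (a - c)%N = 0%N) ?add0n; last by lia.
by have := leq_div (c - a) r.+1; move: (_ %/ _)%N => q; lia.
Qed.

(** A point is recovered from its image, its side of [c] and the remainder of its distance modulo
    [r.+1]: fibres have at most [2 * r.+1] points per coordinate. *)
Lemma contract_inj r a a' c : contract r a c = contract r a' c ->
  (c <= a)%N = (c <= a')%N ->
  (absdiff a c %% r.+1 = absdiff a' c %% r.+1)%N -> a = a'.
Proof.
rewrite /contract /absdiff => + Ec; rewrite -Ec; case: (leqP c a) Ec => ca /esym ca' E.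
  rewrite (_ : (c - a)%N = 0%N) ?addn0; last by lia.
  rewrite (_ : (c - a')%N = 0%N) ?addn0; last by lia.
  have Eq : ((a - c) %/ r.+1 = (a' - c) %/ r.+1)%N := addnI E.
  move=> Em; have := divn_eq (a - c) r.+1; rewrite Eq Em -divn_eq; lia.
rewrite (_ : (a - c)%N = 0%N) ?add0n; last by lia.
rewrite (_ : (a' - c)%N = 0%N) ?add0n; last by lia.
have := leq_div (c - a) r.+1; have := leq_div (c - a') r.+1 => l1 l2.
have Eq : ((c - a) %/ r.+1 = (c - a') %/ r.+1)%N.
  by move: l1 l2 E; move: (_ %/ _)%N => q1; move: (_ %/ _)%N => q2; lia.
move=> Em; have := divn_eq (c - a) r.+1; rewrite Eq Em -divn_eq; lia.
Qed.

(* Moving every coordinate toward [m] by the factor [r.+1] increases [slice_prob] and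
   has fibres of size at most [(2 * r.+1) ^ Lm.+1]. *)
Lemma box_contract b r :
  \sum_(x | near_center b (counts x)) P x
  <= ((2 * r.+1) ^ Lm.+1)%N%:R * \sum_(x | near_center (b %/ r.+1) (counts x)) P x.
Proof.
rewrite !sum_by_slices.
(* [inord] is faithful here because the contracted value lies between [c l] and [m l], both at most
   [N]. *)
pose ctr (c : {ffun K -> 'I_N.+1}) : {ffun K -> 'I_N.+1} :=
  [ffun l => inord (contract r (c l) (m l))].
have ctrE c l : ctr c l = contract r (c l) (m l) :> nat.
  rewrite ffunE inordK // ltnS; have := contract_between r (c l) (m l).
  by have := mn l; have := level_size_le l; have := ltn_ord (c l); lia.
apply: (@le_trans _ _ (\sum_(c | near_center b (vals c)) slice_prob e p (vals (ctr
    c)))).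
  apply: ler_sum => c _; apply: (slice_prob_toward p01 plow mn) => l.
  by rewrite ![vals _ l]ffunE ctrE contract_between.
rewrite (partition_big ctr (fun c => near_center (b %/ r.+1) (vals c))); last first.
  move=> c /forallP cb; apply/forallP => l; rewrite ffunE ctrE.
  by apply: contract_dist; have := cb l; rewrite ffunE.
rewrite mulr_sumr; apply: ler_sum => c' _ /=.
rewrite (eq_bigr (fun=> slice_prob e p (vals c'))); last by move=> c /andP[_ /eqP->].
rewrite sumr_const -[leLHS]mulr_natl ler_wpM2r ?slice_prob_ge0 // ler_nat.
(* Side and remainder in each coordinate, the data that [contract_inj] needs to separate points of a
   fibre. *)
pose off (c : {ffun K -> 'I_N.+1}) : {ffun K -> bool * 'I_r.+1} :=
  [ffun l => ((m l <= c l)%N, inord (absdiff (c l) (m l) %% r.+1))].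
have off_inj : {in [pred c | near_center b (vals c) && (ctr c == c')] &, injective off}.
  move=> c1 c2 /andP[_ /eqP E1] /andP[_ /eqP E2] /ffunP E12; apply/ffunP => l.
  have := E12 l; rewrite !ffunE => -[El Em].
  apply: val_inj; apply: (@contract_inj r _ _ (m l)).
  - by rewrite -!ctrE E1 E2.
  - exact: El.
  - by move/(congr1 val): Em; rewrite /= !inordK ?ltn_pmod.
rewrite -(card_in_imset off_inj); apply: (leq_trans (max_card _)).
by rewrite card_ffun card_prod card_bool !card_ord.
Qed.

Lemma fexp_count l : fexp P (fun x => (count_true (l : K) x)%:R) = (m l)%:R.
Proof.
rewrite (eq_fexp _ (Y := fun x : X => \sum_(i | e i == l) (x i)%:R)); last first.
  by move=> x; rewrite /count_true natr_sum.
rewrite fexp_sum (eq_bigr (fun=> (m l)%:R / (level_size l)%:R)); last first.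
  by move=> i /eqP ei; rewrite fexp_coord (plow ei).
rewrite sumr_const -[LHS]mulr_natl -(sum1_card [pred i | e i == l]).
rewrite -[(\sum_(i in _) 1)%N]/(level_size l).
have [n0|n0] := eqVneq (level_size l) 0%N; last by rewrite mulrC divfK // pnatr_eq0.
by rewrite n0 mul0r; have := mn l; rewrite n0 leqn0 => /eqP ->.
Qed.

Lemma fvar_count_le l : fcov P (fun x => (count_true (l : K) x)%:R)
   (fun x => (count_true l x)%:R) <= 4 * N%:R.
Proof.
pose U i (x : X) : R := (e i == l)%:R * (x i)%:R.
have UE x : (count_true l x)%:R = \sum_i U i x.
  rewrite /count_true natr_sum big_mkcond /=; apply: eq_bigr => i _.
  by rewrite /U; case: eqP; rewrite ?mul1r ?mul0r.
rewrite (eq_fcov _ UE UE).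
have -> : 4 * N%:R = (N * 1 * (1 * 1))%N%:R * (4 * 1 ^+ 2) :> R by rewrite !muln1; ring.
apply: (local_variance p01 (S := fun i => [set i]%SET)) => [i|i|i|i x].
- by rewrite (bigD1 i) //= inE eqxx big1 // => j ji; rewrite inE eq_sym (negbTE ji).
- by rewrite cards1.
- by move=> x y xy; rewrite /U xy // inE.
- by rewrite /U; case: (_ == _); case: (x i); rewrite /= ?mul0r ?mulr0 ?mul1r ?normr0
    ?normr1.
Qed.

(** Chebyshev's inequality gives mass at least 1/2 to a box of radius at most [16 * Lm.+1 * sqrt N],
    and contraction by [r.+1] brings it within [delta * sqrt N]. *)
Lemma box_prob_lb (r : nat) (delta : R) : (0 < N)%N ->
  16 * Lm.+1%:R <= delta * r.+1%:R ->
  1 / 2 <= ((2 * r.+1) ^ Lm.+1)%N%:R *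
    \sum_(x | [forall l : K, `|(count_true l x)%:R - (m l)%:R| <= delta * Num.sqrt
        N%:R]) P x.
Proof.
move=> N0 hr; set sn := Num.sqrt N%:R.
have sn2 : sn ^+ 2 = N%:R by rewrite sqr_sqrtr.
have sn1 : 1 <= sn.
  by rewrite -[1]sqrtr1 ler_sqrt ?ltr0n // ler1n.
set t := Num.truncn sn.
have /andP[t1 t2] : t%:R <= sn < t.+1%:R by rewrite truncn_itv // (le_trans _ sn1).
(* As [sqrt N < t.+1], [b ^ 2] is at least [8 * Lm.+1 * N]; with the variance bound [4 * N] each of
   the [Lm.+1] coordinates fails with probability at most [1 / (2 * Lm.+1)]. As
   [t.+1 <= 2 * sqrt N], [b] is at most [16 * Lm.+1 * sqrt N]. *)
pose b := (8 * Lm.+1 * t.+1)%N.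
have bE : b%:R = 8 * Lm.+1%:R * t.+1%:R :> R by rewrite !natrM.
apply: (@le_trans _ _ (\sum_(x | near_center b (counts x)) P x)); last first.
  apply: (le_trans (box_contract b r)).
  rewrite ler_wpM2l ?ler0n // [leRHS]big_mkcond [leLHS]big_mkcond.
  apply: ler_sum => x _; case: ifPn => [/forallP xb|_]; last first.
    by case: ifP => // _; exact: bernoulli_prod_ge0.
  rewrite ifT //; apply/forallP => l; rewrite -absdiffE.
  have := xb l; rewrite ffunE leq_divRL // -(ler_nat R) natrM bE => xl.
  rewrite -(@ler_pM2r _ r.+1%:R) ?ltr0n // (le_trans xl) //.
  have -> : delta * sn * r.+1%:R = delta * r.+1%:R * sn by ring.
  apply: (@le_trans _ _ (16 * Lm.+1%:R * sn)); last by rewrite ler_wpM2r // (le_trans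
      _ sn1).
  have -> : 16 * Lm.+1%:R * sn = 8 * Lm.+1%:R * (2 * sn) by ring.
  rewrite ler_wpM2l ?mulr_ge0 ?ler0n // -natr1; lra.
have bad l : \sum_(x | (b%:R : R) < `|(count_true (l : K) x)%:R - (m l)%:R|) P x <=
    (2 * Lm.+1%:R)^-1.
  have b0 : 0 < b%:R :> R by rewrite ltr0n.
  have := markov_sqr (bernoulli_prod_ge0 p01)
    (fun x => (count_true l x)%:R - (m l)%:R) b0.
  have -> : fexp P (fun x => ((count_true l x)%:R - (m l)%:R) ^+ 2) =
     fcov P (fun x => (count_true l x)%:R) (fun x => (count_true l x)%:R).
    by apply: eq_fexp => x; rewrite fexp_count expr2.
  move=> /le_trans/(_ (fvar_count_le l)) h.
  have b2 : 8 * Lm.+1%:R * N%:R <= b%:R ^+ 2 :> R.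
    have NT : N%:R <= t.+1%:R ^+ 2 :> R.
      by rewrite -sn2 lerXn2r ?nnegrE ?ler0n ?(le_trans _ sn1) // ltW.
    have L1 : 1 <= Lm.+1%:R :> R by rewrite ler1n.
    rewrite bE; have T0 := ler0n R t.+1; have N0' := ler0n R N.
    have -> : (8 * Lm.+1%:R * t.+1%:R) ^+ 2 = 8 * Lm.+1%:R * (8 * Lm.+1%:R * t.+1%:R
        ^+ 2) :> R.
      by ring.
    by rewrite ler_wpM2l ?mulr_ge0 ?ler0n // (le_trans NT) // ler_peMl ?sqr_ge0 //; lra.
  have L0 : 0 < 2 * Lm.+1%:R :> R by rewrite mulr_gt0 ?ltr0n.
  have Nb : 0 < b%:R ^+ 2 :> R by rewrite exprn_gt0.
  rewrite -(ler_pM2l Nb); apply: le_trans h _.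
  by rewrite ler_pdivlMr //; apply: le_trans b2; rewrite le_eqVlt; apply/orP; left;
      apply/eqP; ring.
have tot := bernoulli_prod_sum p.
rewrite (bigID (fun x => near_center b (counts x))) /= in tot.
suff : \sum_(x | ~~ near_center b (counts x)) P x <= 1 / 2 by lra.
apply: (@le_trans _ _ (\sum_(l : K) \sum_(x | (b%:R : R) < `|(count_true l x)%:R - (m
    l)%:R|) P x)).
  under [leRHS]eq_bigr => l _ do rewrite big_mkcond.
  rewrite exchange_big big_mkcond; apply: ler_sum => x _.
  case: ifPn => [/forallPn[l]|_]; last first.
    by apply: sumr_ge0 => l _; case: ifP => // _; exact: bernoulli_prod_ge0.
  rewrite ffunE -(ler_nat R) absdiffE -ltNge => xl.
  rewrite (bigD1 l) //= xl lerDl; apply: sumr_ge0 => l' _.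
  by case: ifP => // _; exact: bernoulli_prod_ge0.
apply: (@le_trans _ _ (\sum_(l : K) (2 * Lm.+1%:R)^-1)); first by apply: ler_sum.
rewrite sumr_const card_ord -mulr_natr le_eqVlt; apply/orP; left; apply/eqP.
by field; rewrite -[1]/(1%:R) -natrD pnatr_eq0.
Qed.

End Box.

(** * Gaussian distribution function *)

Section RealCalculus.
Variable R : realType.
Implicit Types (f df : R -> R) (x y : R).

Lemma is_derive_continuous f x l : is_derive x (1 : R) f l -> {for x, continuous f}.
Proof.
by move=> H; apply/differentiable_continuous/derivable1_diffP; apply: ex_derive.
Qed.

Lemma is_derive_mvt f df x y : x <= y ->
  (forall z, x <= z <= y -> is_derive z (1 : R) f (df z)) ->
  exists2 z, x <= z <= y & f y - f x = df z * (y - x).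
Proof.
move=> xy fd.
have [| |z zi zE] := @MVT_segment _ f df x y xy.
- by move=> z; rewrite in_itv /= => /andP[xz zy]; apply: fd; rewrite !ltW.
- apply: derivable_within_continuous => z; rewrite in_itv /= => /fd; exact: @ex_derive.
by exists z.
Qed.

Lemma is_derive_lipschitz f df C : (forall z, is_derive z (1 : R) f (df z)) ->
  (forall z, `|df z| <= C) -> forall x y, `|f y - f x| <= C * `|y - x|.
Proof.
move=> fd dfC x y; wlog xy : x y / x <= y.
  by move=> wl; have [/wl//|/ltW/wl] := leP x y; rewrite distrC [`|x - y|]distrC.
have [z _ ->] := is_derive_mvt xy (fun z _ => fd z).
by rewrite normrM ler_wpM2r.
Qed.

Lemma bounded_of_tails f a b C : (forall x, {for x, continuous f}) ->
  (forall x, x <= a -> `|f x| <= C) -> (forall x, b <= x -> `|f x| <= C) ->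
  exists2 C', 0 <= C' & forall x, `|f x| <= C'.
Proof.
move=> cf fa fb; set u := Num.min a b; set v := Num.max a b.
have uv : u <= v by rewrite /u /v ge_min le_max lexx.
have cn : {within `[u, v], continuous (fun x => `|f x|)}.
  apply: continuous_subspaceT => x; apply: (cvg_norm (V := R^o)); exact: cf.
have [c _ cM] := EVT_max uv cn.
have C0 : 0 <= C by exact: le_trans (normr_ge0 _) (fa a (lexx _)).
exists (C + `|f c|) => [|x]; first by rewrite addr_ge0.
have [xu|ux] := leP x u.
  by rewrite (le_trans (fa x _)) ?lerDl // (le_trans xu) // /u ge_min lexx.
have [xv|vx] := leP x v.
  by rewrite (le_trans (cM x _)) ?lerDr // in_itv /= (ltW ux) xv.
by rewrite (le_trans (fb x _)) ?lerDl // (le_trans _ (ltW vx)) // /v le_max lexx orbT.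
Qed.

End RealCalculus.

Section GaussianCdf.
Variables (R : realType) (sg : R).
Hypothesis sg0 : 0 < sg.
Local Notation mu := (@lebesgue_measure R).
Local Notation phi := (normal_pdf 0 sg).

Definition gauss_cdf (x : R) : R := fine (normal_prob 0 sg [set` `]-oo, x]]).

(** The identity as a random variable under the normal law, so that the limits of distribution
    functions at infinity apply to [gauss_cdf]. *)
Let idTR : measurableTypeR R -> R := idfun.
#[local] HB.instance Definition _ :=
  @isMeasurableFun.Build _ _ _ _ idTR (@measurable_id _ _ setT).

Lemma gauss_cdf_cvgNy : gauss_cdf x @[x --> -oo%R] --> (0 : R).
Proof.
have := @cvg_cdfNy0 _ _ _ (normal_prob 0 sg) (idTR : {RV (normal_prob 0 sg) >-> R}).
exact: fine_cvg.
Qed.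

Lemma gauss_cdf_cvgy : gauss_cdf x @[x --> +oo%R] --> (1 : R).
Proof.
have := @cvg_cdfy1 _ _ _ (normal_prob 0 sg) (idTR : {RV (normal_prob 0 sg) >-> R}).
exact: fine_cvg.
Qed.

Lemma gauss_cdf01 x : 0 <= gauss_cdf x <= 1.
Proof.
apply/andP; split; first exact: fine_ge0.
rewrite -[1]/(fine 1%E); apply: fine_le; rewrite ?fin_num_measure //.
exact: probability_le1.
Qed.

Lemma phi_gt0 x : 0 < phi x.
Proof. by rewrite normal_pdfE ?gt_eqF // mulr_gt0 ?expR_gt0 // normal_peak_gt0 //
    gt_eqF. Qed.

Lemma is_derive_phi x : is_derive x (1 : R) phi (- (x / sg ^+ 2) * phi x).
Proof.
rewrite normal_pdfE ?gt_eqF // /normal_fun.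
apply: is_derive_eq; rewrite ?/GRing.scale /= -[sg ^+ 2 *+ 2]mulr_natr.
by move: (expR _) => E; field; rewrite gt_eqF.
Qed.

Section Weighted.
Variable h : R -> R.
Hypotheses (hc : continuous h) (h01 : forall x, 0 <= h x <= 1).

(** With [h = 1] this is the Gaussian distribution function; with a ramp it is the numerator in the
    solution of Stein's equation. One application of the fundamental theorem of calculus
    differentiates both. *)
Definition weighted_cdf (x : R) : R :=
  (\int[mu]_(t in [set` `]-oo, x]]) (h t * phi t))%R.

Lemma integrable_weighted (A : set R) : measurable A ->
  mu.-integrable A (EFin \o (fun t => h t * phi t)).
Proof.
move=> mA; apply: (integrableS measurableT) => //.
apply: (le_integrable measurableT _ _ (integrable_normal_pdf 0 sg)).
  apply/measurable_EFinP; apply: measurable_funM; last exact: measurable_normal_pdf.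
  exact: continuous_measurable_fun.
move=> x _ /=; rewrite lee_fin normrM [`|h x|]ger0_norm; last by case/andP: (h01 x).
by rewrite ler_piMl //; case/andP: (h01 x).
Qed.

Lemma is_derive_weighted_cdf x : is_derive x (1 : R) weighted_cdf (h x * phi x).
Proof.
have xu : x < x + 1 by rewrite ltrDl.
have int := integrable_weighted (measurable_itv `]-oo, x + 1]).
have cx : {for x, continuous (fun t => h t * phi t)}.
  by apply: cvgM; [exact: hc|apply: continuous_normal_pdf; rewrite gt_eqF].

have [d dE] : derivable weighted_cdf x 1 /\ derive1 weighted_cdf x = h x * phi x.
  apply: (continuous_FTC1 xu int _ cx). by rewrite ltNyr.
by apply: DeriveDef => //; rewrite -derive1E.
Qed.

End Weighted.

Lemma gauss_cdf_weighted : gauss_cdf = weighted_cdf (fun=> 1).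
Proof.
apply/funext => x; rewrite /gauss_cdf /weighted_cdf /normal_prob /Rintegral.
by congr fine; apply: eq_integral => t _; rewrite mul1r.
Qed.

Lemma is_derive_gauss_cdf x : is_derive x (1 : R) gauss_cdf (phi x).
Proof.
rewrite gauss_cdf_weighted -[phi x]mul1r.
apply: (@is_derive_weighted_cdf (fun=> 1)) => [y|y]; first exact: cvg_cst.
by rewrite ler01 lexx.
Qed.

End GaussianCdf.

(** * Bounds on the Mills ratio in the left tail *)

Section MillsRatio.
Variables (R : realType) (sg : R).
Hypothesis sg0 : 0 < sg.
Local Notation phi := (normal_pdf 0 sg).

Lemma phi_even x : phi (- x) = phi x.
Proof. by rewrite !normal_pdfE ?gt_eqF // /normal_fun !subr0 sqrrN. Qed.

Lemma phi_cvgNy : phi x @[x --> -oo%R] --> (0 : R).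
Proof.
(* From [expR t >= t] one gets [phi x <= q / x ^+ 2], which is at most [eps] once [x <= -1] and
   [x <= - (q / eps)]. *)
pose q := normal_peak sg * (2 * sg ^+ 2).
have pk0 : 0 < normal_peak sg by rewrite normal_peak_gt0 ?gt_eqF.
have q0 : 0 < q by rewrite !mulr_gt0 // exprn_gt0.
apply/cvgrPdist_le => eps eps0; near=> x.
have x1 : x <= -1 by near: x; apply: nbhs_ninfty_le; rewrite num_real.
have xq : x <= - (q / eps) by near: x; apply: nbhs_ninfty_le; rewrite num_real.
rewrite sub0r normrN gtr0_norm ?phi_gt0 //.
rewrite normal_pdfE ?gt_eqF // /normal_fun subr0 mulNr expRN.
have s2 : 0 < sg ^+ 2 by rewrite exprn_gt0.
have x0 : x != 0 by rewrite lt_eqF //; lra.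
set t := x ^+ 2 / _.
have t0 : 0 < t by rewrite divr_gt0 // ?mulrn_wgt0 // exprn_even_gt0.
apply: (@le_trans _ _ (normal_peak sg / t)).
  rewrite ler_wpM2l ?(ltW pk0) // lef_pV2 ?posrE ?expR_gt0 //.
  by rewrite (le_trans _ (expR_ge1Dx t)) // lerDr.
have -> : normal_peak sg / t = q / x ^+ 2.
  by rewrite /t /q -[sg ^+ 2 *+ 2]mulr_natr; field; rewrite x0 gt_eqF.
rewrite ler_pdivrMr ?exprn_even_gt0 //.
move: xq; rewrite lerNr ler_pdivrMr // => xq.
by apply: (le_trans xq); rewrite mulrC ler_wpM2l ?(ltW eps0) //; nra.
Unshelve. all: by end_near. Qed.

(** Kept abstract to serve both tails: [Theta] will be [gauss_cdf] on the left and its reflection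
    [1 - gauss_cdf (- y)] on the right. *)
Variable Theta : R -> R.
Hypotheses (dTheta : forall x, is_derive x (1 : R) Theta (phi x))
  (ThetaNy : Theta x @[x --> -oo%R] --> (0 : R)).

(* [s * (Theta - g * phi)] tends to 0 at [-oo] and is nondecreasing. *)
Lemma tail_compare (s : R) (g dg : R -> R) (C x0 : R) : `|s| = 1 ->
  (forall z, z <= x0 -> is_derive z (1 : R) g (dg z)) ->
  (forall z, z <= x0 -> `|g z| <= C) ->
  (forall z, z <= x0 -> 0 <= s * (1 - (dg z - g z * (z / sg ^+ 2)))) ->
  0 <= s * (Theta x0 - g x0 * phi x0).
Proof.
move=> s1 dgP gC sP; pose D x := s * (Theta x - g x * phi x).
have C0 : 0 <= C by exact: le_trans (normr_ge0 _) (gC x0 (lexx _)).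
pose D1 z := s * (1 - (dg z - g z * (z / sg ^+ 2))) * phi z.
have dD z : z <= x0 -> is_derive z (1 : R) D (D1 z).
  move=> zx; have := dTheta z; have := dgP z zx; have := is_derive_phi sg0 z.
  move=> ? ? ?; rewrite /D /D1; apply: is_derive_eq; rewrite /GRing.scale /=; ring.
have mono y : y <= x0 -> D y <= D x0.
  move=> yx; have dDy z : y <= z <= x0 -> is_derive z (1 : R) D (D1 z).
    by move=> /andP[_ /dD].
  have [z /andP[_ zx] E] := is_derive_mvt yx dDy.
  rewrite -subr_ge0 E /D1; apply: mulr_ge0; last by rewrite subr_ge0.
  by apply: mulr_ge0; [exact: sP|exact: normal_pdf_ge0].
rewrite -/(D x0) leNgt; apply/negP => D0.
(* Far to the left [|D y|] is at most [(1 + C) * eps = - D x0 / 2], against [D y <= D x0 < 0]. *)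
pose eps := - D x0 / (2 * (1 + C)).
have eps0 : 0 < eps by rewrite divr_gt0 ?oppr_gt0 ?mulr_gt0 // ltr_wpDr.
move/cvgrPdist_le: (ThetaNy) => /(_ _ eps0) N1.
move/cvgrPdist_le: phi_cvgNy => /(_ _ eps0) N2.
have N3 : \forall y \near -oo%R, y <= x0 by apply: nbhs_ninfty_le; rewrite num_real.
have [y [[T1 P1] yx]] := filter_ex (filterI (filterI N1 N2) N3).
have := mono y yx; apply/negP; rewrite -ltNge.
rewrite sub0r normrN in T1; rewrite sub0r normrN in P1.
have : `|D y| <= eps + C * eps.
  rewrite /D normrM s1 mul1r (le_trans (ler_normB _ _)) // lerD // normrM.
  by apply: ler_pM => //; exact: gC.
rewrite ler_norml => /andP[+ _]; apply: lt_le_trans.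
have -> : eps + C * eps = - D x0 / 2 by rewrite /eps; field; rewrite gt_eqF // ltr_wpDr.
by rewrite mulNr opprK; lra.
Qed.

Definition mills_ratio x := Theta x / (sg ^+ 2 * phi x).

(** Comparison with [g z = - sg ^+ 2 * z / (z ^+ 2 + sg ^+ 2)], for which
    [dg z - g z * (z / sg ^+ 2)] falls short of 1 by [2 * sg ^+ 4 / (z ^+ 2 + sg ^+ 2) ^+ 2]. *)
Lemma mills_lower x : x < 0 -> - x / (x ^+ 2 + sg ^+ 2) <= mills_ratio x.
Proof.
move=> x0; have s2 : 0 < sg ^+ 2 by rewrite exprn_gt0.
have den z : 0 < z ^+ 2 + sg ^+ 2 by rewrite ltr_wpDl ?sqr_ge0.
have := @tail_compare 1 (fun z => - sg ^+ 2 * (z * (z ^+ 2 + sg ^+ 2)^-1))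
  (fun z => - sg ^+ 2 * (sg ^+ 2 - z ^+ 2) / (z ^+ 2 + sg ^+ 2) ^+ 2)
  (1 + sg ^+ 2) x.
rewrite normr1 mul1r subr_ge0 => /(_ erefl) H.
rewrite /mills_ratio ler_pdivlMr ?mulr_gt0 ?phi_gt0 //.
apply: le_trans (H _ _ _) => [|z zx|z zx|z zx].
- rewrite le_eqVlt; apply/orP; left; apply/eqP; field; by rewrite gt_eqF.
- have dz := lt0r_neq0 (den z).
  have d1 : is_derive z (1 : R) (fun y => y ^+ 2 + sg ^+ 2) (2 * z).
    by apply: is_derive_eq; rewrite /GRing.scale /=; ring.
  have d2 := @is_deriveV R (fun y => y ^+ 2 + sg ^+ 2) z (2 * z) 1 dz d1.
  by apply: is_derive_eq; rewrite /GRing.scale /=; field.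
- rewrite normrM normrM normrN normfV (gtr0_norm s2) (gtr0_norm (den z)).
  rewrite mulrA ler_pdivrMr //.
  have := sqr_ge0 (`|z| - 1); rewrite sqrrB1 real_normK ?num_real //.
  have := sqr_ge0 z; have := normr_ge0 z.
  set n := `|z|; set w := z ^+ 2; set v := sg ^+ 2 in s2 *.
  move=> n0 w0 h; have : v * n <= v * (w + 1) by rewrite ler_wpM2l ?ltW //; lra.
  by have := mulr_ge0 (ltW s2) w0; have := mulr_ge0 (ltW s2) (ltW s2); lra.
rewrite mul1r subr_ge0.
have -> : - sg ^+ 2 * (sg ^+ 2 - z ^+ 2) / (z ^+ 2 + sg ^+ 2) ^+ 2
   - - sg ^+ 2 * (z * (z ^+ 2 + sg ^+ 2)^-1) * (z / sg ^+ 2)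
   = 1 - 2 * sg ^+ 4 / (z ^+ 2 + sg ^+ 2) ^+ 2.
  by field; rewrite (gt_eqF (den z)) gt_eqF.
by rewrite gerBl divr_ge0 ?mulr_ge0 ?exprn_ge0 ?ltW.
Qed.

(** Comparison with [g z = - sg ^+ 2 / z], for which [dg z - g z * (z / sg ^+ 2)] exceeds 1 by
    [sg ^+ 2 / z ^+ 2]. *)
Lemma mills_upper x : x < 0 -> mills_ratio x <= - x^-1.
Proof.
move=> x0; have s2 : 0 < sg ^+ 2 by rewrite exprn_gt0.
have := @tail_compare (-1) (fun z => - sg ^+ 2 * z^-1) (fun z => sg ^+ 2 * z ^- 2)
  (sg ^+ 2 * - x^-1) x.
rewrite normrN1 mulN1r opprB subr_ge0 => /(_ erefl) H.
rewrite /mills_ratio ler_pdivrMr ?mulr_gt0 ?phi_gt0 //.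
apply: le_trans (H _ _ _) _ => [z zx|z zx|z zx|].
- have z0 : z != 0 by rewrite lt_eqF // (le_lt_trans zx).
  have d2 := @is_deriveV R id z 1 1 z0 (is_derive_id z (1 : R)).
  by apply: is_derive_eq; rewrite /GRing.scale /=; field.
- rewrite normrM normrN (gtr0_norm s2) (ler_wpM2l (ltW s2)) //.
  rewrite ltr0_norm ?invr_lt0 ?(le_lt_trans zx) // lerN2 lef_nV2 ?negrE //.
  exact: le_lt_trans x0.
- have z0 : z != 0 by rewrite lt_eqF // (le_lt_trans zx).
  have -> : sg ^+ 2 * z ^- 2 - - sg ^+ 2 * z^-1 * (z / sg ^+ 2) = sg ^+ 2 * z ^- 2 + 1.
    by field; rewrite z0 gt_eqF.
  have : 0 <= sg ^+ 2 * z ^- 2 by rewrite mulr_ge0 ?invr_ge0 ?exprn_even_ge0 ?ltW.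
  by lra.
by rewrite le_eqVlt; apply/orP; left; apply/eqP; ring.
Qed.

(** These control [psi], [x * psi] and [x * psi1] in the tails. The third needs the sharper lower
    bound, which gives [1 + x * mills_ratio x <= sg ^+ 2 / (x ^+ 2 + sg ^+ 2)]. *)
Lemma mills_bounds x : x <= -1 ->
  [/\ `|mills_ratio x| <= 1, `|x * mills_ratio x| <= 1
    & `|x * (1 + x * mills_ratio x)| <= 1 + sg ^+ 2].
Proof.
move=> x1; have x0 : x < 0 by lra.
have s2 : 0 < sg ^+ 2 by rewrite exprn_gt0.
have den : 0 < x ^+ 2 + sg ^+ 2 by rewrite ltr_wpDl ?sqr_ge0.
have := mills_lower x0; have := mills_upper x0; set r := mills_ratio x.
move=> r1; rewrite (ler_pdivrMr _ _ den) => r2.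
have xr1 : -1 <= x * r.
  have := ler_wnM2l (ltW x0) r1; by rewrite mulrN mulfV ?lt_eqF.
have r0 : 0 <= r.
  rewrite leNgt; apply/negP => rn.
  have : r * (x ^+ 2 + sg ^+ 2) < 0 by rewrite nmulr_rlt0.
  by lra.
have xr0 : x * r <= 0 by rewrite nmulr_rle0.
have rle1 : r <= 1 by nra.
split.
- by rewrite ger0_norm.
- by rewrite ler0_norm //; lra.
rewrite normrM ltr0_norm // ger0_norm; last by lra.
have : (1 + x * r) * (x ^+ 2 + sg ^+ 2) <= sg ^+ 2.
  have -> : (1 + x * r) * (x ^+ 2 + sg ^+ 2) = x ^+ 2 + sg ^+ 2
     + x * (r * (x ^+ 2 + sg ^+ 2)) by ring.
  have := ler_wnM2l (ltW x0) r2; rewrite mulrN -expr2; lra.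
move=> h; rewrite -(ler_pM2r den) -mulrA; apply: (@le_trans _ _ (- x * sg ^+ 2)).
  by rewrite ler_wpM2l //; lra.
set v := sg ^+ 2 in s2 *; have := sqr_ge0 (x + 1); have := sqr_ge0 x.
rewrite sqrrD1; set w := x ^+ 2 => w0 h2.
have : v * - x <= v * (w + 1) by rewrite ler_wpM2l ?ltW //; rewrite /w; nra.
by have := mulr_ge0 (ltW s2) w0; have := mulr_ge0 (ltW s2) (ltW s2); lra.
Qed.

End MillsRatio.

(** * Solution of Stein's equation *)

Section Ramp.
Variables (R : realType) (a b : R).
Hypothesis ab : a < b.

Definition ramp (x : R) : R := Num.min 1 (Num.max 0 ((b - x) / (b - a))).

Let d0 : 0 < b - a. Proof. by rewrite subr_gt0. Qed.

Lemma ramp01 x : 0 <= ramp x <= 1.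
Proof. by rewrite /ramp le_min ler01 le_max lexx /= ge_min lexx. Qed.

Lemma ramp_left x : x <= a -> ramp x = 1.
Proof.
move=> xa; rewrite /ramp min_l // le_max; apply/orP; right.
by rewrite ler_pdivlMr // mul1r lerD2l lerN2.
Qed.

Lemma ramp_right x : b <= x -> ramp x = 0.
Proof.
move=> bx; rewrite /ramp max_l ?min_r ?ler01 //.
by rewrite ler_pdivrMr // mul0r subr_le0.
Qed.

Lemma ramp_lip x y : `|ramp x - ramp y| <= (b - a)^-1 * `|x - y|.
Proof.
have -> : (b - a)^-1 * `|x - y| = `|(b - x) / (b - a) - (b - y) / (b - a)|.
  rewrite -mulrBl normrM [`|(b - a)^-1|]ger0_norm ?invr_ge0 ?ltW // mulrC.
  by rewrite (_ : b - x - (b - y) = - (x - y)) ?normrN //; ring.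
rewrite /ramp; move: (_ / _) (_ / _) => u v.
have H s t : s <= t -> `|Num.min 1 (Num.max 0 s) - Num.min 1 (Num.max 0 t)| <= `|s -
    t| :> R.
  move=> st; rewrite [`|s - t|]distrC (ger0_norm (_ : 0 <= t - s)) ?subr_ge0 //.
  have Hm : Num.min 1 (Num.max 0 s) <= Num.min 1 (Num.max 0 t).
    by rewrite le_min2 // le_max2.
  have M : Num.max 0 t <= Num.max 0 s + (t - s).
    rewrite ge_max addr_ge0 ?subr_ge0 ?le_max ?lexx //=.
    have : s <= Num.max 0 s by rewrite le_max lexx orbT.
    by lra.
  rewrite distrC ger0_norm ?subr_ge0 //; have [m1|m1] := leP 1 (Num.max 0 s).
    have : Num.min 1 (Num.max 0 t) <= 1 by rewrite ge_min lexx.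
    by lra.
  have : Num.min 1 (Num.max 0 t) <= Num.max 0 t by rewrite ge_min lexx orbT.
  by lra.
have [uv|/ltW vu] := leP v u; first exact: H.
by rewrite distrC [`|v - u|]distrC; exact: H.
Qed.

Lemma ramp_continuous : continuous ramp.
Proof.
move=> x; apply/cvgrPdist_le => eps eps0.
near=> y; rewrite (le_trans (ramp_lip x y)) // -ler_pdivlMl ?invr_gt0 // invrK.
near: y; apply: cvgr_dist_le; first exact: cvg_id.
by rewrite mulr_gt0.
Unshelve. all: by end_near. Qed.

End Ramp.

Section SteinSolution.
Variables (R : realType) (sg a b : R).
Hypotheses (sg0 : 0 < sg) (ab : a < b).
Local Notation phi := (normal_pdf 0 sg).
Local Notation h := (ramp a b).
Local Notation Phi := (gauss_cdf sg).
Local Notation W := (weighted_cdf sg h).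

(* [ramp a b] vanishes beyond [b], so [c] is its full Gaussian mean. *)
Let c : R := W b.
(** Variation of constants for [sg ^+ 2 * psi' - x * psi = h - c]. Subtracting [c * Phi] makes the
    numerator tend to 0 at both ends, which selects the bounded solution; [psi1] is the derivative
    read off from the equation. *)
Let psi (x : R) : R := (W x - c * Phi x) / (sg ^+ 2 * phi x).
Let psi1 (x : R) : R := (h x - c + x * psi x) / sg ^+ 2.

Let s2 : 0 < sg ^+ 2. Proof. by rewrite exprn_gt0. Qed.

Let dW x : is_derive x (1 : R) W (h x * phi x).
Proof.
by apply: is_derive_weighted_cdf => //; [exact: ramp_continuous|move=> y; exact:
    ramp01].
Qed.

Let dPhi x : is_derive x (1 : R) Phi (phi x).
Proof. exact: is_derive_gauss_cdf. Qed.

Let W_left x : x <= a -> W x = Phi x.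
Proof.
move=> xa; rewrite gauss_cdf_weighted; apply: eq_Rintegral => t.
by rewrite inE /= in_itv /= => tx; rewrite ramp_left // (le_trans tx).
Qed.

Let W_right x : b <= x -> W x = c.
Proof.
move=> bx; have [z /andP[bz _] E] := is_derive_mvt bx (fun z _ => dW z).
by apply/eqP; rewrite -subr_eq0 E (ramp_right ab bz) !mul0r.
Qed.

(** The ramp lies between the indicators of the half-lines ending at [a] and [b]. This sandwich is
    all that the final comparison of distribution functions asks of [c]. *)
Lemma stein_constant : Phi a <= c <= Phi b.
Proof.
apply/andP; split.
  rewrite -W_left // -subr_ge0.
  have [z _ ->] := is_derive_mvt (ltW ab) (fun z _ => dW z).
  by rewrite !mulr_ge0 ?normal_pdf_ge0 ?subr_ge0 ?(ltW ab) //; case/andP: (ramp01 a b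
      z).
have dD z : is_derive z (1 : R) (fun x => Phi x - W x) ((1 - h z) * phi z).
  have := dPhi z; have := dW z => ? ?; apply: is_derive_eq.
  by ring.
have [z _] := is_derive_mvt (ltW ab) (fun z _ => dD z).
rewrite (W_left (lexx a)) subrr subr0 => E; rewrite -subr_ge0 E.
rewrite !mulr_ge0 ?normal_pdf_ge0 ?subr_ge0 ?(ltW ab) //; by case/andP: (ramp01 a b z).
Qed.

Let c01 : 0 <= c <= 1.
Proof.
have /andP[c1 c2] := stein_constant.
have /andP[p1 _] := gauss_cdf01 sg a; have /andP[_ p2] := gauss_cdf01 sg b.
by rewrite (le_trans p1) // (le_trans c2).
Qed.

Let dpsi x : is_derive x (1 : R) psi (psi1 x).
Proof.
have phi0 : sg ^+ 2 * phi x != 0 by rewrite gt_eqF // mulr_gt0 // phi_gt0.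
have := dW x; have := dPhi x; have := is_derive_phi sg0 x => ? ? ?.
have d1 : is_derive x (1 : R) (fun y => sg ^+ 2 * phi y) (- (x * phi x)).
  apply: is_derive_eq; rewrite /GRing.scale /=; field; by rewrite gt_eqF.
have d2 := @is_deriveV R (fun y => sg ^+ 2 * phi y) x _ 1 phi0 d1.
have d3 : is_derive x (1 : R) (fun y => W y - c * Phi y) ((h x - c) * phi x).
  by apply: is_derive_eq; rewrite /GRing.scale /=; ring.
apply: is_derive_eq; rewrite /psi1 /psi /GRing.scale /=.
by field; rewrite !gt_eqF // phi_gt0.
Qed.

Let psi_stein x : sg ^+ 2 * psi1 x - x * psi x = h x - c.
Proof. by rewrite /psi1; field; rewrite gt_eqF. Qed.

(** The upper tail reflected to the left, where [mills_bounds] applies. *)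
Let Theta y : R := 1 - Phi (- y).

Let dTheta y : is_derive y (1 : R) Theta (phi y).
Proof.
have d1 : is_derive (- y) (1 : R) Phi (phi (- y)) by exact: dPhi.
have d2 : is_derive y (1 : R) (fun z : R => - z) (- 1) by apply: is_derive_eq.
have d3 := is_derive1_comp d1 d2.
apply: is_derive_eq; rewrite phi_even //; ring.
Qed.

Let ThetaNy : Theta x @[x --> -oo%R] --> (0 : R).
Proof.
rewrite -(subrr (1 : R)); apply: (@cvgB _ R^o); first exact: cvg_cst.
apply/(cvgNy_compNP (fun x => Phi (- x))).
rewrite (_ : _ \o _ = Phi); first exact: gauss_cdf_cvgy.
by apply/funext => x; rewrite /= opprK.
Qed.

(** Left of [a] the ramp is 1, so [W = Phi] and [psi] is [1 - c] times the Mills ratio;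
    symmetrically, right of [b] it is [c] times the reflected ratio. *)
Let tail_left x : x <= Num.min a (-1) ->
  [/\ `|psi x| <= 1, `|x * psi x| <= 1 & `|x * psi1 x| <= (1 + sg ^+ 2) / sg ^+ 2].
Proof.
rewrite le_min => /andP[xa x1].
have [m1 m2 m3] := mills_bounds sg0 dPhi (gauss_cdf_cvgNy sg) x1.
have /andP[c0 c1] := c01.
have pE : psi x = (1 - c) * mills_ratio sg Phi x.
  by rewrite /psi W_left // /mills_ratio; field; rewrite !gt_eqF // phi_gt0.
have u1 : `|1 - c| <= 1 by rewrite ger0_norm; lra.
split; first by rewrite pE normrM -[leRHS]mulr1 ler_pM.
  by rewrite pE mulrCA normrM -[leRHS]mulr1 ler_pM.
have -> : x * psi1 x = (1 - c) * (x * (1 + x * mills_ratio sg Phi x)) / sg ^+ 2.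
  by rewrite /psi1 pE ramp_left //; ring.
rewrite normrM [`|_^-1|]ger0_norm ?invr_ge0 ?sqr_ge0 // ler_wpM2r ?invr_ge0 ?sqr_ge0 //.
by rewrite normrM -[leRHS]mul1r ler_pM.
Qed.

Let tail_right x : Num.max b 1 <= x ->
  [/\ `|psi x| <= 1, `|x * psi x| <= 1 & `|x * psi1 x| <= (1 + sg ^+ 2) / sg ^+ 2].
Proof.
rewrite ge_max => /andP[bx x1]; have x1' : - x <= -1 by lra.
have [m1 m2 m3] := mills_bounds sg0 dTheta ThetaNy x1'.
have /andP[c0 c1] := c01.
have pE : psi x = c * mills_ratio sg Theta (- x).
  rewrite /psi W_right // /mills_ratio /Theta opprK phi_even //.
  by field; rewrite !gt_eqF // phi_gt0.
have u1 : `|c| <= 1 by rewrite ger0_norm.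
split; first by rewrite pE normrM -[leRHS]mulr1 ler_pM.
  by rewrite pE -normrN mulrCA -mulrN -mulNr normrM -[leRHS]mulr1 ler_pM.
have -> : x * psi1 x = c * (- x * (1 + - x * mills_ratio sg Theta (- x))) / sg ^+ 2.
  by rewrite /psi1 pE ramp_right //; ring.
rewrite normrM [`|_^-1|]ger0_norm ?invr_ge0 ?sqr_ge0 // ler_wpM2r ?invr_ge0 ?sqr_ge0 //.
by rewrite normrM -[leRHS]mul1r ler_pM.
Qed.

(** Tail estimates and continuity bound [psi], [x * psi] and [x * psi1] on the whole line; the
    equation turns these into a bound and a Lipschitz bound for [psi1], whence the second-order
    remainder. *)
Lemma stein_solution : exists (psi psi1 : R -> R) (c C : R),
  [/\ Phi a <= c <= Phi b, 0 <= C,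
      forall x, sg ^+ 2 * psi1 x - x * psi x = h x - c
    & [/\ forall x, `|psi x| <= C, forall x, `|psi1 x| <= C,
      forall x u, `|psi x - psi (x - u)| <= C * `|u|
    & forall x u, `|psi x - psi (x - u) - psi1 x * u| <= C * `|u| ^+ 2]].
Proof.
have cpsi x : {for x, continuous psi} by exact: is_derive_continuous (dpsi x).
have cxpsi x : {for x, continuous (fun y : R => y * psi y)}.
  by apply: cvgM; [exact: cvg_id|exact: cpsi].
have cpsi1 x : {for x, continuous psi1}.
  apply: cvgM; last exact: cvg_cst.
  apply: (@cvgD _ R^o); last exact: cxpsi.
  by apply: (@cvgB _ R^o); [exact: ramp_continuous|exact: cvg_cst].
have cxpsi1 x : {for x, continuous (fun y : R => y * psi1 y)}.
  by apply: cvgM; [exact: cvg_id|exact: cpsi1].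
have [C1 C10 B1] : exists2 C', 0 <= C' & forall x, `|psi x| <= C'.
  by apply: (@bounded_of_tails _ _ (Num.min a (-1)) (Num.max b 1) 1 cpsi) => x;
      [move=> /tail_left[]|move=> /tail_right[]].
have [C2 C20 B2] : exists2 C', 0 <= C' & forall x, `|x * psi x| <= C'.
  by apply: (@bounded_of_tails _ _ (Num.min a (-1)) (Num.max b 1) 1 cxpsi) => x;
      [move=> /tail_left[]|move=> /tail_right[]].
have [C3 C30 B3] : exists2 C', 0 <= C' & forall x, `|x * psi1 x| <= C'.
  by apply: (@bounded_of_tails _ _ (Num.min a (-1)) (Num.max b 1) ((1 + sg ^+ 2) / sg
      ^+ 2) cxpsi1) => x;
      [move=> /tail_left[]|move=> /tail_right[]].
pose C4 := (1 + C2) / sg ^+ 2; pose C5 := ((b - a)^-1 + (C1 + C3)) / sg ^+ 2.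
have d0 : 0 <= (b - a)^-1 by rewrite invr_ge0 subr_ge0 ltW.
have C40 : 0 <= C4 by rewrite divr_ge0 ?sqr_ge0 ?addr_ge0.
have C50 : 0 <= C5 by rewrite divr_ge0 ?sqr_ge0 ?addr_ge0.
have B4 x : `|psi1 x| <= C4.
  rewrite /psi1 normrM [`|_^-1|]ger0_norm ?invr_ge0 ?sqr_ge0 //.
  rewrite ler_wpM2r ?invr_ge0 ?sqr_ge0 // (le_trans (ler_normD _ _)) // lerD //.
  rewrite ler_norml; have /andP[? ?] := c01; have /andP[? ?] := ramp01 a b x.
  by apply/andP; split; lra.
have dxpsi x : is_derive x (1 : R) (fun y : R => y * psi y) (psi x + x * psi1 x).
  by have := dpsi x => ?; apply: is_derive_eq; rewrite /GRing.scale /=; ring.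
(* In the formula for [psi1] the ramp is Lipschitz, and [y * psi y] has the bounded derivative
   [psi + y * psi1]. *)
have B5 x y : `|psi1 x - psi1 y| <= C5 * `|x - y|.
  have -> : psi1 x - psi1 y = (h x - h y + (x * psi x - y * psi y)) / sg ^+ 2.
    by rewrite /psi1; ring.
  rewrite normrM [`|_^-1|]ger0_norm ?invr_ge0 ?sqr_ge0 // /C5 mulrAC.
  rewrite ler_wpM2r ?invr_ge0 ?sqr_ge0 // mulrDl (le_trans (ler_normD _ _)) // lerD //.
    exact: ramp_lip.
  apply: (is_derive_lipschitz dxpsi) => z.
  by rewrite (le_trans (ler_normD _ _)) // lerD.
have mvt_le s t : s <= t -> exists2 z, s <= z <= t & psi t - psi s = psi1 z * (t - s).
  by move=> st; apply: (is_derive_mvt st) => z _; exact: dpsi.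
have mvt x u : exists2 z, `|x - z| <= `|u| & psi x - psi (x - u) = psi1 z * u.
  have [u0|/ltW u0] := leP 0 u.
    have [|z /andP[z1 z2] E] := mvt_le (x - u) x; first by rewrite gerBl.
    exists z; first by rewrite !ger0_norm ?subr_ge0 // lerBlDr -lerBlDl.
    by rewrite E opprB addrC subrK.
  have [|z /andP[z1 z2] E] := mvt_le x (x - u); first by rewrite lerDl oppr_ge0.
  exists z; first by rewrite distrC [`|u|]ler0_norm // ger0_norm ?subr_ge0 //; lra.
  by rewrite -opprB E; ring.
exists psi, psi1, c, (C1 + C4 + C5); split.
- exact: stein_constant.
- by rewrite !addr_ge0.
- exact: psi_stein.
split=> [x|x|x u|x u].
- by rewrite (le_trans (B1 x)) // -addrA lerDl addr_ge0.
- by rewrite (le_trans (B4 x)) // -addrA addrCA lerDl addr_ge0.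
- have [z _ ->] := mvt x u; rewrite normrM ler_wpM2r // (le_trans (B4 z)) //.
  by rewrite -addrA addrCA lerDl addr_ge0.
have [z xz ->] := mvt x u; rewrite -mulrBl normrM expr2 mulrA ler_wpM2r //.
rewrite (le_trans (B5 z x)) // distrC ler_pM // lerDr addr_ge0 //.
Qed.

End SteinSolution.

(** * Stratified permutations *)

Section StratifiedPermutations.
Variables (R : realType) (I : finType) (e : I -> nat) (L Lm : nat).
Hypothesis eL : forall i, (e i <= L)%N.
Local Notation X := {ffun I -> bool}.
Local Notation tuple_perm := {ffun 'I_L -> {perm I}}.
Implicit Types (x y : X) (tau : tuple_perm) (i j : I).

Definition level (l : nat) : {set I} := [set i | e i == l]%SET.
Definition level_pmf tau : R :=
  \prod_l (if tau l \in Sym (level l.+1) then #|Sym (level l.+1)|%:R^-1 else 0).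
Definition compose_levels tau : {perm I} := (\prod_(l < L) tau l)%g.
Definition stratified tau := [forall l, tau l \in Sym (level l.+1)].
Definition relabel (s : {perm I}) x : X := [ffun i => x (s i)].

Lemma level_pmf_ge0 tau : 0 <= level_pmf tau.
Proof. by apply: prodr_ge0 => l _; case: ifP => //; rewrite invr_ge0. Qed.

Lemma level_pmf_sum : \sum_tau level_pmf tau = 1.
Proof.
rewrite -(bigA_distr_bigA (fun (l : 'I_L) (s : {perm I}) =>
  if s \in Sym (level l.+1) then #|Sym (level l.+1)|%:R^-1 else 0 : R)).
apply: big1 => l _; rewrite -big_mkcond sumr_const -[LHS]mulr_natl mulfV //.
by rewrite pnatr_eq0 -lt0n cardG_gt0.
Qed.

Lemma level_pmf_supp tau : level_pmf tau != 0 -> stratified tau.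
Proof.
apply: contraR => /forallPn[l nl]; rewrite /level_pmf (bigD1 l) //=.
by rewrite (negbTE nl) mul0r.
Qed.

Lemma stratified_perm_on tau (l : 'I_L) : stratified tau -> perm_on (level l.+1) (tau
    l).
Proof. by move=> /forallP/(_ l); rewrite inE. Qed.

Lemma compose_levels_zero tau i : stratified tau -> e i = 0%N -> compose_levels tau i
    = i.
Proof.
move=> st ei; rewrite /compose_levels.
elim/big_rec: _ => [|l s _ IH]; first by rewrite perm1.
by rewrite permM (out_perm (stratified_perm_on l st)) // inE ei.
Qed.

Lemma compose_levels_pos tau i (l : 'I_L) : stratified tau -> e i = l.+1 ->
  compose_levels tau i = tau l i.
Proof.
move=> st; rewrite /compose_levels.
(* Generalised to a duplicate-free list of levels: the factors before [l] fix the point, and those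
   after [l] fix its image, which has stayed in the level of [l]. *)
suff H (r : seq 'I_L) i' : uniq r -> e i' = l.+1 ->
    (\prod_(l' <- r) tau l')%g i' = if l \in r then tau l i' else i'.
  by move=> ei; rewrite H ?index_enum_uniq // mem_index_enum.
elim: r i' => [|l' r IH] i' /=; first by rewrite big_nil perm1.
move=> /andP[l'r ur] ei; rewrite big_cons permM inE.
have po := stratified_perm_on l' st.
have [ll'|ll'] := eqVneq l l'.
  have : tau l' i' \in level l'.+1 by rewrite (perm_closed _ po) inE ei ll'.
  by rewrite inE -ll' => /eqP ei'; rewrite IH // ll' (negbTE l'r).
by rewrite (out_perm po) ?IH // inE ei eqSS.
Qed.

Lemma level_ord i : (0 < e i)%N -> exists l : 'I_L, e i = l.+1.
Proof.
move=> ei; have li : ((e i).-1 < L)%N by rewrite prednK.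
by exists (Ordinal li); rewrite /= prednK.
Qed.

Lemma compose_levels_e tau i : stratified tau -> e (compose_levels tau i) = e i.
Proof.
move=> st; have [e0|ei] := posnP (e i); first by rewrite compose_levels_zero.
have [l el] := level_ord ei; rewrite (compose_levels_pos st el).
have : tau l i \in level l.+1 by rewrite (perm_closed _ (stratified_perm_on l st))
    inE el.
by rewrite inE => /eqP ->.
Qed.

Lemma count_true_relabel (s : {perm I}) l x : (forall i, e (s i) = e i) ->
  count_true e l (relabel s x) = count_true e l x.
Proof.
move=> es; rewrite /count_true [RHS](reindex_inj (@perm_inj _ s)).
by apply: eq_big => i; rewrite ?es // ffunE.
Qed.

Lemma relabel_slice (s : {perm I}) k x : (forall i, e (s i) = e i) ->
  (relabel s x \in slice (Lm := Lm) e k) = (x \in slice e k).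
Proof.
move=> es; rewrite !inE; congr (_ && _); last first.
  by apply: eq_forallb => l; rewrite count_true_relabel.
apply/forallP/forallP => H i; last by rewrite ffunE -es; exact: H.
by have := H (s^-1 i)%g; rewrite ffunE -es !permKV.
Qed.

Variable F : X -> R.
Hypothesis F0 : forall x y, (forall i, (0 < e i)%N -> x i = y i) -> F x = F y.

Definition mean_relabel x := fexp level_pmf (fun tau => F (relabel (compose_levels
    tau) x)).

(* At level 0, where the model does not permute, [F] ignores the signs; at a positive
   level, composition with [tperm i j] preserves the uniform law. *)
Lemma mean_relabel_tperm i j x : e i = e j ->
  mean_relabel (relabel (tperm i j) x) = mean_relabel x.
Proof.
move=> eij; have et a : e a != e i -> tperm i j a = a.
  by move=> ea; rewrite tpermD //; apply: contraNneq ea => <-; rewrite ?eij.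
have [e0|ei] := posnP (e i).
  apply: eq_fexp_supp => tau /level_pmf_supp st; apply: F0 => a ea.
  by rewrite !ffunE et // compose_levels_e // e0 -lt0n.
have [l el] := level_ord ei.
have tS : tperm i j \in Sym (level l.+1).
  rewrite inE; apply/fintype.subsetP => a; rewrite !inE => ta.
  by apply: contraNT ta => ea; rewrite et // el.
pose g tau : tuple_perm := [ffun l' => if l' == l then (tau l * tperm i j)%g else tau
    l'].
have gK : involutive g.
  move=> tau; apply/ffunP => l'; rewrite !ffunE eqxx; case: eqP => [->|//].
  by rewrite -mulgA tperm2 mulg1.
have gpmf tau : level_pmf (g tau) = level_pmf tau.
  apply: eq_bigr => l' _; rewrite ffunE; case: eqP => [->|//].
  by rewrite groupMr.
have gst tau : stratified tau -> stratified (g tau).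
  move=> /forallP st; apply/forallP => l'; rewrite ffunE; case: eqP => [->|//].
  by rewrite groupMr.
rewrite /mean_relabel {2}/fexp (reindex_inj (inv_inj gK)) /=.
under [RHS]eq_bigr => tau _ do rewrite gpmf.
apply: eq_fexp_supp => tau /level_pmf_supp st; congr F; apply/ffunP => a.
rewrite !ffunE; congr (x _); have [a0|a0] := posnP (e a).
  rewrite !compose_levels_zero ?et ?a0 ?gst //.
  by rewrite eq_sym -lt0n.
have [la ela] := level_ord a0.
rewrite (compose_levels_pos (gst _ st) ela) (compose_levels_pos st ela) ffunE.
case: eqP => [->|ll]; first by rewrite permM.
rewrite et // -(compose_levels_pos st ela) compose_levels_e // ela el eqSS.
by apply/eqP => /val_inj.
Qed.

(** Two points of a slice are joined by transpositions inside levels, each of which reduces the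
    number of disagreements. *)
Lemma mean_relabel_slice k x y : x \in slice (Lm := Lm) e k -> y \in slice e k ->
  mean_relabel x = mean_relabel y.
Proof.
move: {2}#|_| (leqnn #|[set i | x i != y i]%SET|) => N.
elim: N x => [|N IH] x.
  rewrite leqn0 cards_eq0 => /eqP xy _ _; congr mean_relabel; apply/ffunP => i.
  by move/setP/(_ i): xy; rewrite !inE => /negbFE/eqP.
move=> xy xk yk; have [->//|nxy] := eqVneq x y.
have [i xyi] : exists i, x i != y i.
  case: (pickP (fun i => x i != y i)) => [i|H]; first by exists i.
  by case/eqP: nxy; apply/ffunP => i; apply/eqP/negbFE/H.
have cxy : forall l : 'I_Lm.+1, count_true e l x = count_true e l y.
  move=> l; move: xk yk; rewrite !inE => /andP[_ /forallP/(_ l)/eqP ->].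
  by move=> /andP[_ /forallP/(_ l)/eqP ->].
have eiL : (e i < Lm.+1)%N.
  move: xk yk; rewrite !inE => /andP[/forallP/(_ i) xL _] /andP[/forallP/(_ i) yL _].
  by move: xyi xL yL; rewrite ltnS; case: (x i); case: (y i).
(* If no site of the level of [i] disagreed in the opposite direction, the counts of [x] and [y] at
   that level would differ. *)
have [j eij xyj] : exists2 j, e j = e i & (x j == ~~ x i) && (y j == ~~ y i).
  apply: contrapT => H.
  have Hj j : e j = e i -> j != i -> (x i -> y j -> x j) /\ (~~ x i -> x j -> y j).
    move=> ej ji; split.
      move=> xi yj; apply/negPn/negP => xj; apply: H; exists j => //.
      by move: xyi; rewrite xi yj (negbTE xj); case: (y i).
    move=> xi xj; apply/negPn/negP => yj; apply: H; exists j => //.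
    by move: xyi; rewrite (negbTE xi) xj (negbTE yj); case: (y i).
  have := cxy (Ordinal eiL); rewrite /count_true /= (bigD1 i) //= [in RHS](bigD1 i) //=.
  move: xyi; case xi: (x i); case yi: (y i) => // _ /eqP.
    rewrite add0n gtn_eqF // add1n ltnS; apply: leq_sum => j /andP[/eqP ej ji].
    by have [/(_ xi) K _] := Hj j ej ji; move: K; case: (y j) => // ->.
  rewrite add0n ltn_eqF // add1n ltnS; apply: leq_sum => j /andP[/eqP ej ji].
  have [_ K] := Hj j ej ji; move: K; rewrite xi => /(_ isT).
  by case: (x j) => // ->.
case/andP: xyj => /eqP xj /eqP yj.
have ij : i != j by apply/eqP => ij; move: xj; rewrite -ij; case: (x i).
have es a : e (tperm i j a) = e a by case: tpermP => [->|->|] //.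
rewrite -(mean_relabel_tperm x (esym eij)); apply: IH => //; last by rewrite
    relabel_slice.
rewrite -ltnS; apply: leq_trans xy; apply: proper_card; apply/properP; split.
  apply/fintype.subsetP => a; rewrite !inE ffunE; case: tpermP => [->|->|//].
    by move: xyi; rewrite xj; case: (x i); case: (y i).
  by rewrite xj yj; move: xyi; case: (x i); case: (y i).
exists i; rewrite !inE // ffunE tpermL xj.
by move: xyi; case: (x i); case: (y i).
Qed.

(** The mean over relabellings is constant on the slice, so it equals its own slice average; after
    exchanging the sums, each relabelling merely permutes the slice. *)
Lemma mean_relabel_avg k x : x \in slice (Lm := Lm) e k -> mean_relabel x = slice_avg
    e k F.
Proof.
move=> xk; have S0 : #|slice e k|%:R != 0 :> R.
  by rewrite pnatr_eq0 -lt0n; apply/card_gt0P; exists x.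
apply: (mulIf S0); rewrite /slice_avg divfK //.
transitivity (\sum_(y in slice e k) mean_relabel y).
  rewrite mulr_natr -sumr_const; apply: eq_bigr => y yk.
  exact: mean_relabel_slice xk yk.
rewrite /mean_relabel -fexp_sum -[RHS](fexp_cst level_pmf_sum).
apply: eq_fexp_supp => tau /level_pmf_supp st.
have inj : injective (relabel (compose_levels tau)).
  move=> y z /ffunP yz; apply/ffunP => i.
  by have := yz ((compose_levels tau)^-1%g i); rewrite !ffunE permKV.
rewrite [RHS](reindex_inj inj) /=; apply: eq_bigl => y.
by rewrite relabel_slice // => i; rewrite compose_levels_e.
Qed.

End StratifiedPermutations.

(** * The bump weight *)

Section RadialWeight.
Variables (R : realType) (m : nat) (delta kappa : R).
Hypotheses (m0 : (0 < m)%N) (d0 : 0 < delta) (k0 : 0 <= kappa) (kd : kappa <= delta).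
Implicit Types z h : 'I_m -> R.

Definition pos_sqr (t : R) : R := Num.max 0 t ^+ 2.
Definition radial z : R := 1 - (\sum_l z l ^+ 2) / delta ^+ 2.
(** The square of the positive part has a Lipschitz derivative across the boundary of the ball,
    which is enough for a Taylor remainder of order [kappa ^+ 2]. *)
Definition weight z : R := pos_sqr (radial z).
Definition dweight (l : 'I_m) z : R :=
  2 * Num.max 0 (radial z) * (- 2 * z l / delta ^+ 2).
(** The sum of three constants: [4 / delta] for the partial derivatives, [10 * m / delta] for the
    increments, and [(25 + 2) * m ^+ 2 / delta ^+ 2] for the Taylor remainder. *)
Definition weight_const : R :=
  27 * m%:R ^+ 2 / delta ^+ 2 + 10 * m%:R / delta + 4 / delta.

Lemma pos_sqr_taylor t t' :
  `|pos_sqr t - pos_sqr t' - 2 * Num.max 0 t * (t - t')| <= (t - t') ^+ 2.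
Proof.
rewrite /pos_sqr ler_norml; case: (leP 0 t) => ht; case: (leP 0 t') => ht'.
- by have := sqr_ge0 (t - t'); rewrite sqrrB => ?; apply/andP; split; lra.
- have := mulr_ge0_le0 ht (ltW ht'); have := sqr_ge0 t'; have := sqr_ge0 t.
  by rewrite sqrrB => ? ? ?; apply/andP; split; lra.
- have := mulr_le0_ge0 (ltW ht) ht'; have := sqr_ge0 t'; have := sqr_ge0 t.
  by rewrite sqrrB => ? ? ?; apply/andP; split; lra.
- by have := sqr_ge0 (t - t') => ?; apply/andP; split; lra.
Qed.

Lemma pos_sqr_lip t t' : t <= 1 -> t' <= 1 ->
  `|pos_sqr t - pos_sqr t'| <= 2 * `|t - t'|.
Proof.
move=> t1 t1'; rewrite /pos_sqr subr_sqr normrM mulrC.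
set M := Num.max 0 t; set M' := Num.max 0 t'.
have M01 : 0 <= M <= 1 by rewrite /M le_max lexx ge_max ler01.
have M01' : 0 <= M' <= 1 by rewrite /M' le_max lexx ge_max ler01.
have /andP[M0 M1] := M01; have /andP[M0' M1'] := M01'.
apply: ler_pM => //; first by rewrite ger0_norm ?addr_ge0 //; lra.
rewrite /M /M'; case: (leP 0 t) => ht; case: (leP 0 t') => ht' //.
- by rewrite subr0 !ger0_norm //; lra.
- by rewrite sub0r normrN (ger0_norm ht') distrC ger0_norm; lra.
- by rewrite subrr normr0.
Qed.

Lemma radial_le1 z : radial z <= 1.
Proof. by rewrite gerBl divr_ge0 ?sqr_ge0 // sumr_ge0 // => l _; exact: sqr_ge0. Qed.

Lemma weight_ge0 z : 0 <= weight z.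
Proof. exact: sqr_ge0. Qed.

Lemma weight_le1 z : `|weight z| <= 1.
Proof.
rewrite ger0_norm ?weight_ge0 // /weight /pos_sqr expr_le1 ?ge_max ?ler01 ?radial_le1
    //.
by rewrite le_max lexx.
Qed.

Lemma radial_gt0 z l : 0 < radial z -> `|z l| <= delta.
Proof.
rewrite subr_gt0 ltr_pdivrMr ?exprn_gt0 // mul1r (bigD1 l) //= => h.
have H : z l ^+ 2 <= delta ^+ 2.
  apply/ltW/(le_lt_trans _ h); rewrite lerDl sumr_ge0 // => j _; exact: sqr_ge0.
rewrite -(ger0_norm (ltW d0)) -ler_sqr ?nnegrE //.
by rewrite !real_normK ?num_real.
Qed.

Lemma weight_supp z l : weight z != 0 -> `|z l| <= delta.
Proof.
move=> wz; apply: radial_gt0; rewrite ltNge; apply: contraNN wz => t0.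
by rewrite /weight /pos_sqr max_l // expr0n.
Qed.

Lemma weight_center z : (forall l, `|z l| <= delta / (2 * m%:R)) -> 1 / 4 <= weight z.
Proof.
move=> zd; have mR : 1 <= m%:R :> R by rewrite ler1n.
suff H : 1 / 2 <= radial z.
  rewrite /weight /pos_sqr max_r; last by apply: le_trans H; lra.
  by have := H; nra.
have : (\sum_l z l ^+ 2) / delta ^+ 2 <= 1 / 2; last by rewrite /radial; lra.
rewrite ler_pdivrMr ?exprn_gt0 //.
apply: (@le_trans _ _ (\sum_(l < m) (delta / (2 * m%:R)) ^+ 2)).
  apply: ler_sum => l _; rewrite -real_normK ?num_real // lerXn2r ?nnegrE //.
  by rewrite divr_ge0 ?mulr_ge0 // ltW.
rewrite sumr_const card_ord -[leLHS]mulr_natr.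
have -> : (delta / (2 * m%:R)) ^+ 2 * m%:R = delta ^+ 2 / 4 / m%:R.
  by field; rewrite pnatr_eq0 -lt0n.
have D0 : 0 < delta ^+ 2 by rewrite exprn_gt0.
rewrite ler_pdivrMr; last by lra.
nra.
Qed.

Lemma dweight_le l z : `|dweight l z| <= weight_const.
Proof.
have c0 : 0 <= 27 * m%:R ^+ 2 / delta ^+ 2 + 10 * m%:R / delta.
  by rewrite addr_ge0 ?divr_ge0 ?mulr_ge0 ?sqr_ge0 ?(ltW d0).
have c4 : 0 <= 4 / delta by rewrite divr_ge0 // ltW.
rewrite /dweight; have [t0|t0] := leP (radial z) 0.
  by rewrite mulr0 mul0r normr0 addr_ge0.
rewrite (le_trans _ (_ : 4 / delta <= _)) ?lerDr //.
rewrite !normrM normrN normfV (ger0_norm (sqr_ge0 delta)) (ger0_norm (ltW t0)).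
rewrite ger0_norm //.
have zl := radial_gt0 l t0; have := radial_le1 z.
have -> : 4 / delta = 2 * 1 * (2 * delta / delta ^+ 2) by field; rewrite gt_eqF.
move=> t1; apply: ler_pM.
- by rewrite mulr_ge0 // ltW.
- by rewrite !mulr_ge0 ?invr_ge0 ?sqr_ge0.
- by rewrite ler_wpM2l.
- by rewrite ler_wpM2r ?invr_ge0 ?sqr_ge0 // ler_wpM2l.
Qed.

(** If either end is in the ball, then [|z l| <= 2 * delta] because [kappa <= delta]; each
    coordinate then contributes at most [kappa * delta + 4 * delta * kappa] before division by
    [delta ^+ 2]. *)
Lemma radial_diff z h : (forall l, `|h l| <= kappa) ->
  0 < radial z \/ 0 < radial (fun l => z l - h l) ->
  `|radial z - radial (fun l => z l - h l)| <= 5 * m%:R * kappa / delta.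
Proof.
move=> hk rz; have z2 l : `|z l| <= 2 * delta.
  case: rz => [/(radial_gt0 l) rl|/(radial_gt0 l) rl].
    by rewrite (le_trans rl) // mulr2n mulrDl mul1r lerDl ltW.
  have := hk l; have -> : z l = (z l - h l) + h l by ring.
  by move=> hl; rewrite (le_trans (ler_normD _ _)) // mulr2n mulrDl mul1r lerD //
      (le_trans hl).
have -> : radial z - radial (fun l => z l - h l) =
    (\sum_l (h l ^+ 2 - 2 * z l * h l)) / delta ^+ 2.
  have E (A B C : R) : 1 - A * C - (1 - B * C) = (B - A) * C by ring.
  rewrite /radial E -sumrB; congr (_ / _).
  by apply: eq_bigr => l _; ring.
have D0 : 0 < delta ^+ 2 by rewrite exprn_gt0.
rewrite normrM [`|_^-1|]ger0_norm ?invr_ge0 ?(ltW D0) // ler_pdivrMr //.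
have -> : 5 * m%:R * kappa / delta * delta ^+ 2 = \sum_(l < m) (5 * kappa * delta).
  by rewrite sumr_const card_ord -[RHS]mulr_natr; field; rewrite gt_eqF.
apply: (le_trans (ler_norm_sum _ _ _)); apply: ler_sum => l _.
apply: (le_trans (ler_normB _ _)).
have -> : 5 * kappa * delta = kappa * delta + 2 * (2 * delta) * kappa by ring.
apply: lerD; first by rewrite normrX expr2 ler_pM // (le_trans (hk l)).
by rewrite !normrM ger0_norm // ler_pM // ler_wpM2l.
Qed.

Lemma weight_lip z h : (forall l, `|h l| <= kappa) ->
  `|weight z - weight (fun l => z l - h l)| <= weight_const * kappa.
Proof.
move=> hk; set z' := fun l => _.
have c0 : 0 <= 27 * m%:R ^+ 2 / delta ^+ 2 + 4 / delta.
  by rewrite addr_ge0 ?divr_ge0 ?mulr_ge0 ?sqr_ge0 ?(ltW d0).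
have Hc : 2 * (5 * m%:R * kappa / delta) <= weight_const * kappa.
  rewrite -subr_ge0 (_ : _ - _ = (27 * m%:R ^+ 2 / delta ^+ 2 + 4 / delta) * kappa).
    by rewrite mulr_ge0.
  by rewrite /weight_const; ring.
have main : 0 < radial z \/ 0 < radial z' ->
    `|weight z - weight z'| <= weight_const * kappa.
  move=> rz; apply: le_trans Hc; apply: (le_trans (pos_sqr_lip _ _)); rewrite
      ?radial_le1 //.
  by rewrite ler_wpM2l // radial_diff.
have [rz|rz] := ltP 0 (radial z); first by apply: main; left.
have [rz'|rz'] := ltP 0 (radial z'); first by apply: main; right.
rewrite /weight /pos_sqr !max_l // subrr normr0 (le_trans _ Hc) //.
by rewrite !mulr_ge0 ?invr_ge0 ?(ltW d0).
Qed.

Lemma weight_taylor z h : (forall l, `|h l| <= kappa) ->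
  `|weight z - weight (fun l => z l - h l) - \sum_l dweight l z * h l|
  <= weight_const * kappa ^+ 2.
Proof.
move=> hk; set z' := fun l => _.
have Hc : (5 * m%:R * kappa / delta) ^+ 2 + 2 * (m%:R * kappa ^+ 2 / delta ^+ 2)
    <= weight_const * kappa ^+ 2.
  rewrite -subr_ge0.
  have mR : 0 <= m%:R * (m%:R - 1) :> R by rewrite mulr_ge0 // subr_ge0 ler1n.
  have -> : weight_const * kappa ^+ 2 -
     ((5 * m%:R * kappa / delta) ^+ 2 + 2 * (m%:R * kappa ^+ 2 / delta ^+ 2)) =
     2 * (m%:R * (m%:R - 1)) * kappa ^+ 2 / delta ^+ 2
     + (10 * m%:R / delta + 4 / delta) * kappa ^+ 2.
    by rewrite /weight_const; field; rewrite gt_eqF.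
  apply: addr_ge0.
    by apply: divr_ge0; rewrite ?sqr_ge0 //; apply: mulr_ge0; rewrite ?sqr_ge0 //;
        apply: mulr_ge0.
  apply: mulr_ge0; rewrite ?sqr_ge0 //; apply: addr_ge0;
    apply: divr_ge0; rewrite ?mulr_ge0 ?(ltW d0) //.
have main : 0 < radial z \/ 0 < radial z' ->
   `|weight z - weight z' - \sum_l dweight l z * h l| <= weight_const * kappa ^+ 2.
  move=> rz; apply: le_trans Hc; have rd := radial_diff hk rz.
  (* The gradient term is the derivative of [pos_sqr] times the increment of [radial], up to the
     quadratic part of that increment. *)
  have E : \sum_l dweight l z * h l = 2 * Num.max 0 (radial z) * (radial z - radial z')
      - 2 * Num.max 0 (radial z) * ((\sum_l h l ^+ 2) / delta ^+ 2).
    rewrite -mulrBr /dweight.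
    have -> : radial z - radial z' - (\sum_l h l ^+ 2) / delta ^+ 2
       = \sum_l (- 2 * z l / delta ^+ 2) * h l.
      have E (A B H C : R) : 1 - A * C - (1 - B * C) - H * C = (B - A - H) * C by ring.
      rewrite /radial E -!sumrB mulr_suml.
      by apply: eq_bigr => l _; rewrite /z'; ring.
    by rewrite mulr_sumr; apply: eq_bigr => l _; ring.
  rewrite E opprB addrA addrAC; apply: (le_trans (ler_normD _ _)); apply: lerD.
    apply: (le_trans (pos_sqr_taylor _ _)).
    rewrite -real_normK ?num_real // lerXn2r ?nnegrE //.
    by rewrite !mulr_ge0 ?invr_ge0 ?(ltW d0).
  have M01 : 0 <= Num.max 0 (radial z) <= 1 by rewrite le_max lexx ge_max ler01
      radial_le1.
  have /andP[M0 M1] := M01.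
  have H0 : 0 <= \sum_l h l ^+ 2 by rewrite sumr_ge0 // => l _; exact: sqr_ge0.
  rewrite ger0_norm; last by rewrite !mulr_ge0 ?invr_ge0 ?sqr_ge0.
  rewrite -mulrA ler_wpM2l //; apply: (@le_trans _ _ (1 * ((\sum_l h l ^+ 2) / delta
      ^+ 2))).
    by rewrite ler_wpM2r // divr_ge0 ?sqr_ge0.
  rewrite mul1r ler_wpM2r ?invr_ge0 ?sqr_ge0 //.
  have -> : m%:R * kappa ^+ 2 = \sum_(l < m) kappa ^+ 2.
    by rewrite sumr_const card_ord mulr_natl.
  by apply: ler_sum => l _; rewrite -real_normK ?num_real // lerXn2r ?nnegrE.
have [rz|rz] := ltP 0 (radial z); first by apply: main; left.
have [rz'|rz'] := ltP 0 (radial z'); first by apply: main; right.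
rewrite /weight /pos_sqr !max_l // subrr sub0r normrN big1 => [|l _].
  by rewrite normr0 (le_trans _ Hc) // addr_ge0 ?sqr_ge0 ?mulr_ge0 ?invr_ge0 ?sqr_ge0.
by rewrite /dweight max_l // mulr0 !mul0r.
Qed.

End RadialWeight.

(** * From the product measure to a slice *)

Section FiniteModel.
Variables (R : realType) (I : finType) (e : I -> nat) (Lm : nat).
Local Notation X := {ffun I -> bool}.
Local Notation K := 'I_Lm.+1.
Local Notation N := #|I|.
Variables (p : I -> R) (m : {ffun K -> nat}).
Hypotheses (p01 : forall i, 0 <= p i <= 1)
  (phigh : forall i, (Lm < e i)%N -> p i = 0)
  (plow : forall (l : K) i, e i = l -> p i = (m l)%:R / (level_size e l)%:R)
  (mn : forall l : K, (m l <= level_size e l)%N)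
  (Sm : (0 < #|slice e m|)%N).
Local Notation P := (bernoulli_prod p).
Local Notation E := (fexp P).
Variables (T : {set I * I * I}) (d : nat).

Definition touches (t : I * I * I) i := [|| t.1.1 == i, t.1.2 == i | t.2 == i].

Hypothesis Td : forall i, (e i <= Lm)%N -> (\sum_(t in T) touches t i <= d)%N.

Implicit Types (x y : X) (i : I).

Let P0 := bernoulli_prod_ge0 p01.
Let P1 := bernoulli_prod_sum p.

Definition odd3 (t : I * I * I) x : bool := x t.1.1 (+) x t.1.2 (+) x t.2.
Definition odd_count x : R := \sum_(t in T) (odd3 t x)%:R.
(* The model puts no negative sign above level [Lm], but the locality of the terms is
   needed for every [x], hence the truncation. *)
Definition low_part x : X := [ffun i => x i && (e i <= Lm)%N].
Definition low_odd_count x : R := odd_count (low_part x).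
Definition cnt (l : nat) x : R := (count_true e l x)%:R.

Lemma low_part_id x : low_support e Lm x -> low_part x = x.
Proof.
move=> /forallP xL; apply/ffunP => i; rewrite ffunE.
by have := xL i; case: (x i).
Qed.

Lemma low_odd_count_supp x : P x != 0 -> low_odd_count x = odd_count x.
Proof.
move=> Px; rewrite /low_odd_count low_part_id //; apply: contraNT Px => nx.
by rewrite (bernoulli_prod_high phigh nx).
Qed.

Lemma normr_boolB (b c : bool) : `|b%:R - c%:R| <= 1 :> R.
Proof. by case: b; case: c; rewrite ?subrr ?subr0 ?sub0r ?normrN ?normr0 ?normr1. Qed.

Lemma low_odd_count_add x i : `|low_odd_count x - low_odd_count (add_true i x)| <= d%:R.
Proof.
have [ei|ei] := leqP (e i) Lm; last first.
  rewrite (_ : low_odd_count (add_true i x) = low_odd_count x) ?subrr ?normr0 ?ler0n //.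
  congr odd_count; apply/ffunP => j; rewrite !ffunE.
  by case: eqP => [->|//]; rewrite leqNgt ei /= !andbF.
rewrite /low_odd_count /odd_count -sumrB; apply: (le_trans (ler_norm_sum _ _ _)).
apply: (@le_trans _ _ (\sum_(t in T) (touches t i)%:R)); last first.
  by rewrite -natr_sum ler_nat Td.
apply: ler_sum => t _; rewrite /touches.
case: (boolP [|| _, _ | _]) => [_|]; first exact: normr_boolB.
rewrite !negb_or => /and3P[/negbTE t1 /negbTE t2 /negbTE t3].
by rewrite /odd3 !ffunE t1 t2 t3 subrr normr0.
Qed.

Lemma cntE l x : cnt l x = \sum_(i | e i == l) (x i)%:R.
Proof. by rewrite /cnt natr_sum. Qed.

Lemma fcov_coord i j : fcov P (fun x => (x i)%:R) (fun x => (x j)%:R)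
  = (i == j)%:R * (p i * (1 - p i)).
Proof.
have [->|ij] := eqVneq i j.
  rewrite fcovE // !fexp_coord (eq_fexp _ (Y := fun x : X => (x j)%:R)).
    by rewrite fexp_coord mul1r; ring.
  by move=> x /=; case: (x j); rewrite ?mulr0 ?mulr1.
rewrite mul0r; apply: (fcov_indep p _ (@depends_on_coord R I i) (@depends_on_coord R
    I j)).
by apply/fintype.subsetP => a; rewrite !inE => /eqP ->; rewrite eq_sym.
Qed.

Definition count_var l : R := fcov P (cnt l) (cnt l).
Definition count_cov l : R := fcov P low_odd_count (cnt l).
(* [0] when [count_var l = 0], where [count_cov l = 0] too (see [slope_count_var]). *)
Definition slope l : R := count_cov l / count_var l.

Lemma fcov_cntr (F : X -> R) l :
  fcov P F (cnt l) = \sum_(i | e i == l) fcov P F (fun x => (x i)%:R).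
Proof. by rewrite -fcov_sumr //; apply: eq_fcov => // x; rewrite cntE. Qed.

Lemma fcov_cnt l l' : fcov P (cnt l) (cnt l') = (l == l')%:R * count_var l.
Proof.
have [->|ll'] := eqVneq l l'; first by rewrite mul1r.
rewrite mul0r fcov_cntr big1 // => j /eqP ej; rewrite fcovC fcov_cntr big1 // => i
    /eqP ei.
by rewrite fcov_coord (_ : j == i = false) ?mul0r //; apply: contraNF ll' => /eqP ji;
  rewrite -ej -ei ji.
Qed.

Lemma count_varE l : count_var l = \sum_(i | e i == l) p i * (1 - p i).
Proof.
rewrite /count_var fcov_cntr; apply: eq_bigr => i ei; rewrite fcovC fcov_cntr.
rewrite (bigD1 i) //= big1 ?addr0 => [|j /andP[_ ji]].
  by rewrite fcov_coord eqxx mul1r.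
by rewrite fcov_coord eq_sym (negbTE ji) mul0r.
Qed.

(* The discrete derivative of [low_odd_count] in direction [i] is independent of [x
    i]. *)
Lemma fcov_low_odd_count_coord i : `|fcov P low_odd_count (fun x => (x i)%:R)| <=
    d%:R * (p i * (1 - p i)).
Proof.
have /andP[p0 p1] := p01 i.
pose D x := low_odd_count (add_true i x) - low_odd_count (del_true i x).
have VE x : low_odd_count x = low_odd_count (del_true i x) + (x i)%:R * D x.
  have xE : x = if x i then add_true i x else del_true i x.
    apply/ffunP => j; case xi: (x i); rewrite ffunE; case: eqP => // ->.
      by rewrite xi.
    by rewrite xi.
  by rewrite {1}xE; case: (x i); rewrite /D ?mul1r ?mul0r ?addr0 // addrC subrK.
have dA : depends_on (~: [set i]%SET) (fun x => low_odd_count (del_true i x)).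
  move=> x y xy; congr low_odd_count; apply/ffunP => j; rewrite !ffunE.
  by case: eqP => //= ji; rewrite xy // !inE; apply/eqP.
have dB : depends_on (~: [set i]%SET) (fun x => low_odd_count (add_true i x)).
  move=> x y xy; congr low_odd_count; apply/ffunP => j; rewrite !ffunE.
  by case: eqP => //= ji; rewrite xy // !inE; apply/eqP.
have dD : depends_on (~: [set i]%SET) D by move=> x y xy; rewrite /D (dA x y xy) (dB
    x y xy).
have di := @depends_on_coord R I i.
rewrite (eq_fcov _ VE (fun=> erefl)) fcovDl fcovC (fcov_indep p (fintype.subxx _) di
    dA) add0r.
rewrite fcovE //.
have -> : E (fun x => (x i)%:R * D x * (x i)%:R) = E (fun x => (x i)%:R * D x).
  by apply: eq_fexp => x; case: (x i); rewrite ?mul0r ?mulr0 ?mul1r ?mulr1.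
rewrite (fexp_indep p di dD) fexp_coord.
have -> : p i * E D - p i * E D * p i = E D * (p i * (1 - p i)) by ring.
rewrite normrM [`|_ * (1 - _)|]ger0_norm ?mulr_ge0 ?subr_ge0 //.
rewrite ler_wpM2r ?mulr_ge0 ?subr_ge0 //; apply: fexp_le_bound => // x.
rewrite /D distrC (_ : add_true i x = add_true i (del_true i x)) ?low_odd_count_add //.
by apply/ffunP => j; rewrite !ffunE; case: eqP.
Qed.

Lemma count_cov_le l : `|count_cov l| <= d%:R * count_var l.
Proof.
rewrite /count_cov fcov_cntr (le_trans (ler_norm_sum _ _ _)) // count_varE mulr_sumr.
by apply: ler_sum => i _; exact: fcov_low_odd_count_coord.
Qed.

Lemma count_var_ge0 l : 0 <= count_var l. Proof. exact: fcov_ge0. Qed.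

(** The bound does not depend on how small the variance of the count is; it makes the terms of the
    residual uniformly bounded, even at nearly degenerate levels. *)
Lemma slope_le l : `|slope l| <= d%:R.
Proof.
rewrite /slope; have [v0|v0] := eqVneq (count_var l) 0; first by rewrite v0 invr0
    mulr0 normr0.
have vp : 0 < count_var l by rewrite lt_neqAle eq_sym v0 count_var_ge0.
by rewrite normrM normfV (gtr0_norm vp) ler_pdivrMr // count_cov_le.
Qed.

Lemma slope_count_var l : slope l * count_var l = count_cov l.
Proof.
rewrite /slope; have [v0|v0] := eqVneq (count_var l) 0; last by rewrite divfK.
by have := count_cov_le l; rewrite v0 !mulr0 normr_le0 => /eqP ->.
Qed.

Definition centered_cnt (l : K) x : R := cnt l x - (m l)%:R.
Definition residual x : R := low_odd_count x - E low_odd_count - \sum_(l : K) slope l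
    * centered_cnt l x.

Lemma fexp_cnt (l : K) : E (cnt l) = (m l)%:R.
Proof. exact: (fexp_count plow mn). Qed.

Lemma fcov_centered (F : X -> R) (l : K) : E (fun x => (F x - E F) * centered_cnt l x)
  = fcov P F (cnt l).
Proof. by rewrite /fcov fexp_cnt. Qed.

(** Counts of different levels are uncorrelated, so the regression splits into one slope per level;
    [slope_count_var] covers the levels of variance 0. *)
Lemma fexp_residual_cnt (l : K) : E (fun x => residual x * centered_cnt l x) = 0.
Proof.
rewrite (eq_fexp _ (Y := fun x => (low_odd_count x - E low_odd_count) * centered_cnt
    l x -
  \sum_(l' : K) slope l' * (centered_cnt l' x * centered_cnt l x))); last first.
  move=> x; rewrite /residual mulrBl mulr_suml; congr (_ - _).
  by apply: eq_bigr => l' _; rewrite mulrA.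
rewrite fexpB [X in _ - X]fexp_sum (fcov_centered low_odd_count l) -/(count_cov l)
    (bigD1 l) //= big1 => [|l' l'l].
  rewrite fexpZ (eq_fexp _ (Y := fun x => (cnt l x - E (cnt l)) * centered_cnt l x)).
    by rewrite fcov_centered -/(count_var l) slope_count_var addr0 subrr.
  by move=> x; rewrite fexp_cnt.
rewrite fexpZ (eq_fexp _ (Y := fun x => (cnt l' x - E (cnt l')) * centered_cnt l x)).
  by rewrite fcov_centered fcov_cnt (_ : (l' : nat) == l = false) ?mul0r ?mulr0 //;
      exact/negbTE.
by move=> x; rewrite fexp_cnt.
Qed.

(** Pythagoras: by orthogonality to the counts, one factor [residual] can be replaced by the centred
    [low_odd_count]. *)
Lemma fexp_residual_sqr : E (fun x => residual x ^+ 2) = fcov P low_odd_count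
    low_odd_count - \sum_(l : K) count_cov l ^+ 2 / count_var l.
Proof.
rewrite (eq_fexp _ (Y := fun x => residual x * (low_odd_count x - E low_odd_count) -
  \sum_(l : K) slope l * (residual x * centered_cnt l x))); last first.
  move=> x; rewrite expr2 {2}/residual mulrBr; congr (_ - _); rewrite mulr_sumr.
  by apply: eq_bigr => l' _; ring.
rewrite fexpB [X in _ - X]fexp_sum [X in _ - X]big1 ?subr0 => [|l _]; last by rewrite
    fexpZ fexp_residual_cnt mulr0.
rewrite (eq_fexp _ (Y := fun x => (low_odd_count x - E low_odd_count) *
    (low_odd_count x - E low_odd_count) -
  \sum_(l : K) slope l * ((low_odd_count x - E low_odd_count) * centered_cnt l x)));
      last first.
  move=> x; rewrite /residual mulrBl; congr (_ - _); rewrite mulr_suml.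
  by apply: eq_bigr => l' _; ring.
rewrite fexpB [X in _ - X]fexp_sum; congr (_ - _); apply: eq_bigr => l _.
by rewrite fexpZ fcov_centered -/(count_cov l) /slope expr2; ring.
Qed.

(** The residual is a sum of centred triangle parities and of single-edge contributions to the
    regression, hence indices of two kinds. *)
Definition term : finType := ((I * I * I) + I)%type.

Definition term_support (a : term) : {set I} :=
  match a with
  | inl t => if t \in T then [set i | touches t i && (e i <= Lm)%N]%SET else finset.set0
  | inr i => if (e i <= Lm)%N then [set i]%SET else finset.set0
  end.

Definition residual_term (a : term) x : R :=
  match a with
  | inl t => if t \in T then (odd3 t (low_part x))%:R - E (fun y => (odd3 t (low_part
      y))%:R)
             else 0
  | inr i => if (e i <= Lm)%N then - slope (e i) * ((x i)%:R - p i) else 0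
  end.

(** Zero on triples, so that the counts are summed over the same index family, with the same
    supports, as the residual. *)
Definition count_term (l : K) (a : term) x : R :=
  match a with inl _ => 0 | inr i => if e i == l then (x i)%:R - p i else 0 end.

Lemma term_incidence i : (\sum_a (i \in term_support a) <= d.+1)%N.
Proof.
rewrite big_sumType /= -addn1; apply: leq_add.
  have [ei|ei] := leqP (e i) Lm.
    apply: leq_trans (Td ei); rewrite [leqRHS]big_mkcond /=; apply: leq_sum => t _.
    by case: (t \in T); rewrite ?inE // ei andbT.
  rewrite big1 // => t _; case: (t \in T); rewrite ?inE //.
  by rewrite [(e i <= _)%N]leqNgt ei andbF.
rewrite (bigD1 i) //= big1 ?addn0 => [|j ji].
  exact: leq_b1.
by case: (_ <= _)%N; rewrite ?inE // eq_sym (negbTE ji).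
Qed.

Lemma term_card a : (#|term_support a| <= 3)%N.
Proof.
case: a => [[[t1 t2] t3]|i] /=; case: ifP; rewrite ?cards0 ?cards1 // => _.
apply: (@leq_trans #|[set t1; t2; t3]%SET|).
  apply: subset_leq_card; apply/fintype.subsetP => i; rewrite !inE /touches /=.
  by rewrite ![i == _]eq_sym => /andP[/or3P[] ->]; rewrite ?orbT.
apply: (leq_trans (leq_card_setU _ _)); rewrite cards1 cards2.
by case: (_ != _).
Qed.

Lemma residual_term_depends a : depends_on (term_support a) (residual_term a).
Proof.
case: a => [t|i] x y; rewrite /term_support /residual_term; case: ifP => // ti xy.
  have H i : touches t i -> low_part x i = low_part y i.
    move=> tti; rewrite !ffunE; case: (boolP (e i <= Lm)%N) => ei; rewrite ?andbF //.
    by rewrite xy // inE tti.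
  by rewrite /odd3 !H /touches ?eqxx ?orbT.
by rewrite xy // inE.
Qed.

Lemma count_term_depends l a : depends_on (term_support a) (count_term l a).
Proof.
case: a => [t|i] x y; rewrite /term_support /count_term // => xy.
by case: eqP => // el; rewrite xy // el -ltnS ltn_ord inE.
Qed.

Lemma coord_bound i x : `|(x i)%:R - p i| <= 1.
Proof. by have /andP[? ?] := p01 i; rewrite ler_norml; case: (x i) => /=; apply/andP;
    split; lra. Qed.

Lemma residual_term_bound a x : `|residual_term a x| <= d.+1%:R.
Proof.
have D1 : 1 <= d.+1%:R :> R by rewrite ler1n.
case: a => [t|i]; rewrite /residual_term; case: ifP => _; rewrite ?normr0 ?ler0n //.
  apply: le_trans D1.
  have : 0 <= E (fun y => (odd3 t (low_part y))%:R) <= 1.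
    rewrite fexp_ge0 //= -[leRHS](fexp_cst P1); apply: le_fexp => // y.
    by case: (odd3 _ _).
  move=> /andP[? ?]; rewrite ler_norml.
  by case: (odd3 _ _) => /=; apply/andP; split; lra.
rewrite normrM normrN -[leRHS]mulr1 ler_pM ?coord_bound //.
by rewrite (le_trans (slope_le _)) // ler_nat.
Qed.

Lemma count_term_bound l a x : `|count_term l a x| <= d.+1%:R.
Proof.
have D1 : 1 <= d.+1%:R :> R by rewrite ler1n.
case: a => [t|i]; rewrite /count_term ?normr0 ?ler0n //.
case: ifP => _; rewrite ?normr0 ?ler0n //.
by rewrite (le_trans (coord_bound _ _)).
Qed.

Lemma residual_term_mean a : E (residual_term a) = 0.
Proof.
case: a => [t|i]; rewrite /residual_term.
  case: (t \in T); last by rewrite (fexp_cst P1).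
  by rewrite fexpB (fexp_cst P1) subrr.
case: (e i <= Lm)%N; last by rewrite (fexp_cst P1).
by rewrite fexpZ fexpB fexp_coord (fexp_cst P1) subrr mulr0.
Qed.

Lemma centered_cntE (l : K) x : centered_cnt l x = \sum_(i | e i == l) ((x i)%:R - p i).
Proof.
rewrite /centered_cnt -fexp_cnt sumrB cntE; congr (_ - _).
rewrite (eq_fexp _ (cntE l)) fexp_sum; apply: eq_bigr => i _; exact: fexp_coord.
Qed.

Lemma sum_count_term (l : K) x : \sum_a count_term l a x = centered_cnt l x.
Proof.
rewrite centered_cntE [RHS]big_mkcond big_sumType /= [X in X + _]big1 ?add0r //.
Qed.

Lemma sum_residual_term x : \sum_a residual_term a x = residual x.
Proof.
rewrite big_sumType /=.
have -> : \sum_(t : I * I * I) residual_term (inl t) x = low_odd_count x - E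
    low_odd_count.
  rewrite /low_odd_count /odd_count fexp_sum -sumrB [RHS]big_mkcond /=.
  by apply: eq_bigr => t _.
rewrite /residual; congr (_ + _); rewrite -sumrN.
under [RHS]eq_bigr => l _ do rewrite centered_cntE mulr_sumr -sumrN.
rewrite (exchange_big_dep xpredT) //=; apply: eq_bigr => i _.
case: ifP => ei; last first.
  by rewrite big1 // => l /eqP el; move: ei; rewrite el -ltnS ltn_ord.
have eiL : (e i < Lm.+1)%N by rewrite ltnS.
rewrite (big_pred1 (Ordinal eiL)) /= => [|l]; first by rewrite mulNr.
by rewrite eq_sym.
Qed.

(** Edges above level [Lm] contribute the factor 1, and edges of one level share the same
    probability, so the weight depends only on the counts. *)
Lemma bernoulli_prod_slice x : low_support e Lm x ->
  P x = \prod_(l : K) (((m l)%:R / (level_size e l)%:R) ^+ count_true e l x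
    * (1 - (m l)%:R / (level_size e l)%:R) ^+ (level_size e l - count_true e l x)).
Proof.
move=> /forallP xL; rewrite /bernoulli_prod (bigID (fun i => (e i <= Lm)%N)) /=.
rewrite [X in _ * X]big1 ?mulr1 => [|i]; last first.
  rewrite -ltnNge => ei; have := xL i; rewrite leqNgt ei implybF => /negbTE ->.
  by rewrite phigh // subr0.
rewrite (partition_big (fun i => inord (e i) : K) xpredT) //=; apply: eq_bigr => l _.
have pE i : (e i <= Lm)%N && (inord (e i) == l :> K) = (e i == l).
  apply/andP/eqP => [[ei /eqP <-]|el]; first by rewrite inordK.
  by split; [rewrite el -ltnS ltn_ord|rewrite el inord_val].
have prodE (Q : pred I) (a : R) : \prod_(i | Q i) a = a ^+ (\sum_(i | Q i) 1)%N.
  by rewrite sum1_card; exact: prodr_const.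
rewrite (eq_bigl _ _ pE) (bigID (fun i => x i)) /=; congr (_ * _).
  rewrite (eq_bigr (fun=> (m l)%:R / (level_size e l)%:R)) => [|i /andP[/eqP el ->]].
    by rewrite prodE big_mkcondr.
  by rewrite (plow el).
rewrite (eq_bigr (fun=> 1 - (m l)%:R / (level_size e l)%:R)) => [|i /andP[/eqP el
    /negbTE ->]].
  rewrite prodE; congr (_ ^+ _).
  apply: (@addnI (count_true e l x)); rewrite subnKC ?count_true_le //.
  rewrite big_mkcondr /count_true /level_size -big_split; apply: eq_bigr => i _ /=.
  by case: (x i).
by rewrite (plow el).
Qed.

Local Notation cts := (counts e Lm).

(* [bernoulli_prod] is constant on slices. *)
Lemma fexp_slice_avg (H : {ffun K -> nat} -> R) (F : X -> R) :
  E (fun x => H (cts x) * F x) = E (fun x => H (cts x) * slice_avg e (cts x) F).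
Proof.
have low (f : X -> R) : E f = \sum_(x | low_support e Lm x) P x * f x.
  rewrite /fexp (bigID (low_support e Lm)) /= [X in _ + X]big1 ?addr0 // => x nx.
  by rewrite (bernoulli_prod_high phigh nx) mul0r.
rewrite !low.
under [RHS]eq_bigr => x _ do rewrite /slice_avg mulr_suml mulr_sumr mulr_sumr.
rewrite [RHS](exchange_big_dep (low_support e Lm)) /=; last first.
  by move=> x y _; rewrite in_slice => /andP[].
apply: eq_bigr => y yL.
have inE' x : low_support e Lm x && (y \in slice e (cts x)) = (x \in slice e (cts y)).
  by rewrite !in_slice yL eq_sym.
rewrite (eq_bigl _ _ inE') (eq_bigr (fun=> P y * (H (cts y) * (F y / #|slice e (cts
    y)|%:R)))).
  rewrite sumr_const -[RHS]mulr_natr -!mulrA mulVf ?mulr1 // pnatr_eq0 -lt0n.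
  by apply/card_gt0P; exists y; rewrite in_slice yL eqxx.
move=> x; rewrite in_slice => /andP[xL /eqP xy]; rewrite xy; congr (_ * _).
rewrite !bernoulli_prod_slice //; apply: eq_bigr => l _.
by move/ffunP/(_ l): xy; rewrite !ffunE => ->.
Qed.

Lemma le_fexp_supp (f g : X -> R) : (forall x, P x != 0 -> f x <= g x) -> E f <= E g.
Proof.
move=> fg; apply: ler_sum => x _; have [->|Px] := eqVneq (P x) 0; first by rewrite
    !mul0r.
by rewrite ler_wpM2l ?fg.
Qed.

Section Transfer.
Variables (h : R -> R) (Lh c delta err : R) (r : nat).
Hypotheses (N0 : (0 < N)%N) (delta0 : 0 < delta) (Lh0 : 0 <= Lh)
  (hL : forall u v, `|h u - h v| <= Lh * `|u - v|)
  (hr : 32 * Lm.+1%:R ^+ 2 <= delta * r.+1%:R).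
Let s : R := (Num.sqrt N%:R)^-1.
Let z x (l : K) : R := s * centered_cnt l x.
Let G x : R := weight delta (z x).
Let f x : R := h (s * (low_odd_count x - E low_odd_count)).
Let bound : R := Lh * (d%:R * (Lm.+1%:R * delta)).

Let s0 : 0 < s. Proof. by rewrite invr_gt0 sqrtr_gt0 ltr0n. Qed.

Let G0 x : 0 <= G x. Proof. exact: weight_ge0. Qed.

Let sum_z x : G x != 0 -> \sum_l `|z x l| <= Lm.+1%:R * delta.
Proof.
move=> Gx; have -> : Lm.+1%:R * delta = \sum_(l < Lm.+1) delta.
  by rewrite sumr_const card_ord mulr_natl.
by apply: ler_sum => l _; apply: weight_supp.
Qed.

(** The weight is at least 1/4 on the box of radius [delta / (2 * Lm.+1)], to which [box_prob_lb]
    applies; this gives the constants 8 here and 32 in [hr]. *)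
Lemma weight_mean_lb : 1 <= 8 * ((2 * r.+1) ^ Lm.+1)%N%:R * E G.
Proof.
have KR : 0 < Lm.+1%:R :> R by rewrite ltr0n.
have hr' : 16 * Lm.+1%:R <= delta / (2 * Lm.+1%:R) * r.+1%:R.
  rewrite -(@ler_pM2r _ (2 * Lm.+1%:R)) ?mulr_gt0 //.
  have -> : delta / (2 * Lm.+1%:R) * r.+1%:R * (2 * Lm.+1%:R) = delta * r.+1%:R.
    by field; rewrite gt_eqF.
  by apply: le_trans hr; rewrite le_eqVlt; apply/orP; left; apply/eqP; ring.
have := box_prob_lb p01 phigh plow mn N0 hr'.
set Nr : R := _%:R; set S := \sum_(x | _) _ => hS.
have Nr0 : 0 <= Nr by exact: ler0n.
suff : S <= 4 * E G.
  move=> /(ler_wpM2l Nr0) h2; have : 1 / 2 <= Nr * (4 * E G) by exact: le_trans h2.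
  have -> : Nr * (4 * E G) = (8 * Nr * E G) / 2 by field.
  by move=> h3; lra.
rewrite /S /fexp mulr_sumr big_mkcond /=; apply: ler_sum => x _.
case: ifP => [/forallP xb|_]; last by apply: mulr_ge0 => //; apply: mulr_ge0.
rewrite mulrCA ler_peMr //.
have : 1 / 4 <= G x; last by lra.
apply: weight_center => // l; rewrite /z normrM (gtr0_norm s0).
rewrite /s mulrC ler_pdivrMr ?sqrtr_gt0 ?ltr0n //; exact: xb.
Qed.

Let avg : R := slice_avg e m f.

Let f_step x i : `|f x - f (add_true i x)| <= Lh * (s * d%:R).
Proof.
rewrite (le_trans (hL _ _)) // ler_wpM2l // -mulrBr normrM (gtr0_norm s0).
rewrite ler_wpM2l ?(ltW s0) // (_ : _ - _ = low_odd_count x - low_odd_count (add_true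
    i x)) ?low_odd_count_add //.
by ring.
Qed.

(** On the support of [G] the counts are within lattice distance [Lm.+1 * delta / s] of [m], and
    each unit step changes the slice average of [f] by at most [Lh * (s * d%:R)]. *)
Lemma avg_near_mean : `|E (fun x => G x * (f x - avg))| <= bound * E G.
Proof.
(* [G] depends on [x] only through the counts, as [fexp_slice_avg] requires. *)
pose H (k : {ffun K -> nat}) : R := weight delta (fun l => s * ((k l)%:R - (m l)%:R)).
have HG x : H (cts x) = G x.
  by congr weight; apply/funext => l; rewrite /z /centered_cnt /cnt ffunE.
have -> : E (fun x => G x * (f x - avg)) =
    E (fun x => G x * (slice_avg e (cts x) f - avg)).
  rewrite (eq_fexp _ (Y := fun x => H (cts x) * f x - avg * G x)); last first.
    by move=> x; rewrite HG; ring.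
  rewrite fexpB fexp_slice_avg -fexpB; apply: eq_fexp => x.
  by rewrite HG; ring.
apply: (le_trans (ler_norm_fexp P0 _)); rewrite -fexpZ; apply: le_fexp_supp => x Px.
rewrite normrM (ger0_norm (G0 x)) mulrC.
have [->|Gx] := eqVneq (G x) 0; first by rewrite !mulr0.
rewrite ler_wpM2r //.
have xS : (0 < #|slice e (cts x)|)%N.
  apply/card_gt0P; exists x; rewrite in_slice eqxx andbT.
  by apply: contraNT Px => nx; rewrite (bernoulli_prod_high phigh nx).
rewrite (le_trans (slice_avg_lip f_step xS Sm)) //.
have -> : (lattice_dist (cts x) m)%:R * (Lh * (s * d%:R)) =
    Lh * (d%:R * (\sum_l `|z x l|)).
  rewrite /lattice_dist natr_sum.
  have -> : \sum_l `|z x l| = s * \sum_(l : K) (absdiff (cts x l) (m l))%:R.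
    rewrite mulr_sumr; apply: eq_bigr => l _; rewrite /z normrM (gtr0_norm s0).
    by rewrite absdiffE /centered_cnt /cnt ffunE.
  by ring.
by rewrite ler_wpM2l // ler_wpM2l ?ler0n // sum_z.
Qed.

Lemma linear_correction : `|E (fun x => G x * (f x - h (s * residual x)))| <= bound *
    E G.
Proof.
apply: (le_trans (ler_norm_fexp P0 _)); rewrite -fexpZ; apply: le_fexp => // x.
rewrite normrM (ger0_norm (G0 x)) mulrC.
have [->|Gx] := eqVneq (G x) 0; first by rewrite !mulr0.
rewrite ler_wpM2r // (le_trans (hL _ _)) // ler_wpM2l //.
have -> : s * (low_odd_count x - E low_odd_count) - s * residual x = \sum_(l : K)
    slope l * z x l.
  rewrite -mulrBr /residual opprB addrCA subrr addr0 mulr_sumr.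
  by apply: eq_bigr => l _; rewrite /z; ring.
rewrite (le_trans (ler_norm_sum _ _ _)) //.
apply: (@le_trans _ _ (d%:R * \sum_l `|z x l|)); last by rewrite ler_wpM2l ?ler0n //
    sum_z.
by rewrite mulr_sumr; apply: ler_sum => l _; rewrite normrM ler_wpM2r // slope_le.
Qed.

(** The average over the slice of [m] is compared with [c] under the weight [G], and the comparison
    is divided by the mean of [G]. *)
Lemma transfer : `|E (fun x => (h (s * residual x) - c) * G x)| <= err ->
  `|avg - c| <= 2 * bound + 8 * ((2 * r.+1) ^ Lm.+1)%N%:R * err.
Proof.
move=> herr; have g1 := weight_mean_lb; set M := 8 * _ in g1 *.
have M0 : 0 <= M by rewrite mulr_ge0 ?ler0n.
have g0 : 0 < E G.
  have : 0 <= E G by apply: fexp_ge0.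
  rewrite le_eqVlt => /predU1P[g|//].
  by move: g1; rewrite -g mulr0; lra.
have err0 : 0 <= err by exact: le_trans herr.
have key : (avg - c) * E G = E (fun x => (h (s * residual x) - c) * G x)
    + E (fun x => G x * (f x - h (s * residual x))) - E (fun x => G x * (f x - avg)).
  by rewrite -fexpD -fexpB -fexpZ; apply: eq_fexp => x; ring.
have : `|avg - c| * E G <= err + bound * E G + bound * E G.
  rewrite -[E G in leLHS](gtr0_norm g0) -normrM key.
  apply: (le_trans (ler_normB _ _)); apply: lerD; last exact: avg_near_mean.
  by apply: (le_trans (ler_normD _ _)); apply: lerD => //; exact: linear_correction.
have := ler_wpM2l err0 g1 => h1 h2.
rewrite -(ler_pM2r g0); apply: (le_trans h2).
have -> : (2 * bound + M * err) * E G = err * (M * E G) + bound * E G + bound * E G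
    by ring.
by rewrite !lerD2r; move: h1; rewrite mulr1.
Qed.

End Transfer.

Section SteinApplication.
Variables (delta sg C : R) (h psi psi1 : R -> R) (c : R).
Let s : R := (Num.sqrt N%:R)^-1.
Let B : R := d.+1%:R.
Let D : R := (3 * d.+1)%N%:R.
Hypotheses (N0 : (0 < N)%N) (delta0 : 0 < delta) (sd : s * (B * D) <= delta) (C0 : 0
    <= C)
  (steinE : forall u : R, sg ^+ 2 * psi1 u - u * psi u = h u - c)
  (psiC : forall u, `|psi u| <= C) (psi1C : forall u, `|psi1 u| <= C)
  (psi_lip : forall w u, `|psi w - psi (w - u)| <= C * `|u|)
  (psi_taylor : forall w u, `|psi w - psi (w - u) - psi1 w * u| <= C * `|u| ^+ 2).

(** [stein_error] with a factor [s] taken out, for [eta = C * kappa]; it does not involve the graph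
    otherwise, so the error tends to 0 with [s]. *)
Definition stein_rate : R :=
  let CG := weight_const Lm.+1 delta in
  B * B * (B * D) * (C * (B * D) + B * D * (2 * C * CG))
  + (C + Lm.+1%:R * (C * CG)) * Num.sqrt (var_const d.+1 3 B).

Lemma stein_application :
  `|E (fun x => (h (s * residual x) - c) * weight delta (fun l : K => s *
      centered_cnt l x))|
  <= s * stein_rate + `|sg ^+ 2 - s ^+ 2 * E (fun x => residual x ^+ 2)| * C.
Proof.
have s0 : 0 <= s by rewrite invr_ge0 sqrtr_ge0.
have sN : s ^+ 2 * N%:R <= 1.
  by rewrite /s exprVn sqr_sqrtr ?ler0n // mulVf // pnatr_eq0 -lt0n.
have B0 : 0 <= B by rewrite ler0n.
have k0 : 0 <= s * (B * D) by rewrite !mulr_ge0 ?ler0n.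
have := @weighted_stein R I term p p01 term_support d.+1 3 Lm.+1 B term_incidence
    term_card B0
  residual_term count_term residual_term_depends count_term_depends
      residual_term_bound count_term_bound residual_term_mean s s0 sN psi psi1
      (weight delta)
  (fun l z => dweight delta l z) C (weight_const Lm.+1 delta) (C * (s * (B * D))).
rewrite -/D.
have e0 : 0 <= C * (s * (B * D)) by rewrite mulr_ge0.
move=> /(_ psiC psi1C e0).
have l1 w u : `|u| <= s * (B * D) -> `|psi w - psi (w - u)| <= C * (s * (B * D)).
  by move=> uk; rewrite (le_trans (psi_lip _ _)) // ler_wpM2l.
have l2 w u : `|u| <= s * (B * D) ->
    `|psi w - psi (w - u) - psi1 w * u| <= C * (s * (B * D)) * (s * (B * D)).
  move=> uk; rewrite (le_trans (psi_taylor _ _)) // -mulrA ler_wpM2l // expr2.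
  by rewrite ler_pM.
move=> /(_ l1 l2 (weight_le1 delta)).
have g1 (l : K) (z : K -> R) := dweight_le delta0 l z.
move=> /(_ g1).
have g2 := @weight_lip R Lm.+1 _ _ delta0 k0 sd.
have g3 := @weight_taylor R Lm.+1 _ _ (ltn0Sn Lm) delta0 k0 sd.
move=> /(_ g2 g3).
have WZ0 (l : K) : E (fun x => (\sum_a residual_term a x) * (\sum_a count_term l a
    x)) = 0.
  by rewrite -[RHS](fexp_residual_cnt l); apply: eq_fexp => x /=; rewrite
      sum_residual_term sum_count_term.
move=> /(_ WZ0).
have -> : stein_error d.+1 3 Lm.+1 B s C (weight_const Lm.+1 delta) (C * (s * (B * D)))
   = s * stein_rate.
  by rewrite /stein_error /stein_rate -/D -/B; ring.
move=> main.
(* The Stein equation has the limiting variance [sg ^+ 2], whereas [weighted_stein] produces the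
   actual one; their difference is split off. *)
have -> : E (fun x => (h (s * residual x) - c) * weight delta (fun l : K => s *
    centered_cnt l x)) =
   E (fun x => (s ^+ 2 * E (fun y => (\sum_a residual_term a y) ^+ 2) * psi1 (s *
       \sum_a residual_term a x)
       - s * (\sum_a residual_term a x) * psi (s * \sum_a residual_term a x))
      * weight delta (fun l : K => s * \sum_a count_term l a x))
   + (sg ^+ 2 - s ^+ 2 * E (fun x => residual x ^+ 2))
     * E (fun x => psi1 (s * residual x) * weight delta (fun l : K => s *
         centered_cnt l x)).
  have E2 : E (fun y => (\sum_a residual_term a y) ^+ 2) = E (fun x => residual x ^+ 2).
    by apply: eq_fexp => x; rewrite sum_residual_term.
  rewrite -[X in _ = _ + X]fexpZ -fexpD; apply: eq_fexp => x /=; rewrite E2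
      sum_residual_term.
  have -> : (fun l : K => s * \sum_a count_term l a x) = (fun l : K => s *
      centered_cnt l x).
    by apply/funext => l; rewrite sum_count_term.
  by rewrite -steinE; ring.
apply: (le_trans (ler_normD _ _)); apply: lerD => //.
rewrite normrM ler_wpM2l //; apply: fexp_le_bound => // x.
by rewrite normrM -[leRHS]mulr1 ler_pM // weight_le1.
Qed.

End SteinApplication.

End FiniteModel.

(** * Triangles and edge signs *)

Section GraphModel.
Variables (R : realType) (G : signed_graph) (Lm : nat).
Hypothesis A1 : forall i : edge G, neg G i -> (embeddedness i <= Lm)%N.
Local Notation e := (@embeddedness G).
Local Notation T := (triangles G).
Local Notation K := 'I_Lm.+1.
Local Notation s := ((Num.sqrt #|edge G|%:R)^-1 : R).
Implicit Types (i j k : edge G) (x : signing G).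

Lemma triangle_swap i j k : triangle i j k -> triangle j i k.
Proof.
move=> /existsP[x /existsP[y /existsP[z /and4P[U /eqP Ei /eqP Ej /eqP Ek]]]].
apply/existsP; exists z; apply/existsP; exists y; apply/existsP; exists x.
rewrite Ei Ej Ek; apply/and4P; split; last 3 first.
- by rewrite finset.setUC.
- by rewrite finset.setUC.
- by rewrite finset.setUC.
move: U; rewrite /= !inE !negb_or -!andbA => /and4P[xy xz yz _].
by rewrite ![z == _]eq_sym [y == x]eq_sym xy xz yz.
Qed.

Lemma triangle_rot i j k : triangle j k i -> triangle i j k.
Proof.
move=> /existsP[x /existsP[y /existsP[z /and4P[U /eqP Ej /eqP Ek /eqP Ei]]]].
apply/existsP; exists z; apply/existsP; exists x; apply/existsP; exists y.
rewrite Ei Ej Ek; apply/and4P; split=> //; last 2 first.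
- by rewrite finset.setUC.
- by rewrite finset.setUC.
move: U; rewrite /= !inE !negb_or -!andbA => /and4P[xy xz yz _].
by rewrite ![z == _]eq_sym xy xz yz.
Qed.

Lemma triangle_swap_last i j k : triangle i j k -> triangle i k j.
Proof. by move=> /triangle_rot /triangle_swap. Qed.

Definition nb_tri i : nat := \sum_(q : edge G * edge G) triangle i q.1 q.2.

(** The order of the three edges is forgotten, and each triangle is charged to the position held by
    [i]; symmetry of [triangle] then brings [i] to the front. *)
Lemma triangle_degree i : (\sum_(t in T) touches t i <= 3 * nb_tri i)%N.
Proof.
have tT (t : edge G * edge G * edge G) : t \in T -> triangle t.1.1 t.1.2 t.2.
  by rewrite inE => /and3P[].
have sumE (F : edge G -> edge G -> edge G -> nat) :
    (\sum_(t : edge G * edge G * edge G) F t.1.1 t.1.2 t.2 =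
     \sum_a \sum_b \sum_c F a b c)%N.
  rewrite (pair_big xpredT xpredT (fun a b => \sum_c F a b c)%N) /=.
  by rewrite (pair_big xpredT xpredT (fun ab c => F ab.1 ab.2 c)%N).
have triE : nb_tri i = (\sum_a \sum_b triangle i a b)%N.
  by rewrite (pair_big xpredT xpredT (fun a b => triangle i a b : nat)).
have pick1 (F : edge G -> nat) : (\sum_a (a == i) * F a = F i)%N.
  by rewrite (bigD1 i) //= eqxx mul1n big1 ?addn0 // => a /negbTE ->.
have le1 (t : edge G * edge G * edge G) : ((t \in T) * touches t i <=
   ((t.1.1 == i) * triangle i t.1.2 t.2 + (t.1.2 == i) * triangle i t.1.1 t.2)
    + (t.2 == i) * triangle i t.1.1 t.1.2)%N.
  case: (boolP (t \in T)) => // /tT tri; rewrite mul1n /touches.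
  case: eqP => [<-|_]; first by rewrite tri mul1n -addnA leq_addr.
  case: eqP => [<-|_]; first by rewrite (triangle_swap tri) mul1n addnAC leq_addl.
  by case: eqP => [<-|_] //; rewrite (triangle_rot tri) mul1n leq_addl.
apply: (@leq_trans (\sum_(t : edge G * edge G * edge G) (t \in T) * touches t i)%N).
  rewrite big_mkcond; apply: leq_sum => t _.
  by case: (t \in T); rewrite ?mul1n.
apply: (leq_trans (leq_sum _ (fun t _ => le1 t))).
rewrite !big_split /=.
rewrite (sumE (fun a b c => (a == i) * triangle i b c)%N).
rewrite (sumE (fun a b c => (b == i) * triangle i a c)%N).
rewrite (sumE (fun a b c => (c == i) * triangle i a b)%N).
under eq_bigr => a _.
  under eq_bigr => b _ do rewrite -big_distrr /=.
  rewrite -big_distrr /=; over.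
rewrite pick1.
under [X in (_ + X + _)%N]eq_bigr => a _.
  under eq_bigr => b _ do rewrite -big_distrr /=.
  rewrite pick1; over.
under [X in (_ + X)%N]eq_bigr => a _ do under eq_bigr => b _ do rewrite pick1.
by rewrite -triE; lia.
Qed.

(** [embeddedness] halves [nb_tri] with rounding down; the added 1 absorbs the remainder. *)
Lemma nb_tri_le i : (nb_tri i <= 2 * e i + 1)%N.
Proof.
rewrite -{1}(odd_double_half (nb_tri i)) -/(e i) -mul2n addnC leq_add2l.
by case: (odd _).
Qed.

Definition degree : nat := 3 * (2 * Lm + 1).

Lemma low_degree i : (e i <= Lm)%N -> (\sum_(t in T) touches t i <= degree)%N.
Proof.
move=> ei; apply: (leq_trans (triangle_degree i)); rewrite leq_mul2l /=.
by apply: (leq_trans (nb_tri_le i)); rewrite leq_add2r leq_mul2l.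
Qed.

(** The permutation model fixes the edges of level 0, while a slice lets their signs vary; the
    triangle count must not see this level. Both [(j, k)] and [(k, j)] are counted, so the half is
    at least 1. *)
Lemma touched_pos (t : edge G * edge G * edge G) i : t \in T -> touches t i -> (0 < e
    i)%N.
Proof.
move=> tT ti.
have [j [k [jk tri]]] : exists j k, j != k /\ triangle i j k.
  move: tT; rewrite inE => /and3P[tri r12 r23].
  have n12 : t.1.1 != t.1.2 by apply/eqP => E; move: r12; rewrite E ltnn.
  have n23 : t.1.2 != t.2 by apply/eqP => E; move: r23; rewrite E ltnn.
  have n13 : t.1.1 != t.2.
    by apply/eqP => E; move: (ltn_trans r12 r23); rewrite E ltnn.
  case/or3P: ti => /eqP <-.
  - by exists t.1.2, t.2.
  - by exists t.1.1, t.2; split=> //; exact: triangle_swap.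
  - by exists t.1.1, t.1.2; split=> //; exact: triangle_rot.
have : (2 <= nb_tri i)%N.
  rewrite /nb_tri (bigD1 (j, k)) //= tri (bigD1 (k, j)) /=.
    by rewrite (triangle_swap_last tri).
  by rewrite xpair_eqE negb_and eq_sym jk.
by move=> /half_leq.
Qed.

Lemma nb_unbalancedE x : (nb_unbalanced x)%:R = odd_count R T x.
Proof.
rewrite /nb_unbalanced /odd_count -sum1_card natr_sum big_mkcond [RHS]big_mkcond.
apply: eq_bigr => t _; rewrite !inE; case: [&& triangle _ _ _, _ & _] => //=.
by rewrite /sgn /odd3; case: (x t.1.1); case: (x t.1.2); case: (x t.2);
  rewrite /= ?expr1 ?expr0 ?mulN1r ?mul1r ?opprK ?mul1r ?eqxx.
Qed.

Lemma nb_triangles_neg_13 x : (nb_triangles_neg 1 x)%:R + (nb_triangles_neg 3 x)%:R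
  = odd_count R T x.
Proof.
rewrite /nb_triangles_neg /odd_count -!sum1_card !natr_sum.
rewrite big_mkcond [X in _ + X]big_mkcond [RHS]big_mkcond -big_split.
apply: eq_bigr => t _; rewrite /= !inE; case: [&& triangle _ _ _, _ & _] => /=; last
    by rewrite addr0.
rewrite /odd3; case: (x t.1.1); case: (x t.1.2); case: (x t.2) => /=;
  by rewrite ?addr0 ?add0r.
Qed.

Lemma nb_negE l x : nb_neg l x = count_true e l x.
Proof.
rewrite /nb_neg /count_true -sum1_card big_mkcond [RHS]big_mkcond.
by apply: eq_bigr => i _; rewrite !inE; case: (e i == l); case: (x i).
Qed.

Lemma card_Eset l : #|Eset G l| = level_size e l.
Proof.
by rewrite /level_size -sum1_card big_mkcond [RHS]big_mkcond; apply: eq_bigr => i _;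
    rewrite inE.
Qed.

Definition edge_prob i : R := neg_frac G R (e i).
Definition neg_counts : {ffun K -> nat} := counts e Lm (neg G).
Local Notation P := (bernoulli_prod edge_prob).
Local Notation E := (fexp P).

Lemma edge_prob01 i : 0 <= edge_prob i <= 1.
Proof.
rewrite /edge_prob /neg_frac nb_negE card_Eset divr_ge0 //=.
have [->|n0] := eqVneq (level_size e (e i)) 0%N; first by rewrite invr0 mulr0.
rewrite ler_pdivrMr ?ltr0n ?lt0n // mul1r ler_nat; exact: count_true_le.
Qed.

Lemma edge_prob_high i : (Lm < e i)%N -> edge_prob i = 0.
Proof.
move=> ei; rewrite /edge_prob /neg_frac nb_negE /count_true big1 ?mul0r // => j /eqP ej.
have := @A1 j; case: (neg G j) => // /(_ isT); rewrite ej leqNgt ei //.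
Qed.

Lemma edge_prob_low (l : K) i : e i = l ->
  edge_prob i = (neg_counts l)%:R / (level_size e l)%:R.
Proof. by move=> ei; rewrite /edge_prob /neg_frac nb_negE card_Eset ei ffunE. Qed.

Lemma neg_counts_le (l : K) : (neg_counts l <= level_size e l)%N.
Proof. by rewrite ffunE count_true_le. Qed.

Lemma neg_in_slice : neg G \in slice e neg_counts.
Proof. by rewrite in_slice eqxx andbT; apply/forallP => i; apply/implyP/A1. Qed.

Lemma neg_slice_gt0 : (0 < #|slice e neg_counts|)%N.
Proof. by apply/card_gt0P; exists (neg G); exact: neg_in_slice. Qed.

End GraphModel.

(** * The limiting variance *)

Section CovarianceBlocks.
Variables (R : realType) (G : signed_graph) (Lm : nat).
Hypothesis A1 : forall i : edge G, neg G i -> (embeddedness i <= Lm)%N.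
Hypothesis G0 : (0 < #|edge G|)%N.
Local Notation e := (@embeddedness G).
Local Notation T := (triangles G).
Local Notation K := 'I_Lm.+1.
Local Notation s := ((Num.sqrt #|edge G|%:R)^-1 : R).
Local Notation p := (@edge_prob R G).
Local Notation m := (neg_counts G Lm).
Local Notation P := (bernoulli_prod p).
Local Notation E := (fexp P).
Local Notation VG := (low_odd_count R e Lm T).
Local Notation C := (cov_mx R G Lm).

Let P1 := bernoulli_prod_sum p.

Lemma low_odd_count_low x : low_support e Lm x -> VG x = odd_count R T x.
Proof. by move=> xL; rewrite /low_odd_count low_part_id. Qed.

Lemma low_odd_count_odd_count x : P x != 0 -> VG x = odd_count R T x.
Proof. by apply: low_odd_count_supp; apply: edge_prob_high. Qed.

(** The conditional law appears here: relabelling the given signs averages over the slice that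
    contains them, where the truncated count equals the true one. *)
Lemma strat_fexp_avg (h : R -> R) :
  fexp (@strat_pmf R G) (fun tau => h (s * (@U_strat R G tau - fexp (@indep_pmf R G)
      (@V_indep R G))))
  = slice_avg e m (fun x => h (s * (VG x - E VG))).
Proof.
have EV : fexp (@indep_pmf R G) (@V_indep R G) = E VG.
  by apply: eq_fexp_supp => x Px; rewrite /V_indep nb_unbalancedE
      low_odd_count_odd_count.
have eL i : (e i <= max_embeddedness G)%N by exact: leq_bigmax.
pose F x := h (s * (odd_count R T x - E VG)).
have F0 (x y : {ffun edge G -> bool}) : (forall i, (0 < e i)%N -> x i = y i) -> F x =
    F y.
  move=> xy; congr (h (s * (_ - _))); apply: eq_bigr => t tT.
  by rewrite /odd3 !xy //; apply: (touched_pos tT); rewrite /touches eqxx ?orbT.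
transitivity (@mean_relabel R (edge G) e (max_embeddedness G) F (neg G)).
  by apply: eq_fexp => tau; rewrite EV /F /U_strat nb_unbalancedE.
rewrite (mean_relabel_avg eL F0 (neg_in_slice A1)) /slice_avg; congr (_ / _).
by apply: eq_bigr => x; rewrite in_slice => /andP[xL _]; rewrite /F low_odd_count_low.
Qed.

Lemma fcov_affine (X Y : signing G -> R) (a b : R) :
  fcov P (fun x => s * (X x - a)) (fun x => s * (Y x - b)) = s ^+ 2 * fcov P X Y.
Proof.
have lin (Z W : signing G -> R) c : fcov P (fun x => s * (Z x - c)) W = s * fcov P Z W.
  by rewrite fcovZl // fcovDl (fcov_cstl P1) addr0.
by rewrite lin fcovC lin fcovC; ring.
Qed.

Lemma eq_fcov_supp (X X' Y Y' : signing G -> R) :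
  (forall x, P x != 0 -> X x = X' x) -> (forall x, P x != 0 -> Y x = Y' x) ->
  fcov P X Y = fcov P X' Y'.
Proof.
move=> XX YY; rewrite /fcov (eq_fexp_supp XX) (eq_fexp_supp YY).
by apply: eq_fexp_supp => x Px; rewrite XX ?YY.
Qed.

Definition tri_neg (a : 'I_3) (x : signing G) : R := (nb_triangles_neg a.+1 x)%:R.

Lemma cov_TT a b : C (lshift Lm.+1 a) (lshift Lm.+1 b) = s ^+ 2 * fcov P (tri_neg a)
    (tri_neg b).
Proof.
rewrite mxE -(fcov_affine _ _ (E (tri_neg a)) (E (tri_neg b))).
by apply: eq_fcov => x; rewrite /TM_vec row_mxEl !mxE; congr (_ * (_ - _));
  apply: eq_fexp => y; rewrite mxE.
Qed.

Lemma cov_TM a (l : K) : C (lshift Lm.+1 a) (rshift 3 l) = s ^+ 2 * fcov P (tri_neg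
    a) (cnt R e l).
Proof.
rewrite mxE -(fcov_affine _ _ (E (tri_neg a)) (E (cnt R e l))).
apply: eq_fcov => x; rewrite /TM_vec.
  by rewrite row_mxEl !mxE; congr (_ * (_ - _)); apply: eq_fexp => y; rewrite mxE.
rewrite row_mxEr !mxE nb_negE; congr (_ * (_ - _)); apply: eq_fexp => y.
by rewrite mxE nb_negE.
Qed.

Lemma cov_MM (l l' : K) : C (rshift 3 l) (rshift 3 l') = (l == l')%:R * (s ^+ 2 *
    count_var e p l).
Proof.
rewrite mulrCA -[(l == l')%:R * _](fcov_cnt e p l l').
rewrite mxE -(fcov_affine _ _ (E (cnt R e l)) (E (cnt R e l'))).
by apply: eq_fcov => x; rewrite /TM_vec row_mxEr !mxE nb_negE; congr (_ * (_ - _));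
  apply: eq_fexp => y; rewrite mxE nb_negE.
Qed.

Lemma low_odd_count_tri_neg x : P x != 0 -> VG x = tri_neg ord0 x + tri_neg ord_max x.
Proof. by move=> Px; rewrite low_odd_count_odd_count // -nb_triangles_neg_13. Qed.

Lemma cov_VV : C (lshift Lm.+1 ord0) (lshift Lm.+1 ord0) + C (lshift Lm.+1 ord_max)
    (lshift Lm.+1 ord_max)
  + 2 * C (lshift Lm.+1 ord0) (lshift Lm.+1 ord_max) = s ^+ 2 * fcov P VG VG.
Proof.
rewrite (eq_fcov_supp low_odd_count_tri_neg low_odd_count_tri_neg) !cov_TT fcovDl
    ![fcov P _ (fun x => _ + _)]fcovC.
by rewrite !fcovDl [fcov P (tri_neg ord_max) (tri_neg ord0)]fcovC; ring.
Qed.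

Lemma cov_VM (l : K) : C (lshift Lm.+1 ord0) (rshift 3 l) + C (lshift Lm.+1 ord_max)
    (rshift 3 l)
  = s ^+ 2 * count_cov e Lm p T l.
Proof.
rewrite /count_cov (eq_fcov_supp low_odd_count_tri_neg (fun x _ => erefl)) !cov_TM
    fcovDl; ring.
Qed.

Lemma s_gt0 : 0 < s.
Proof. by rewrite invr_gt0 sqrtr_gt0 ltr0n. Qed.

(** The bound on the slopes in terms of matrix entries; at a level of vanishing variance it forces
    the cross-covariance to vanish at the same rate. *)
Lemma cov_VM_le (l : K) : `|C (lshift Lm.+1 ord0) (rshift 3 l) + C (lshift Lm.+1
    ord_max) (rshift 3 l)|
  <= (degree Lm)%:R * C (rshift 3 l) (rshift 3 l).
Proof.
rewrite cov_VM cov_MM eqxx mul1r mulrCA normrM (ger0_norm (sqr_ge0 _)) ler_wpM2l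
    ?sqr_ge0 //.
by apply: count_cov_le; [exact: edge_prob01|exact: low_degree].
Qed.

Lemma cov_MM_ge0 (l : K) : 0 <= C (rshift 3 l) (rshift 3 l).
Proof.
rewrite cov_MM eqxx mul1r mulr_ge0 ?sqr_ge0 //; apply: count_var_ge0; exact:
    edge_prob01.
Qed.

Lemma residual_variance : s ^+ 2 * E (fun x => residual e p m T x ^+ 2) =
  C (lshift Lm.+1 ord0) (lshift Lm.+1 ord0) + C (lshift Lm.+1 ord_max) (lshift Lm.+1
      ord_max)
  + 2 * C (lshift Lm.+1 ord0) (lshift Lm.+1 ord_max)
  - \sum_(l : K) (C (lshift Lm.+1 ord0) (rshift 3 l) + C (lshift Lm.+1 ord_max)
      (rshift 3 l)) ^+ 2
      / C (rshift 3 l) (rshift 3 l).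
Proof.
rewrite (fexp_residual_sqr (@edge_prob01 R G) (@edge_prob_low R G Lm) (@neg_counts_le
    G Lm) (@low_degree G Lm)).
rewrite cov_VV mulrBr; congr (_ - _); rewrite mulr_sumr; apply: eq_bigr => l _.
rewrite cov_VM cov_MM eqxx mul1r.
have [->|v0] := eqVneq (count_var e p l) 0; first by rewrite mulr0 !invr0 !mulr0.
by have := s_gt0; move: (s) => t t0; field; rewrite v0 gt_eqF.
Qed.

End CovarianceBlocks.

(** * The Schur complement for a diagonal count block *)

Section SchurComplement.
Variables (R : realType) (Lm : nat) (Sigma : 'M[R]_(3 + Lm.+1)).
Local Notation K := 'I_Lm.+1.
Hypothesis diag : forall l l' : K, l != l' -> Sigma (rshift 3 l) (rshift 3 l') = 0.

Lemma Sigma_MM_inv : invmx (Sigma_MM Sigma) =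
  diag_mx (\row_(i < #|kept Sigma|) (Sigma (rshift 3 (enum_val i)) (rshift 3
      (enum_val i)))^-1).
Proof.
set D := diag_mx _.
have DS : D *m Sigma_MM Sigma = 1%:M.
  apply/matrixP => i j; rewrite mul_diag_mx !mxE.
  have [->|ij] := eqVneq i j.
    have := enum_valP j; rewrite inE !mxE => kj.
    by rewrite mulVf.
  have -> : Sigma (rshift 3 (enum_val i)) (rshift 3 (enum_val j)) = 0.
    by apply: diag; apply: contra_neq ij => /enum_val_inj.
  by rewrite mulr0.
have [_ U] := mulmx1_unit DS.
by rewrite -[RHS]mulmx1 -(mulmxV U) mulmxA DS mul1mx.
Qed.

(** [sigma_u2] is the quadratic form of [Sigma_s] at [(1, 0, 1)], that is, for [T_1 + T_3]; a
    diagonal count block turns the correction into a sum of squares over the kept levels. *)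
Lemma sigma_u2E : sigma_u2 Sigma =
  Sigma (lshift Lm.+1 ord0) (lshift Lm.+1 ord0) + Sigma (lshift Lm.+1 ord_max)
      (lshift Lm.+1 ord_max)
  + 2 * Sigma (lshift Lm.+1 ord0) (lshift Lm.+1 ord_max)
  - \sum_(l in kept Sigma) (Sigma (lshift Lm.+1 ord0) (rshift 3 l)
       + Sigma (lshift Lm.+1 ord_max) (rshift 3 l)) ^+ 2 / Sigma (rshift 3 l) (rshift
           3 l).
Proof.
have entry a b : Sigma_s Sigma a b = Sigma (lshift Lm.+1 a) (lshift Lm.+1 b)
   - \sum_(l in kept Sigma) Sigma (lshift Lm.+1 a) (rshift 3 l)
       * Sigma (lshift Lm.+1 b) (rshift 3 l) / Sigma (rshift 3 l) (rshift 3 l).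
  rewrite /Sigma_s Sigma_MM_inv mul_mx_diag !mxE; congr (_ - _).
  rewrite [RHS]big_enum_val; apply: eq_bigr => i _; rewrite !mxE.
  by rewrite mulrAC.
rewrite /sigma_u2 !entry.
have -> : \sum_(l in kept Sigma) (Sigma (lshift Lm.+1 ord0) (rshift 3 l)
       + Sigma (lshift Lm.+1 ord_max) (rshift 3 l)) ^+ 2 / Sigma (rshift 3 l) (rshift
           3 l)
  = \sum_(l in kept Sigma) Sigma (lshift Lm.+1 ord0) (rshift 3 l)
       * Sigma (lshift Lm.+1 ord0) (rshift 3 l) / Sigma (rshift 3 l) (rshift 3 l)
  + \sum_(l in kept Sigma) Sigma (lshift Lm.+1 ord_max) (rshift 3 l)
       * Sigma (lshift Lm.+1 ord_max) (rshift 3 l) / Sigma (rshift 3 l) (rshift 3 l)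
  + 2 * \sum_(l in kept Sigma) Sigma (lshift Lm.+1 ord0) (rshift 3 l)
       * Sigma (lshift Lm.+1 ord_max) (rshift 3 l) / Sigma (rshift 3 l) (rshift 3 l).
  by rewrite mulr_sumr -!big_split; apply: eq_bigr => l _ /=; ring.
by ring.
Qed.

End SchurComplement.

Section VarianceLimit.
Variables (R : realType) (Lm : nat) (Sigma : 'M[R]_(3 + Lm.+1)) (C : nat -> 'M[R]_(3
    + Lm.+1)) (d : R).
Local Notation K := 'I_Lm.+1.
Hypotheses (CS : forall a b, (fun n => C n a b) @ \oo --> Sigma a b)
  (Cdiag : forall n, (0 < n)%N -> forall l l' : K, l != l' -> C n (rshift 3 l)
      (rshift 3 l') = 0)
  (C0 : forall n, (0 < n)%N -> forall l : K, 0 <= C n (rshift 3 l) (rshift 3 l))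
  (Cd : forall n, (0 < n)%N -> forall l : K,
     `|C n (lshift Lm.+1 ord0) (rshift 3 l) + C n (lshift Lm.+1 ord_max) (rshift 3 l)|
     <= d * C n (rshift 3 l) (rshift 3 l)).

Lemma cvg_finsum (A : Type) (r : seq A) (f : A -> nat -> R) (g : A -> R) :
  (forall i, f i @ \oo --> g i) ->
  (fun n => \sum_(i <- r) f i n) @ \oo --> \sum_(i <- r) g i.
Proof.
move=> fg; elim: r => [|i r IH].
  by under eq_fun do rewrite big_nil; rewrite big_nil; exact: cvg_cst.
by under eq_fun do rewrite big_cons; rewrite big_cons; apply: (@cvgD _ R^o).
Qed.

(* Terms with [C n (rshift 3 l) (rshift 3 l) = 0] are 0 by the convention for
    division. *)
Definition schur_variance n : R :=
  C n (lshift Lm.+1 ord0) (lshift Lm.+1 ord0) + C n (lshift Lm.+1 ord_max) (lshift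
      Lm.+1 ord_max)
  + 2 * C n (lshift Lm.+1 ord0) (lshift Lm.+1 ord_max)
  - \sum_(l : K) (C n (lshift Lm.+1 ord0) (rshift 3 l) + C n (lshift Lm.+1 ord_max)
      (rshift 3 l)) ^+ 2
      / C n (rshift 3 l) (rshift 3 l).

Lemma schur_variance_cvg : schur_variance n @[n --> \oo] --> sigma_u2 Sigma.
Proof.
have Sdiag (l l' : K) : l != l' -> Sigma (rshift 3 l) (rshift 3 l') = 0.
  move=> ll'; apply: (cvg_unique _ (@CS (rshift 3 l) (rshift 3 l'))) => //.
  by apply: cvg_near_cst; exists 1%N => // n /= n1; exact: Cdiag.
rewrite sigma_u2E //; apply: (@cvgB _ R^o).
  apply: (@cvgD _ R^o); last by apply: cvgMr; exact: CS.
  by apply: (@cvgD _ R^o); exact: CS.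
rewrite [X in _ --> X]big_mkcond /=.
apply: cvg_finsum => l.
have cl : (C n (lshift Lm.+1 ord0) (rshift 3 l) + C n (lshift Lm.+1 ord_max) (rshift
    3 l)
   @[n --> \oo] --> Sigma (lshift Lm.+1 ord0) (rshift 3 l) + Sigma (lshift Lm.+1
       ord_max) (rshift 3 l)).
  by apply: (@cvgD _ R^o); exact: CS.
have := @CS (rshift 3 l) (rshift 3 l).
case: ifP; rewrite inE !mxE => S0 cS.
  by apply: cvgM; [rewrite expr2; under eq_fun do rewrite expr2; apply: cvgM|exact:
      cvgV].
move/negbFE/eqP: S0 => S0; rewrite S0 in cS.
(* A level of zero limiting variance is absent from [Sigma_s] but present for finite [n]; its term
   is at most [d ^+ 2] times its variance, which tends to 0. *)
have sq : (fun n => d ^+ 2 * C n (rshift 3 l) (rshift 3 l)) @ \oo --> (0 : R).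
  by rewrite -(mulr0 (d ^+ 2)); apply: cvgMr.
apply: (@squeeze_cvgr _ _ _ _ (cst 0) _ _ _ _ _ sq); last exact: cvg_cst.
exists 1%N => // n /= n1; have c0 := C0 n1 l; have cd := Cd n1 l.
rewrite mulr_ge0 ?sqr_ge0 ?invr_ge0 //=.
have [->|cn0] := eqVneq (C n (rshift 3 l) (rshift 3 l)) 0; first by rewrite invr0
    !mulr0.
have cp : 0 < C n (rshift 3 l) (rshift 3 l) by rewrite lt_neqAle eq_sym cn0.
rewrite ler_pdivrMr // -mulrA -expr2 -exprMn -real_normK ?num_real //.
by rewrite lerXn2r ?nnegrE // (le_trans _ cd).
Qed.

End VarianceLimit.

(** * Convergence in law *)

Section Sandwich.
Variables (R : realType) (T : finType) (w X : T -> R).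
Hypotheses (w0 : forall t, 0 <= w t).

Lemma fcdf_ge_ramp a b : a < b -> fexp w (fun t => ramp a b (X t)) <= fcdf w X b.
Proof.
move=> ab; rewrite /fcdf big_mkcond; apply: ler_sum => t _; case: (leP (X t) b) => Xb.
  by rewrite ler_piMr //; case/andP: (ramp01 a b (X t)).
by rewrite (ramp_right ab (ltW Xb)) mulr0.
Qed.

Lemma fcdf_le_ramp a b : a < b -> fcdf w X a <= fexp w (fun t => ramp a b (X t)).
Proof.
move=> ab; rewrite /fcdf big_mkcond; apply: ler_sum => t _; case: (leP (X t) a) => Xa.
  by rewrite (ramp_left ab Xa) mulr1.
by rewrite mulr_ge0 //; case/andP: (ramp01 a b (X t)).
Qed.

End Sandwich.

(** Ramps approximate indicators on both sides, so the limit of each ramp mean need only lie between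
    the two values of the limiting distribution function. *)
Lemma cvg_in_law_ramp (R : realType) (T : nat -> finType) (w X : forall n, T n -> R)
    (mu : set R -> \bar R) :
  (forall n t, 0 <= w n t) ->
  (forall a b : R, a < b -> exists2 c : R,
     fine (mu [set` `]-oo, a]]) <= c <= fine (mu [set` `]-oo, b]])
     & (fun n => fexp (w n) (fun t => ramp a b (X n t))) @ \oo --> c) ->
  cvg_in_law (fun n => fcdf (w n) (X n)) mu.
Proof.
move=> w0 H F x /cvgrPdist_le cF.
apply/cvgrPdist_le => eps eps0; have e2 : 0 < eps / 2 by rewrite divr_gt0.
have [eta /= eta0 Feta] := cF _ e2.
have h0 : 0 < eta / 2 by rewrite divr_gt0.
have near_x y : `|x - y| = eta / 2 -> `|F x - F y| <= eps / 2.
  by move=> xy; apply: Feta; rewrite /ball_ /= xy; lra.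
have xl : x - eta / 2 < x by rewrite gtrBl.
have xr : x < x + eta / 2 by rewrite ltrDl.
(* The ramp descending to 0 at [x] bounds the distribution function from below, and the one starting
   its descent at [x] bounds it from above. *)
have [c1 /andP[Fc1 _] L1'] := H (x - eta / 2) x xl.
have [c2 /andP[_ Fc2] L2'] := H x (x + eta / 2) xr.
move/cvgrPdist_le: (L1') => /(_ _ e2) L1; move/cvgrPdist_le: (L2') => /(_ _ e2) L2.
have F1 : `|F x - F (x - eta / 2)| <= eps / 2.
  by apply: near_x; rewrite opprB addrCA subrr addr0 ger0_norm // ltW.
have F2 : `|F x - F (x + eta / 2)| <= eps / 2.
  by apply: near_x; rewrite opprD addNKr normrN ger0_norm // ltW.
near=> n.
have l1 : `|c1 - fexp (w n) (fun t => ramp (x - eta / 2) x (X n t))| <= eps / 2.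
  by near: n.
have l2 : `|c2 - fexp (w n) (fun t => ramp x (x + eta / 2) (X n t))| <= eps / 2.
  by near: n.
have u1 := fcdf_ge_ramp (X n) (w0 n) xl.
have u2 := fcdf_le_ramp (X n) (w0 n) xr.
move: l1 l2 F1 F2 Fc1 Fc2; rewrite !ler_norml -!/(F _).
by move=> /andP[? ?] /andP[? ?] /andP[? ?] /andP[? ?] ? ?; apply/andP; split; lra.
Unshelve. all: by end_near. Qed.

(** * Limit of the ramp means under the permutation model *)

Section Assembly.
Variables (R : realType) (G : nat -> signed_graph) (Lm : nat).
Hypotheses (hedges : forall n, (0 < n)%N -> #|edge (G n)| = n)
  (A1 : forall n, (0 < n)%N -> forall i : edge (G n), neg (G n) i -> (embeddedness i
      <= Lm)%N).
Local Notation e n := (@embeddedness (G n)).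
Local Notation p n := (@edge_prob R (G n)).
Local Notation m n := (neg_counts (G n) Lm).
Local Notation T n := (triangles (G n)).
Local Notation s n := ((Num.sqrt #|edge (G n)|%:R)^-1 : R).
Local Notation E n := (fexp (bernoulli_prod (p n))).
Local Notation d := (degree Lm).

Definition local_error (h : R -> R) (c delta : R) (n : nat) : R :=
  `|E n (fun x => (h (s n * residual (e n) (p n) (m n) (T n) x) - c)
      * weight delta (fun l : 'I_Lm.+1 => s n * centered_cnt R (e n) (m n) l x))|.

Definition strat_stat (n : nat) (tau : strat_sample (G n)) : R :=
  (Num.sqrt n%:R)^-1 * (@U_strat R (G n) tau - fexp (@indep_pmf R (G n)) (@V_indep R
      (G n))).

Lemma inv_sqrt_cvg0 : (fun n => s n) @ \oo --> (0 : R).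
Proof.
apply/cvgrPdist_le => eps eps0; near=> n.
have n0 : (0 < n)%N by near: n; exists 1%N.
rewrite sub0r normrN hedges // ger0_norm ?invr_ge0 ?sqrtr_ge0 //.
have nR : 0 < n%:R :> R by rewrite ltr0n.
rewrite -[eps]invrK lef_pV2 ?posrE ?sqrtr_gt0 ?invr_gt0 //.
rewrite -[_^-1]ger0_norm ?invr_ge0 ?(ltW eps0) // -sqrtr_sqr ler_wsqrtr //.
near: n; exact: nbhs_infty_ger.
Unshelve. all: by end_near. Qed.

Lemma mean_cvg (h : R -> R) (Lh c : R) : 0 <= Lh ->
  (forall u v, `|h u - h v| <= Lh * `|u - v|) ->
  (forall delta, 0 < delta -> local_error h c delta @ \oo --> (0 : R)) ->
  (fun n => fexp (@strat_pmf R (G n)) (fun tau => h (strat_stat tau))) @ \oo --> c.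
Proof.
move=> Lh0 hL herr; apply/cvgrPdist_le => eps eps0.
pose A := Lh * (d%:R * Lm.+1%:R).
have A0 : 0 <= A by rewrite !mulr_ge0 ?ler0n.
(* Makes the bias [2 * A * delta] of the window at most [eps / 2]. *)
pose delta := eps / (4 * A + 1).
have delta0 : 0 < delta by rewrite divr_gt0 //; lra.
have bd : 2 * (Lh * (d%:R * (Lm.+1%:R * delta))) <= eps / 2.
  have -> : 2 * (Lh * (d%:R * (Lm.+1%:R * delta))) = 2 * A * delta by rewrite /A; ring.
  rewrite /delta mulrA ler_pdivrMr; last by lra.
  nra.
(* [r] depends on [delta] but not on [n], so the factor [Mr] stays fixed while the local error tends
   to 0. *)
pose r := Num.truncn (32 * Lm.+1%:R ^+ 2 / delta).
have hr : 32 * Lm.+1%:R ^+ 2 <= delta * r.+1%:R.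
  rewrite [leRHS]mulrC -ler_pdivrMr //; apply: ltW; exact: truncnS_gt.
pose Mr : R := 8 * ((2 * r.+1) ^ Lm.+1)%N%:R.
have Mr0 : 0 < Mr by rewrite mulr_gt0 // ltr0n expn_gt0.
have em : 0 < eps / 2 / Mr by rewrite !divr_gt0.
move/cvgrPdist_le: (herr _ delta0) => /(_ _ em) L.
near=> n.
have n0 : (0 < n)%N by near: n; exists 1%N.
have N0 : (0 < #|edge (G n)|)%N by rewrite hedges.
have le : `|0 - local_error h c delta n| <= eps / 2 / Mr by near: n.
rewrite sub0r normrN ger0_norm ?normr_ge0 // in le.
have -> : fexp (@strat_pmf R (G n)) (fun tau => h (strat_stat tau)) =
   slice_avg (e n) (m n) (fun x => h (s n * (low_odd_count R (e n) Lm (T n) x - E n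
       (low_odd_count R (e n) Lm (T n))))).
  by rewrite -(strat_fexp_avg (A1 n0)) /strat_stat hedges.
have := transfer (@edge_prob01 R (G n)) (edge_prob_high R (A1 n0))
  (fun l i => @edge_prob_low R (G n) Lm l i) (@neg_counts_le (G n) Lm) (neg_slice_gt0
      (A1 n0))
  (fun i => @low_degree (G n) Lm i) N0 delta0 Lh0 hL hr le.
rewrite distrC => /le_trans; apply; rewrite -/Mr.
have -> : Mr * (eps / 2 / Mr) = eps / 2 by field; rewrite gt_eqF.
by lra.
Unshelve. all: by end_near. Qed.

Variable Sigma : 'M[R]_(3 + Lm.+1).
Hypothesis hSigma : forall a b : 'I_(3 + Lm.+1),
  (fun n : nat => cov_mx R (G n) Lm a b) @ \oo --> Sigma a b.

Definition residual_var n : R := s n ^+ 2 * E n (fun x => residual (e n) (p n) (m n)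
    (T n) x ^+ 2).

Lemma residual_var_ge0 n : 0 <= residual_var n.
Proof.
rewrite mulr_ge0 ?sqr_ge0 // fexp_ge0 //; last by move=> x; exact: sqr_ge0.
by move=> x; apply: bernoulli_prod_ge0; exact: edge_prob01.
Qed.

Lemma residual_var_cvg : residual_var @ \oo --> sigma_u2 Sigma.
Proof.
have H : schur_variance (fun n => cov_mx R (G n) Lm) @ \oo --> sigma_u2 Sigma.
  apply: (@schur_variance_cvg _ _ _ _ d%:R hSigma) => n n0 => [l l' ll'|l|l].
  - by rewrite cov_MM (negbTE ll') mul0r.
  - exact: cov_MM_ge0.
  - exact: (cov_VM_le R (A1 n0)).
apply: cvg_trans H; apply: near_eq_cvg; near=> n.
have n0 : (0 < n)%N by near: n; exists 1%N.
rewrite /residual_var residual_variance // ?hedges //; exact: A1.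
Unshelve. all: by end_near. Qed.

Lemma sigma_u2_ge0 : 0 <= sigma_u2 Sigma.
Proof.
rewrite -(cvg_lim _ residual_var_cvg) //; apply: limr_ge.
  by apply/cvg_ex; exists (sigma_u2 Sigma); exact: residual_var_cvg.
by apply: nearW => n; exact: residual_var_ge0.
Qed.

(** With limiting variance 0 the rescaled residual tends to 0 in mean square, so [h] may be replaced
    by its value at 0; no Stein equation enters. *)
Lemma local_error_degenerate (h : R -> R) (Lh delta : R) : 0 <= Lh ->
  (forall u v, `|h u - h v| <= Lh * `|u - v|) -> sigma_u2 Sigma = 0 ->
  local_error h (h 0) delta @ \oo --> (0 : R).
Proof.
move=> Lh0 hL v0.
have H : (fun n => Lh * Num.sqrt (residual_var n)) @ \oo --> (0 : R).
  rewrite -(mulr0 Lh); apply: cvgMr; rewrite -(sqrtr0 R) -v0.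
  by apply: continuous_cvg; [exact: sqrt_continuous|exact: residual_var_cvg].
apply: (@squeeze_cvgr _ _ _ _ (cst 0) _ _ _ _ _ H); last exact: cvg_cst.
apply: nearW => n; rewrite /= normr_ge0 /=.
have P0 := bernoulli_prod_ge0 (@edge_prob01 R (G n)).
have P1 := bernoulli_prod_sum (p n).
apply: (le_trans (ler_norm_fexp P0 _)).
apply: (@le_trans _ _ (E n (fun x => Lh * `|s n * residual (e n) (p n) (m n) (T n)
    x|))).
  apply: le_fexp => // x; rewrite normrM -[leRHS]mulr1; apply: ler_pM => //.
    by rewrite (le_trans (hL _ _)) // subr0.
  exact: weight_le1.
rewrite fexpZ ler_wpM2l // (le_trans (fexp_norm_le_sqrt P0 P1 _)) // ler_wsqrtr //.
by rewrite /residual_var -fexpZ le_eqVlt; apply/orP; left; apply/eqP; apply: eq_fexp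
    => x; rewrite exprMn.
Qed.

Lemma local_error_gaussian (h psi psi1 : R -> R) (c C sg delta : R) :
  0 < delta -> 0 <= C -> sg ^+ 2 = sigma_u2 Sigma ->
  (forall u, sg ^+ 2 * psi1 u - u * psi u = h u - c) ->
  (forall u, `|psi u| <= C) -> (forall u, `|psi1 u| <= C) ->
  (forall w u, `|psi w - psi (w - u)| <= C * `|u|) ->
  (forall w u, `|psi w - psi (w - u) - psi1 w * u| <= C * `|u| ^+ 2) ->
  local_error h c delta @ \oo --> (0 : R).
Proof.
move=> delta0 C0 sgE steinE psiC psi1C psi_lip psi_taylor.
have H : (fun n => s n * stein_rate Lm d delta C + `|sg ^+ 2 - residual_var n| * C) @
    \oo --> (0 : R).
  rewrite -[0](_ : 0 * stein_rate Lm d delta C + `|sg ^+ 2 - sigma_u2 Sigma| * C =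
      0); last first.
    by rewrite sgE subrr normr0 !mul0r addr0.
  apply: (@cvgD _ R^o); apply: cvgMl; first exact: inv_sqrt_cvg0.
  apply: (@cvg_norm _ R^o); apply: (@cvgB _ R^o); [exact: cvg_cst|exact:
      residual_var_cvg].
apply: (@squeeze_cvgr _ _ _ _ (cst 0) _ _ _ _ _ H); last exact: cvg_cst.
pose BD : R := d.+1%:R * (3 * d.+1)%N%:R.
have BD0 : 0 < BD by rewrite mulr_gt0 ?ltr0n.
have dB : 0 < delta / BD by rewrite divr_gt0.
move/cvgrPdist_le: inv_sqrt_cvg0 => /(_ _ dB) L.
near=> n; rewrite /= normr_ge0 /=.
have n0 : (0 < n)%N by near: n; exists 1%N.
have N0 : (0 < #|edge (G n)|)%N by rewrite hedges.
have sd : s n * BD <= delta.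
  have : `|0 - s n| <= delta / BD by near: n.
  by rewrite sub0r normrN ger0_norm ?invr_ge0 ?sqrtr_ge0 // ler_pdivlMr.
exact: (stein_application (@edge_prob01 R (G n)) (fun l i => @edge_prob_low R (G n)
    Lm l i)
  (@neg_counts_le (G n) Lm) (fun i => @low_degree (G n) Lm i) N0 delta0 sd C0 steinE
      psiC psi1C
  psi_lip psi_taylor).
Unshelve. all: by end_near. Qed.

Lemma strat_mean_ramp_cvg (a b : R) : a < b -> exists2 c : R,
   fine (gaussian (sigma_u2 Sigma) [set` `]-oo, a]]) <= c
      <= fine (gaussian (sigma_u2 Sigma) [set` `]-oo, b]])
   & (fun n => fexp (@strat_pmf R (G n)) (fun tau => ramp a b (strat_stat tau))) @
       \oo --> c.
Proof.
move=> ab; have Lh0 : 0 <= (b - a)^-1 by rewrite invr_ge0 subr_ge0 ltW.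
have hL := ramp_lip ab.
have [v0|vn0] := eqVneq (sigma_u2 Sigma) 0.
  exists (ramp a b 0).
    rewrite /gaussian v0 eqxx !diracE /=.
    have memE y : (0 : R) \in [set` `]-oo, y]] = (0 <= y).
      by rewrite mem_setE in_itv.
    rewrite !memE; have /andP[r0 r1] := ramp01 a b 0.
    apply/andP; split.
      by case: (leP 0 a) => a0 /=; rewrite ?(ramp_left ab a0).
    by case: (leP 0 b) => b0 /=; rewrite ?(ramp_right ab (ltW b0)).
  by apply: (mean_cvg Lh0 hL) => delta delta0; apply: (local_error_degenerate _ Lh0
      hL v0).
pose sg := Num.sqrt (sigma_u2 Sigma).
have sg0 : 0 < sg by rewrite sqrtr_gt0 lt_neqAle eq_sym vn0 sigma_u2_ge0.
have sgE : sg ^+ 2 = sigma_u2 Sigma by rewrite sqr_sqrtr ?sigma_u2_ge0.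
have [psi [psi1 [c [C [Fc C0 steinE [psiC psi1C lip tay]]]]]] := stein_solution sg0 ab.
exists c; first by rewrite /gaussian (negbTE vn0).
apply: (mean_cvg Lh0 hL) => delta delta0.
exact: (local_error_gaussian delta0 C0 sgE steinE psiC psi1C lip tay).
Qed.

End Assembly.

Unset Implicit Arguments.

Theorem theorem2 (R : realType) (G : nat -> signed_graph) (Lm : nat)
  (Sigma : 'M[R]_(3 + Lm.+1))
  (hedges : forall n : nat, (0 < n)%N -> #|edge (G n)| = n)
  (A1 : forall n : nat, (0 < n)%N -> forall i : edge (G n),
     neg (G n) i -> (embeddedness i <= Lm)%N)
  (A2 : (fun n : nat =>
           (\max_(i : edge (G n)) embeddedness i ^ 2)%N%:R / n%:R : R)
          @ \oo --> (0 : R))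
  (A3_triangles : forall l1 l2 l3 : nat,
     (l1 <= Lm)%N -> (l2 <= Lm)%N -> (l3 <= Lm)%N ->
     cvg ((fun n : nat => tri_density (G n) R l1 l2 l3) @ \oo))
  (A3_triangle_pairs : forall l1 l2 l3 l4 l5 : nat,
     (l1 <= Lm)%N -> (l2 <= Lm)%N -> (l3 <= Lm)%N -> (l4 <= Lm)%N ->
     (l5 <= Lm)%N ->
     cvg ((fun n : nat => tri_pair_density (G n) R l1 l2 l3 l4 l5) @ \oo))
  (A3_neg_frac : forall l : nat, (l <= Lm)%N ->
     cvg ((fun n : nat => neg_frac (G n) R l) @ \oo))
  (hSigma : forall a b : 'I_(3 + Lm.+1),
     (fun n : nat => cov_mx R (G n) Lm a b) @ \oo --> Sigma a b) :
  cvg_in_law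
    (fun n : nat =>
       fcdf (@strat_pmf R (G n))
         (fun tau => (Num.sqrt n%:R)^-1 *
            (@U_strat R (G n) tau
             - fexp (@indep_pmf R (G n)) (@V_indep R (G n)))))
    (gaussian (sigma_u2 Sigma)).
Proof.
apply: cvg_in_law_ramp => [n tau|a b ab].
  (* [strat_pmf] is [level_pmf] for the function [embeddedness], up to conversion. *)
  exact: (@level_pmf_ge0 R (edge (G n)) (@embeddedness (G n))).
exact: (strat_mean_ramp_cvg hedges A1 hSigma ab).
Qed.
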